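(* Let $G$ be a $6$-regular graph on $n$ vertices. Then $G$ has a path partition with at most $\frac{n}{7}$ components; that is, $\pi_p(G)\le \frac{n}{7}$.
   Context: All graphs are finite, simple and undirected. A path partition of a graph $G=(V,E)$ is a set of vertex-disjoint paths of $G$ (a single vertex is allowed as a path) whose vertex sets together cover $V$; its members are called components. $\pi_p(G)$ denotes the minimum number of components of a path partition of $G$. *)

(* Defs.v *)
From mathcomp Require Import all_boot.
Set Implicit Arguments. Unset Strict Implicit. Unset Printing Implicit Defensive.

Definition simple_graph (T : finType) (e : rel T) : Prop :=
  symmetric e /\ irreflexive e.

Definition nbhd (T : finType) (e : rel T) (v : T) : {set T} := [set u | e v u].

Definition regular (T : finType) (e : rel T) (k : nat) : Prop :=
  forall v : T, #|nbhd e v| = k.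

Definition is_graph_path (T : finType) (e : rel T) (p : seq T) : bool :=
  [&& p != [::], uniq p & sorted e p].

Definition is_path_partition (T : finType) (e : rel T) (P : seq (seq T)) : Prop :=
  (forall p, p \in P -> is_graph_path e p) /\
  uniq (flatten P) /\
  (forall v : T, v \in flatten P).

(* Main.v *)
Require Import Defs.
From mathcomp Require Import all_boot all_fingroup zify.
From Stdlib Require Classical_Prop.
Set Implicit Arguments. Unset Strict Implicit. Unset Printing Implicit Defensive.

(** Among the path partitions with the fewest paths, take one, P, that minimizes
    3 (number of singletons) + (number of paths on three vertices).  Two ends of
    different paths are never adjacent, and if the ends of a path are adjacent
    then every vertex of that path can be rotated into an end.

    Call "slots" the places where a path can be extended, and let the core S be
    the least set that contains every vertex seeing at least three slots and every
    neighbour of a vertex all of whose links (path edges) go into S.  If a core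
    vertex were an end of another path partition of the same size which leaves the
    slots intact, one could hop back along the generation of S until a vertex with
    three slots is exposed, and then merge two paths.  Hence core vertices are
    inner vertices of paths with non-adjacent ends, and no two of them are linked.

    Every vertex now starts with charge 12 and pays 6 to each linked core vertex, 6
    to each path end, 3 to each vertex whose two links go into S, and 2 to each
    vertex of another path that closes up to a cycle.  A vertex outside S sees at
    most two slots, so it can afford this.  The few remaining deficits, at paths on
    one or three vertices, are covered by extra payments whose legitimacy follows
    from the second minimization.  Every path ends up with at least 84 = 7 * 12. *)

(** * Paths as sequences, and their links *)

Section ListLinks.
Variable T : finType.
Implicit Types (s l r D : seq T) (Q : seq (seq T)) (x y a b : T).

(** Three slots are the right threshold for the core: one may be spent when the vertex is exposed,
    one may be the far end of its own path, and the third can be joined. The obstacle in hopping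
    back is that an exchange must not break the links on which earlier levels rest. Saturated
    vertices stay out of the way only because levels contain no links, so that fact belongs to the
    same induction; it is proved with two exposed ends and one path too many, from which two paths
    are saved.

    The payments are fixed by tight cases. An end has 12 and gets 6 over five non-links: 42 is half
    of 84. Bonuses aside, a core vertex gets 12 and pays at most four times 6. Outside the core, one
    end and three flexible neighbours cost 6 + 3 * 2 = 12. A vertex between two core vertices
    recovers its 12 as 4 * 3. A singleton needs 72 from six neighbours, hence a bonus of 6 on top of
    6. A three-vertex path with core centre must cover 12 + 4 * 2 from 5 * (2 + 2), hence the bonus
    2. The penalty 3 of a singleton exceeds that of two three-vertex paths. *)

Fixpoint consec s x y :=
  match s with
  | a :: ((b :: _) as s') =>
      [|| (a == x) && (b == y), (a == y) && (b == x) | consec s' x y]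
  | _ => false
  end.

Definition same_pair a b x y := ((a == x) && (b == y)) || ((a == y) && (b == x)).

Lemma same_pairC a b x y : same_pair a b x y = same_pair b a x y.
Proof. by rewrite /same_pair orbC; congr (_ || _); rewrite andbC. Qed.

Lemma same_pair_sym a b x y : same_pair a b x y = same_pair a b y x.
Proof. by rewrite /same_pair orbC. Qed.

Lemma consec_cons2 a b s x y :
  consec (a :: b :: s) x y = same_pair a b x y || consec (b :: s) x y.
Proof. by rewrite /same_pair /= orbA. Qed.

Lemma consec_cat l a b r x y :
  consec (rcons l a ++ b :: r) x y = [|| consec (rcons l a) x y, same_pair a b x y | consec (b :: r) x y].
Proof.
elim: l => [|c [|d l] IH]; first by rewrite [rcons _ _ ++ _]/= consec_cons2.
  by rewrite [rcons _ _ ++ _]/= !consec_cons2 /= orbF.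
by move: IH; rewrite !rcons_cons !cat_cons => IH; rewrite !consec_cons2 IH !orbA.
Qed.

Lemma consec_sym s x y : consec s x y = consec s y x.
Proof.
elim: s => [|a [|b s] IH] //; rewrite !consec_cons2 IH; by rewrite same_pair_sym.
Qed.

Lemma consec_rev s x y : consec (rev s) x y = consec s x y.
Proof.
elim: s => [|a [|b s] IH] //.
rewrite consec_cons2 -IH (rev_cons a) -cats1 (rev_cons b) consec_cat.
by rewrite same_pairC orbF orbC.
Qed.

Lemma consec_mem s x y : consec s x y -> (x \in s) && (y \in s).
Proof.
elim: s => [|a [|b s] IH] //; rewrite consec_cons2 => /orP[|/IH/andP[h1 h2]].
  by case/orP => /andP[/eqP -> /eqP ->]; rewrite !inE !eqxx ?orbT.
by rewrite (in_cons a) h1 orbT (in_cons a) h2 orbT.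
Qed.

Lemma consec_irr s x : uniq s -> consec s x x = false.
Proof.
elim: s => [|a [|b s] IH] // /andP[an un]; rewrite consec_cons2 IH //.
apply/negbTE; rewrite orbF /same_pair orbb; apply/negP => /andP[/eqP xa /eqP xb].
by move: an; rewrite xa xb inE eqxx.
Qed.

(** [last x l] and [head x r] fall back on [x] when a neighbour is missing; the factor [y != x]
    discards this default, so one formula serves ends and inner vertices alike. *)
Lemma consec_around l x r y : uniq (l ++ x :: r) ->
  consec (l ++ x :: r) x y = (y != x) && ((y == last x l) || (y == head x r)).
Proof.
have consl (s : seq T) : uniq (x :: s) -> consec (x :: s) x y = (y != x) && (y == head x s).
  case: s => [|b s]; first by rewrite /= andNb.
  rewrite consec_cons2 => /andP[xn un].
  have bx : (b == x) = false by apply: contraNF xn => /eqP ->; rewrite inE eqxx.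
  have -> : consec (b :: s) x y = false by apply: contraNF xn => /consec_mem/andP[].
  rewrite /same_pair bx eqxx andbF !orbF /= (eq_sym b).
  by case: (y =P b) => [->|]; rewrite ?bx ?andbF.
case/lastP: l => [|l a] un.
  by rewrite cat0s consl // [last _ _]/=; case: (y == x).
rewrite consec_cat consl; last by move: un; rewrite cat_uniq => /and3P[].
rewrite last_rcons.
move: un; rewrite cat_uniq => /and3P[_ /hasPn hn _].
have xn : x \notin rcons l a by apply: hn; rewrite inE eqxx.
have -> : consec (rcons l a) x y = false by apply: contraNF xn => /consec_mem/andP[].
have ax : (a == x) = false.
  by apply: contraNF xn => /eqP ->; rewrite mem_rcons inE eqxx.
rewrite /same_pair ax eqxx andbT /= (eq_sym a) andb_orr; congr (_ || _).
by case: (y =P a) => [->|]; rewrite ?ax ?andbF.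
Qed.

Lemma consec_edge (e : rel T) s x y : symmetric e -> sorted e s -> consec s x y -> e x y.
Proof.
move=> es; elim: s => [|a [|b s] IH] // /= /andP[ab pb] /or3P[||]; last exact: IH.
  by case/andP => /eqP <- /eqP <-.
by case/andP => /eqP <- /eqP <-; rewrite es.
Qed.

Definition linked Q x y := has (fun D => consec D x y) Q.

Lemma linked_cons D Q x y : linked (D :: Q) x y = consec D x y || linked Q x y.
Proof. by []. Qed.

Lemma linked_perm Q Q' x y : perm_eq Q Q' -> linked Q x y = linked Q' x y.
Proof. by move=> /perm_mem pq; rewrite /linked; apply: eq_has_r => D; rewrite pq. Qed.

Lemma linked_sym Q x y : linked Q x y = linked Q y x.
Proof. by rewrite /linked; apply: eq_has => D; rewrite consec_sym. Qed.

End ListLinks.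

(** * Path partitions as lists of sequences *)

Section Partitions.
Variables (T : finType) (e : rel T).
Hypothesis e_sym : symmetric e.
Implicit Types (l r D : seq T) (Q : seq (seq T)) (x y a b : T).

Definition ppart Q := [&& all (is_graph_path e) Q, uniq (flatten Q) & [forall v, v \in flatten Q]].

Lemma ppartP Q : reflect (is_path_partition e Q) (ppart Q).
Proof.
apply: (iffP and3P) => [[/allP h1 h2 /forallP h3]|[h1 [h2 h3]]]; first by split.
by split=> //; [apply/allP | apply/forallP].
Qed.

Lemma ppart_perm Q Q' : perm_eq Q Q' -> ppart Q = ppart Q'.
Proof.
move=> pq; rewrite /ppart (perm_all _ pq); have pf := perm_flatten pq.
rewrite (perm_uniq pf); congr [&& _, _ & _].
by apply: eq_forallb => v; rewrite (perm_mem pf).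
Qed.

Lemma ppart_head_perm D D' Q : is_graph_path e D' -> perm_eq D D' ->
  ppart (D :: Q) -> ppart (D' :: Q).
Proof.
move=> pD' pd /and3P[/andP[_ aQ] uQ /forallP fQ].
have pf : perm_eq (flatten (D :: Q)) (flatten (D' :: Q)) by rewrite /= perm_cat2r.
apply/and3P; split; first by apply/andP.
  by rewrite -(perm_uniq pf).
by apply/forallP => v; rewrite -(perm_mem pf).
Qed.

Lemma graph_path_rev D : is_graph_path e (rev D) = is_graph_path e D.
Proof.
rewrite /is_graph_path rev_uniq rev_sorted.
have -> : (rev D != [::]) = (D != [::]).
  by rewrite -!size_eq0 size_rev.
by congr [&& _, _ & _]; apply: eq_sorted => x y; rewrite e_sym.
Qed.

Lemma ppart_rev D Q : ppart (D :: Q) -> ppart (rev D :: Q).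
Proof.
move=> h; apply: (ppart_head_perm _ _ h); first by rewrite graph_path_rev; case/and3P: h => /andP[].
by rewrite perm_sym perm_rev.
Qed.

Lemma graph_path_cat D1 D2 x : D1 != [::] -> D2 != [::] ->
  is_graph_path e (D1 ++ D2) =
  [&& is_graph_path e D1, is_graph_path e D2, ~~ has (mem D1) D2 & e (last x D1) (head x D2)].
Proof.
case/lastP: D1 => // l a _; case: D2 => // b r _.
have h1 : is_graph_path e (rcons l a) = uniq (rcons l a) && sorted e (rcons l a).
  by rewrite /is_graph_path; case: (l).
rewrite h1 /is_graph_path.
have -> : (rcons l a ++ b :: r != [::]) by case: (l).
have -> : sorted e (rcons l a ++ b :: r) = [&& sorted e (rcons l a), e a b & path e b r].
  by case: l {h1} => [|c l] //=; rewrite cat_path /= last_rcons.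
rewrite cat_uniq last_rcons [sorted e (b :: r)]/= [head _ _]/=.
case: (uniq (rcons l a)); case: (sorted e (rcons l a)); rewrite ?andbF //=.
case: (path e b r); rewrite ?andbF //.
case: (b \in rcons l a); case: (has _ r); case: (e a b); case: (b \in r); case: (uniq r) => //=.
Qed.

Lemma ppart_cat D1 D2 Q x : D1 != [::] -> D2 != [::] ->
  ppart ((D1 ++ D2) :: Q) = ppart (D1 :: D2 :: Q) && e (last x D1) (head x D2).
Proof.
move=> n1 n2; rewrite /ppart [all _ _]/= (graph_path_cat x n1 n2) /= catA.
have -> : uniq ((D1 ++ D2) ++ flatten Q) = uniq ((D1 ++ D2) ++ flatten Q) && ~~ has (mem D1) D2.
  by rewrite [uniq _]cat_uniq [uniq (D1 ++ _)]cat_uniq; case: (has (mem D1) D2); rewrite ?andbF ?andbT.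
case: (is_graph_path e D1) => //=; case: (is_graph_path e D2) => //=.
case: (~~ has _ _) => /=; last by rewrite !andbF.
rewrite !andbT; case: (e _ _) => /=; rewrite ?andbT ?andbF //.
Qed.

Lemma ppart_mem Q v : ppart Q -> exists2 D, D \in Q & v \in D.
Proof. by case/and3P => _ _ /forallP/(_ v)/flattenP. Qed.

Lemma ppart_path Q D : ppart Q -> D \in Q -> is_graph_path e D.
Proof. by case/and3P => /allP h _ _ /h. Qed.

Lemma ppart_rem Q D : D \in Q -> perm_eq Q (D :: rem D Q).
Proof. exact: perm_to_rem. Qed.

Lemma ppart_uniq Q D : ppart Q -> D \in Q -> uniq D.
Proof. by move=> h /(ppart_path h)/and3P[]. Qed.

Lemma ppart_disj D Q v : ppart (D :: Q) -> v \in D -> forall D', D' \in Q -> v \notin D'.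
Proof.
case/and3P => _ /=; rewrite cat_uniq => /and3P[_ /hasPn hn _] _ vD D' D'Q.
by apply/negP => vD'; have := hn v; rewrite vD => /(_ _)/negP; apply => //; apply/flattenP; exists D'.
Qed.

Lemma ppart_same Q D D' v : ppart Q -> D \in Q -> D' \in Q -> v \in D -> v \in D' -> D = D'.
Proof.
move=> h DQ D'Q vD vD'; apply/eqP; apply: contraT => nDD'.
have h' : ppart (D :: rem D Q) by rewrite -(ppart_perm (ppart_rem DQ)).
have : D' \in rem D Q.
  by move: D'Q; rewrite (perm_mem (ppart_rem DQ)) inE eq_sym (negbTE nDD').
by move/(ppart_disj h' vD); rewrite vD'.
Qed.

Lemma linked_in Q D x y : ppart Q -> D \in Q -> x \in D -> linked Q x y = consec D x y.
Proof.
move=> h DQ xD; apply/hasP/idP => [[D' D'Q h']|h']; last by exists D.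
by case/andP: (consec_mem h') => xD' _; rewrite (ppart_same h DQ D'Q xD xD').
Qed.

Lemma linked_edge Q x y : ppart Q -> linked Q x y -> e x y.
Proof. by move=> h /hasP[D /(ppart_path h)/and3P[_ _ sD]]; apply: consec_edge. Qed.

Lemma linked_irr Q x : ppart Q -> linked Q x x = false.
Proof.
move=> h; apply/negP => /hasP[D DQ]; by rewrite consec_irr // (ppart_uniq h).
Qed.

End Partitions.

(** * Cutting and joining links *)

Section LinearForests.
Variables (T : finType) (e : rel T).
Hypothesis e_sym : symmetric e.
Implicit Types (s l r D : seq T) (Q R : seq (seq T)) (x y a b : T) (M : rel T).

Definition links M x : {set T} := [set y | M x y].
Definition deg M x := #|links M x|.
Definition del_link M x y : rel T := fun u v => M u v && ~~ same_pair x y u v.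
Definition add_link M x y : rel T := fun u v => M u v || same_pair x y u v.
(** A linear forest with [k] components, known only through its link relation: order and orientation
    of the paths are forgotten, and exchanges become local edits that degrees and connectivity can
    track. *)
Definition LF k M := exists Q, [/\ ppart e Q, size Q = k & forall x y, M x y = linked Q x y].

Lemma linked_rev D R x y : linked (rev D :: R) x y = linked (D :: R) x y.
Proof. by rewrite !linked_cons consec_rev. Qed.

Lemma comp_front Q D : ppart e Q -> D \in Q ->
  exists R, [/\ ppart e (D :: R), size Q = (size R).+1 & forall x y, linked Q x y = linked (D :: R) x y].
Proof.
move=> h DQ; have pq := perm_to_rem DQ; exists (rem D Q); split.
- by rewrite -(ppart_perm e pq).
- by rewrite (perm_size pq).
- by move=> x y; apply: linked_perm.
Qed.

Lemma comp_frontr Q D : ppart e Q -> D \in Q ->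
  exists R, [/\ ppart e (rev D :: R), size Q = (size R).+1 & forall x y, linked Q x y = linked (rev D :: R) x y].
Proof.
move=> h /(comp_front h)[R [h1 h2 h3]]; exists R; split=> //; first exact: ppart_rev.
by move=> x y; rewrite h3 linked_rev.
Qed.

Lemma consec_split D x y : consec D x y ->
  exists l r, D = rcons l x ++ y :: r \/ rev D = rcons l x ++ y :: r.
Proof.
elim: D => [|a [|b s] IH] //; rewrite consec_cons2 => /orP[/orP[]|].
- by case/andP => /eqP -> /eqP ->; exists [::], s; left.
- case/andP => /eqP -> /eqP ->; exists (rev s), [::]; right.
  by rewrite !rev_cons -cats1 cat_rcons.
case/IH => l [r [->|E]]; first by exists (a :: l), r; left.
by exists l, (rcons r a); right; rewrite rev_cons E rcons_cat rcons_cons.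
Qed.

Lemma links_around Q l x r : ppart e Q -> l ++ x :: r \in Q ->
  links (linked Q) x = [set last x l; head x r] :\ x.
Proof.
move=> h DQ; apply/setP => y; rewrite !inE (linked_in _ h DQ); last by rewrite mem_cat inE eqxx orbT.
by rewrite consec_around // (ppart_uniq h DQ).
Qed.

Lemma LF_sym k M x y : LF k M -> M x y = M y x.
Proof. by case=> Q [_ _ h]; rewrite !h linked_sym. Qed.

Lemma LF_symm k M : LF k M -> symmetric M.
Proof. by move=> h x y; apply: LF_sym h. Qed.

Lemma LF_edge k M x y : LF k M -> M x y -> e x y.
Proof. by case=> Q [h _ hM]; rewrite hM; apply: linked_edge. Qed.

Lemma LF_irr k M x : LF k M -> M x x = false.
Proof. by case=> Q [h _ hM]; rewrite hM (linked_irr _ h). Qed.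

Lemma deg_eq M M' x : M x =1 M' x -> deg M x = deg M' x.
Proof. by move=> E; rewrite /deg; apply: eq_card => y; rewrite !inE E. Qed.

Lemma LF_deg k M x : LF k M -> deg M x <= 2.
Proof.
case=> Q [h _ hM]; rewrite (@deg_eq _ (linked Q)); last exact: hM.
have [D DQ xD] := ppart_mem x h; case/splitPr: xD DQ => l r DQ.
rewrite /deg (links_around h DQ); apply: leq_trans (subset_leq_card (subD1set _ _)) _.
by rewrite cards2; case: (_ == _).
Qed.

Lemma last_deg Q l x : ppart e Q -> rcons l x \in Q -> deg (linked Q) x <= 1.
Proof.
move=> h; rewrite -cats1 => DQ; rewrite /deg (links_around h DQ) /=.
have := cardsD1 x [set last x l; x]; rewrite cards2 !inE eqxx orbT; by case: (_ != _) => /=; lia.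
Qed.

Lemma head_deg Q r x : ppart e Q -> x :: r \in Q -> deg (linked Q) x <= 1.
Proof.
move=> h DQ; rewrite /deg (@links_around _ [::] x r h) //=.
have := cardsD1 x [set x; head x r]; rewrite cards2 !inE eqxx /=; by case: (_ != _) => /=; lia.
Qed.

Lemma consec_connect M s x y : symmetric M -> (forall u v, consec s u v -> M u v) ->
  x \in s -> y \in s -> connect M x y.
Proof.
move=> sM sub xs ys; case: s sub xs ys => // a s sub xs ys.
have psub b r : path (consec (b :: r)) b r.
  elim: r b => [|c r IH] b //; apply/andP; split; first by rewrite consec_cons2 /same_pair !eqxx.
  by apply: sub_path (IH c) => u v uv; rewrite consec_cons2 uv orbT.
have pa : path M a s by apply: sub_path (psub a s) => u v; apply: sub.
have c1 := path_connect pa xs; have c2 := path_connect pa ys.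
by apply: connect_trans c2; rewrite sym_connect_sym.
Qed.

Lemma connect_in Q D x y : ppart e Q -> D \in Q -> x \in D -> connect (linked Q) x y = (y \in D).
Proof.
move=> h DQ xD; apply/idP/idP => [/connectP[p pth ->]|yD].
  elim: p x xD pth => [|z p IH] x xD //= /andP[xz]; apply: IH.
  by move: xz; rewrite (linked_in _ h DQ xD) => /consec_mem/andP[].
apply: (consec_connect _ _ xD yD) => [u v|u v uv]; first exact: linked_sym.
by apply/hasP; exists D.
Qed.

Lemma inner_links Q l a x b r : ppart e Q -> l ++ [:: a, x, b & r] \in Q ->
  links (linked Q) x = [set a; b] /\ a != b.
Proof.
move=> h DQ; have un := ppart_uniq h DQ.
have /and4P[] : [&& a != x, a != b, x != b & true].
  move: un; rewrite cat_uniq => /and3P[_ _] /=.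
  by rewrite !inE !negb_or -!andbA => /and5P[-> -> _ ->].
move=> ax ab xb _; split=> //.
rewrite -cat_rcons in DQ; rewrite (links_around h DQ) last_rcons /=.
by apply/setP => y; rewrite !inE; case: (y =P x) => //= ->; rewrite eq_sym (negbTE ax) (negbTE xb).
Qed.

Lemma deg_end Q D x : ppart e Q -> D \in Q -> x \in D -> deg (linked Q) x <= 1 ->
  x = head x D \/ x = last x D.
Proof.
move=> h DQ xD; case/splitPr: xD DQ => l r DQ.
case/lastP: l DQ => [|l a] DQ; first by left.
case: r DQ => [|b r] DQ; first by right; rewrite last_cat.
rewrite cat_rcons in DQ; have [E ab] := inner_links h DQ.
by rewrite /deg E cards2 ab.
Qed.

(** A path has only two ends, so of two further ends at least one lies on a path other than that of
    [x] and can be joined to [x] without closing a cycle. *)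
Lemma LF_ends k M x y z : LF k M -> deg M x <= 1 -> deg M y <= 1 -> deg M z <= 1 ->
  connect M x y -> connect M x z -> x != y -> x != z -> y = z.
Proof.
case=> Q [h _ hM].
have hd u : deg M u = deg (linked Q) u by apply: deg_eq => v; apply: hM.
rewrite !hd !(eq_connect hM) => dx dy dz.
have [D DQ xD] := ppart_mem x h; rewrite !(connect_in _ h DQ xD) => yD zD.
have hh u v : u \in D -> head u D = head v D by case: (D).
have ll u v : u \in D -> last u D = last v D by case: (D).
case: (deg_end h DQ xD dx) => ->; case: (deg_end h DQ yD dy) => ->;
case: (deg_end h DQ zD dz) => ->; rewrite ?(hh y x) ?(hh z x) ?(ll y x) ?(ll z x) ?eqxx //.
Qed.

Lemma connect_del M x y u v : connect (del_link M x y) u v -> connect M u v.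
Proof. by apply: connect_sub => a b /andP[ab _]; apply: connect1. Qed.

Lemma connect_add M x y u v : symmetric M -> connect (add_link M x y) u v ->
  [\/ connect M u v, connect M u x /\ connect M y v | connect M u y /\ connect M x v].
Proof.
move=> sM /connectP[p pth ->]; elim: p u pth => [|w p IH] u /=; first by constructor 1.
have cs := sym_connect_sym sM.
case/andP => /orP[uw|/orP[/andP[/eqP <- /eqP <-]|/andP[/eqP <- /eqP <-]]] /IH.
- case=> [h|[h1 h2]|[h1 h2]]; [constructor 1|constructor 2|constructor 3]; rewrite ?h2;
  try split=> //; by apply: connect_trans (connect1 uw) _.
- by case=> [h|[h1 h2]|[h1 h2]]; [constructor 2|constructor 2|constructor 1].
- by case=> [h|[h1 h2]|[h1 h2]]; [constructor 3|constructor 1|constructor 3].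
Qed.

Lemma connect_isolated M x y : deg M x = 0 -> connect M x y -> y = x.
Proof.
move=> /eqP; rewrite cards_eq0 => /eqP E /connectP[[|z p] /=]; first by move=> _ ->.
by case/andP => xz; move: E => /setP/(_ z); rewrite !inE xz.
Qed.

Lemma same_pairE x y u v : same_pair x y u v = ((u == x) && (v == y)) || ((u == y) && (v == x)).
Proof. by rewrite /same_pair !(eq_sym x) !(eq_sym y); congr (_ || _); rewrite andbC. Qed.

Lemma LF_cut k M x y : LF k M -> M x y ->
  LF k.+1 (del_link M x y) /\ ~~ connect (del_link M x y) x y.
Proof.
case=> Q [h sz hM]; rewrite hM => /hasP[D DQ xy].
have [l [r [R [h' sz' lk']]]] : exists l r R, [/\ ppart e ((rcons l x ++ y :: r) :: R),
   size Q = (size R).+1 & forall u v, linked Q u v = linked ((rcons l x ++ y :: r) :: R) u v].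
  have [l [r [E|E]]] := consec_split xy; exists l, r.
    by rewrite -E; apply: comp_front.
  by rewrite -E; apply: comp_frontr.
have ne1 : rcons l x != [::] by case: (l).
have hc := h'; rewrite (ppart_cat _ _ x ne1 (isT : y :: r != [::])) in hc; case/andP: hc => hc _.
have lk2 u v : del_link M x y u v = linked [:: rcons l x, y :: r & R] u v.
  rewrite /del_link hM lk' !linked_cons consec_cat.
  case: (boolP (same_pair x y u v)) => [pxy|_]; last by rewrite andbT /= orbA.
  rewrite andbF; symmetry; apply/negbTE.
  suff nxy : ~~ linked [:: rcons l x, y :: r & R] x y.
    by case/orP: pxy => /andP[/eqP <- /eqP <-]; rewrite // -!linked_cons linked_sym.
  rewrite (linked_in _ hc (mem_head _ _)) ?mem_rcons ?mem_head //.
  apply/negP => /consec_mem/andP[_ yl].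
  by have := ppart_disj hc yl (mem_head _ _); rewrite mem_head.
split.
  by exists [:: rcons l x, y :: r & R]; split=> //; rewrite /= -sz sz'.
rewrite (eq_connect lk2) (connect_in _ hc (mem_head _ _)) ?mem_rcons ?mem_head //.
apply/negP; rewrite -mem_rcons => yl.
by have := ppart_disj hc yl (mem_head _ _); rewrite mem_head.
Qed.

Lemma end_shape Q D x : ppart e Q -> D \in Q -> x \in D -> deg (linked Q) x <= 1 ->
  exists r, D = x :: r \/ rev D = x :: r.
Proof.
move=> h DQ xD; case/splitPr: xD DQ => l r DQ.
case/lastP: l DQ => [|l a] DQ; first by exists r; left.
case: r DQ => [|b r] DQ.
  by move=> _; exists (rev (rcons l a)); right; rewrite cats1 !rev_rcons.
rewrite cat_rcons in DQ; have [E ab] := inner_links h DQ.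
by rewrite /deg E cards2 ab.
Qed.

Lemma two_front Q D1 D2 : ppart e Q -> D1 \in Q -> D2 \in Q -> D1 != D2 ->
  exists R, [/\ ppart e [:: D1, D2 & R], size Q = (size R).+2 &
     forall x y, linked Q x y = linked [:: D1, D2 & R] x y].
Proof.
move=> h h1 h2 n12; have p1 := perm_to_rem h1.
have h2' : D2 \in rem D1 Q by move: h2; rewrite (perm_mem p1) inE eq_sym (negbTE n12).
have p2 : perm_eq Q [:: D1, D2 & rem D2 (rem D1 Q)].
  by apply: perm_trans p1 _; rewrite perm_cons perm_to_rem.
exists (rem D2 (rem D1 Q)); split; first by rewrite -(ppart_perm e p2).
  by rewrite (perm_size p2).
by move=> x y; apply: linked_perm.
Qed.

Lemma ppart_swap D1 D2 R : ppart e [:: D1, D2 & R] = ppart e [:: D2, D1 & R].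
Proof. by apply: ppart_perm; rewrite -[_ :: _ :: R](cat1s D1 [:: D2 & R]) -[[:: D2, D1 & R]](cat1s D2 [:: D1 & R]) (perm_catCA [:: D1] [:: D2] R). Qed.

Lemma LF_join k M x y : LF k.+1 M -> deg M x <= 1 -> deg M y <= 1 ->
  ~~ connect M x y -> e x y -> LF k (add_link M x y).
Proof.
case=> Q [h sz hM].
have hd u : deg M u = deg (linked Q) u by apply: deg_eq => v; apply: hM.
rewrite !hd !(eq_connect hM) => dx dy nc exy.
have [D1 Q1 x1] := ppart_mem x h; have [D2 Q2 y2] := ppart_mem y h.
have n12 : D1 != D2.
  by apply: contraNneq nc => E; rewrite (connect_in _ h Q1 x1) E.
have [l' E1] := end_shape h Q1 x1 dx; have [r E2] := end_shape h Q2 y2 dy.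
have [R [h' sz' lk']] := two_front h Q1 Q2 n12.
have h1 : ppart e [:: rev (x :: l'), D2 & R].
  by case: E1 h' => <- h'; [apply: ppart_rev | rewrite revK].
have h2 : ppart e [:: rev (x :: l'), y :: r & R].
  rewrite ppart_swap; rewrite ppart_swap in h1.
  by case: E2 h1 => <- h1 //; apply: ppart_rev.
rewrite rev_cons in h1 h2.
have ne1 : rcons (rev l') x != [::] by case: (rev l').
exists ((rcons (rev l') x ++ (y :: r)) :: R); split.
- by rewrite (ppart_cat _ _ x ne1 (isT : y :: r != [::])) h2 last_rcons.
- by move: sz; rewrite sz' /= => -[].
move=> u v; rewrite /add_link hM lk' !linked_cons consec_cat -rev_cons.
have -> : consec D1 u v = consec (rev (x :: l')) u v by case: E1 => <-; rewrite ?revK ?consec_rev.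
have -> : consec D2 u v = consec (y :: r) u v by case: E2 => <-; rewrite ?consec_rev.
by case: (consec _ u v); case: (consec _ u v); case: (linked R u v); case: (same_pair x y u v).
Qed.
End LinearForests.

(** * Partitions of minimum size *)

Section Minimal.
Variables (T : finType) (e : rel T) (P : seq (seq T)).
Hypothesis e_sym : symmetric e.
Hypotheses (HP : ppart e P) (Pmin : forall Q, ppart e Q -> size P <= size Q).
Implicit Types (s l r D : seq T) (Q : seq (seq T)) (x y a b c u v w z : T) (M : rel T).

Local Notation lkP := (linked P).
Local Notation LF := (LF e).
Definition pdeg v := deg lkP v.
Local Notation degP := pdeg.
Definition pcomp v := nth [::] P (find (fun D => v \in D) P).
Local Notation cmp := pcomp.

Lemma LF_P : LF (size P) lkP.
Proof. by exists P. Qed.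

Lemma LF_size_min j M : LF j M -> size P <= j.
Proof. by case=> Q [h <- _]; apply: Pmin. Qed.

Lemma cmp_has v : has (fun D => v \in D) P.
Proof. by have [D DP vD] := ppart_mem v HP; apply/hasP; exists D. Qed.

Lemma cmp_in v : cmp v \in P.
Proof. by rewrite mem_nth // -has_find cmp_has. Qed.

Lemma mem_cmp v : v \in cmp v.
Proof. exact: (nth_find [::] (cmp_has v)). Qed.

Lemma cmp_eq D v : D \in P -> v \in D -> cmp v = D.
Proof. by move=> DP vD; apply: (ppart_same HP (cmp_in v) DP (mem_cmp v) vD). Qed.

Lemma mem_cmp_eq u v : (u \in cmp v) = (cmp u == cmp v).
Proof.
apply/idP/eqP => [h|<-]; last exact: mem_cmp.
exact: cmp_eq (cmp_in v) h.
Qed.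

Lemma lkP_nb v u : lkP v u = consec (cmp v) v u.
Proof. exact: linked_in HP (cmp_in v) (mem_cmp v). Qed.

Lemma lkP_cmp u v : lkP u v -> cmp u = cmp v.
Proof. by rewrite lkP_nb => /consec_mem/andP[_ h]; apply/esym/eqP; rewrite -mem_cmp_eq. Qed.

Lemma lkP_sym u v : lkP u v = lkP v u. Proof. exact: linked_sym. Qed.

Lemma join_min M x y : LF (size P) M -> deg M x <= 1 -> deg M y <= 1 ->
  e x y -> connect M x y.
Proof.
move=> h dx dy exy; apply/negPn/negP => nc.
case E: (size P) h => [|j] h.
  by have := cmp_in x; case: (P) E.
by have := LF_size_min (LF_join e_sym h dx dy nc exy); rewrite E ltnn.
Qed.

Definition ends_adj D := if D is a :: r then e a (last a r) else false.
Definition cyc D := (2 < size D) && ends_adj D.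
Definition clique D := all (fun x => all (fun y => (x == y) || e x y) D) D.
(* A short or complete closed path is excluded: its vertices have too few
   neighbours outside to reach charge 84 by the payments of 2, so its two ends
   keep being counted as ends. *)
Definition flexible D := [&& cyc D, 4 < size D & ~~ clique D].

Definition intact M v := forall u, M v u = lkP v u.

Lemma intact_links M v : intact M v -> links M v = links lkP v.
Proof. by move=> h; apply/setP => u; rewrite !inE h. Qed.

Lemma intact_deg M v : intact M v -> deg M v = degP v.
Proof. by move=> h; rewrite /deg intact_links. Qed.

Lemma intact_connect M D v u : D \in P -> (forall w, w \in D -> intact M w) ->
  v \in D -> connect M v u -> u \in D.
Proof.
move=> DP hD vD /connectP[p pth ->]; elim: p v vD pth => [|z p IH] v vD //= /andP[vz].
by apply: IH; move: vz; rewrite (hD _ vD) => /lkP_cmp; rewrite (cmp_eq DP vD) => ->; apply: mem_cmp.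
Qed.

Lemma del_link_out M x y u v : u != x -> u != y -> del_link M x y u v = M u v.
Proof.
by move=> ux uy; rewrite /del_link same_pairE (negbTE ux) (negbTE uy) andbT.
Qed.

Lemma add_link_out M x y u v : u != x -> u != y -> add_link M x y u v = M u v.
Proof.
by move=> ux uy; rewrite /add_link same_pairE (negbTE ux) (negbTE uy) orbF.
Qed.

Lemma deg_del_link M x y u : deg (del_link M x y) u <= deg M u.
Proof. by apply: subset_leq_card; apply/subsetP => v; rewrite !inE => /andP[]. Qed.

Lemma deg_del_link_lt M x y : M x y -> deg (del_link M x y) x < deg M x.
Proof.
move=> xy; apply: proper_card; apply/properP; split.
  by apply/subsetP => v; rewrite !inE => /andP[].
by exists y; rewrite !inE ?xy // /del_link same_pairE !eqxx andbF.
Qed.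

Lemma deg_add_link M x y : deg (add_link M x y) x <= (deg M x).+1.
Proof.
rewrite /deg; apply: leq_trans (_ : #|y |: links M x| <= _); last by rewrite cardsU1; case: (_ \notin _).
apply: subset_leq_card; apply/subsetP => v; rewrite !inE /add_link same_pairE eqxx /=.
by case/orP => [->|/orP[->|/andP[/eqP <- ->]]]; rewrite ?orbT.
Qed.

Lemma del_linkC M x y u v : del_link M x y u v = del_link M y x u v.
Proof. by rewrite /del_link same_pairC. Qed.

Lemma add_linkC M x y u v : add_link M x y u v = add_link M y x u v.
Proof. by rewrite /add_link same_pairC. Qed.

Lemma ends_adjE x D : D != [::] -> ends_adj D = e (head x D) (last x D).
Proof. by case: D. Qed.

Lemma comp_ends x D : D \in P -> degP (head x D) <= 1 /\ degP (last x D) <= 1.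
Proof.
move=> DP; have := ppart_path HP DP; case/and3P => nD _ _; split.
  by case: D DP nD => // a s DP _; apply: (head_deg HP DP).
by case/lastP: D DP nD => // s a DP _; rewrite last_rcons; apply: (last_deg HP DP).
Qed.

Lemma connect_closed M D u w : (forall a b, a \in D -> M a b -> b \in D) ->
  u \in D -> connect M u w -> w \in D.
Proof.
move=> h uD /connectP[p pth ->]; elim: p u uD pth => [|z p IH] u uD //= /andP[uz].
by apply: IH; apply: h uz.
Qed.

(* Close D up to a cycle and cut it next to v. *)
Lemma rotate_cyc j M D v : LF j M -> D \in P -> cyc D -> (forall u, u \in D -> intact M u) -> v \in D ->
  exists M', [/\ LF j M', deg M' v <= 1, (forall u, u \notin D -> M' u =1 M u) &
                (forall u w, u \in D -> connect M' u w -> w \in D)].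
Proof.
move=> hM DP /andP[szD eaD] hD vD.
have [d1|d2] := leqP (deg M v) 1.
  by exists M; split=> // u w uD; apply: intact_connect.
have unD := ppart_uniq HP DP.
have hMD u w : u \in D -> M u w = consec D u w.
  by move=> uD; rewrite hD // (linked_in _ HP DP uD).
have nD : D != [::] by case: (D) szD.
have [dh dl] : deg M (head v D) <= 1 /\ deg M (last v D) <= 1.
  have [h1 h2] := comp_ends v DP; rewrite !intact_deg //; apply: hD.
    by case: (D) nD => //= *; rewrite mem_last.
  by case: (D) nD => //= *; rewrite mem_head.
move: (vD) => /splitPr E; case: D / E hMD hD DP unD nD szD eaD dh dl vD => l r hMD hD DP unD nD szD eaD dh dl vD.
case: r hMD hD DP unD nD szD eaD dh dl vD => [|b r] hMD hD DP unD nD szD eaD dh dl vD.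
  by move: d2; rewrite last_cat /= in dl; rewrite ltnNge dl.
move: hMD hD DP unD nD szD eaD dh dl vD; rewrite -cat_rcons; set D := _ ++ _ => hMD hD DP unD nD szD eaD dh dl vD.
set a := head v D in dh; set z := last v D in dl.
have aD : a \in D by rewrite /a; case: (D) nD => //= *; rewrite mem_head.
have zD : z \in D by rewrite /z; case: (D) nD => //= *; rewrite mem_last.
have al : a \in rcons l v by rewrite /a /D; case: (l) => [|? ?] /=; rewrite mem_head.
have zr : z \in b :: r by rewrite /z /D last_cat /= mem_last.
have disj x : x \in rcons l v -> x \notin b :: r.
  move: unD; rewrite cat_uniq => /and3P[_ /hasPn hn _] xl.
  by apply/negP => /hn; rewrite xl.
have vl : v \in rcons l v by rewrite mem_rcons mem_head.
have vb : M v b by rewrite hMD // consec_cat /same_pair !eqxx /= orbT.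
have [h1 nc] := LF_cut e_sym hM vb.
have sM1 := LF_symm h1.
have c1 : connect (del_link M v b) a v.
  apply: (consec_connect sM1 _ al vl) => x y xy.
  have /andP[xl yl] := consec_mem xy.
  rewrite /del_link hMD ?mem_cat ?xl // consec_cat xy /= same_pairE.
  by apply/negP => /orP[] /andP[/eqP ? /eqP ?]; subst; move: (disj b); rewrite mem_head => /(_ ltac:(by [])).
have c2 : connect (del_link M v b) b z.
  apply: (consec_connect sM1 _ (mem_head _ _) zr) => x y xy.
  have /andP[xl yl] := consec_mem xy.
  rewrite /del_link hMD ?mem_cat ?xl ?orbT // consec_cat xy !orbT /= same_pairE.
  by apply/negP => /orP[] /andP[/eqP ? /eqP ?]; subst; move: (disj v vl); rewrite ?xl ?yl.
have cs := sym_connect_sym sM1.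
have naz : ~~ connect (del_link M v b) a z.
  apply: contra nc => c; rewrite cs in c1; apply: connect_trans c1 _; apply: connect_trans c _.
  by rewrite cs.
have eaz : e a z by rewrite -ends_adjE.
have da : deg (del_link M v b) a <= 1 by apply: leq_trans (deg_del_link _ _ _ _) dh.
have dz : deg (del_link M v b) z <= 1 by apply: leq_trans (deg_del_link _ _ _ _) dl.
have h2 := LF_join e_sym h1 da dz naz eaz.
have va : v != a by apply: contraTneq d2 => ->; rewrite -leqNgt.
have vz : v != z by apply: contraTneq zr => <-; apply: disj.
exists (add_link (del_link M v b) a z); split=> //.
- rewrite (deg_eq (M' := del_link M v b)); last by move=> x; rewrite add_link_out.
  by rewrite -ltnS; apply: leq_trans (deg_del_link_lt vb) (LF_deg v hM).
- move=> u uD x; have bD : b \in D by rewrite mem_cat mem_head orbT.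
  rewrite add_link_out ?del_link_out //; by apply: contraNneq uD => ->.
move=> u w; apply: connect_closed => {u w} x y xD /orP[/andP[]|].
  by rewrite hMD // => /consec_mem/andP[].
by case/orP => /andP[]; [move=> _ /eqP <- | move=> /eqP <- _].
Qed.
End Minimal.

(** * Local exchanges that pass an exposed end on to another vertex *)

Section Hops.
Variables (T : finType) (e : rel T).
Hypotheses (e_sym : symmetric e) (eirr : irreflexive e).
Implicit Types (x y s t u v z : T) (M : rel T).
Local Notation LF := (LF e).

Lemma LF_connectC k M : LF k M -> connect_sym M.
Proof. by move=> h; apply: sym_connect_sym (LF_symm h). Qed.

Lemma connect_add_isolated k M x y u v : LF k M -> deg M y = 0 -> connect (add_link M x y) u v ->
  u != y -> v != y -> connect M u v.
Proof.
move=> h dy /(connect_add (LF_symm h))[//|[_ c]|[c _]].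
  by rewrite (connect_isolated dy c) eqxx.
by rewrite (LF_connectC h) in c; rewrite (connect_isolated dy c) eqxx.
Qed.

Lemma connect_from_isolated k M x y v : LF k M -> deg M y = 0 -> connect (add_link M x y) y v ->
  v != y -> connect M x v.
Proof.
move=> h dy /(connect_add (LF_symm h))[c|[_ c]|[_ //]]; by rewrite (connect_isolated dy c) eqxx.
Qed.

Lemma deg_del_linkC M x y u : deg (del_link M x y) u = deg (del_link M y x) u.
Proof. by apply: deg_eq => v; rewrite del_linkC. Qed.

Lemma deg_add_linkC M x y u : deg (add_link M x y) u = deg (add_link M y x) u.
Proof. by apply: deg_eq => v; rewrite add_linkC. Qed.

(** The common opening of the exchanges at an inner vertex: [y] becomes a path of its own, and its
    former neighbours become ends of different paths. *)
Lemma detach_inner k M y z1 z2 : LF k M -> links M y = [set z1; z2] -> z1 != z2 ->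
  let M2 := del_link (del_link M y z1) y z2 in
  [/\ LF k.+2 M2, deg M2 y = 0, ~~ connect M2 z1 z2,
      forall u v, connect M2 u v -> connect M u v &
      [/\ deg M2 z1 <= 1, deg M2 z2 <= 1 & connect M z1 z2] /\
      (forall u, u != y -> u != z1 -> u != z2 -> M2 u =1 M u)].
Proof.
move=> h E n12 M2.
have m1 : M y z1 by move/setP: E => /(_ z1); rewrite !inE eqxx.
have m2 : M y z2 by move/setP: E => /(_ z2); rewrite !inE eqxx orbT.
have yz1 : y != z1 by apply: contraTneq m1 => <-; rewrite (LF_irr y h).
have yz2 : y != z2 by apply: contraTneq m2 => <-; rewrite (LF_irr y h).
have [h1 nc1] := LF_cut e_sym h m1.
have m2' : del_link M y z1 y z2.
  by rewrite /del_link m2 same_pairE !eqxx /= (eq_sym z2) (negbTE n12) (negbTE yz1).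
have [h2 nc2] := LF_cut e_sym h1 m2'.
have sub u v : connect M2 u v -> connect M u v by move=> /connect_del/connect_del.
split=> //.
- apply/eqP; rewrite cards_eq0; apply/eqP/setP => u; rewrite !inE /M2 /del_link !same_pairE !eqxx /=.
  apply/negbTE; apply/negP => /andP[/andP[yu]]; rewrite !negb_or => /andP[a1 _] /andP[a2 _].
  by move/setP: E => /(_ u); rewrite !inE yu (negbTE a1) (negbTE a2).
- apply: contra nc1 => /connect_del c; apply: connect_trans (connect1 m2') _.
  by rewrite (LF_connectC h1).
split; first split.
- have ms : M z1 y by rewrite (LF_sym _ _ h).
  apply: leq_trans (deg_del_link _ _ _ _) _; rewrite deg_del_linkC -ltnS.
  by apply: leq_trans (deg_del_link_lt ms) _; apply: LF_deg h.
- have ms : del_link M y z1 z2 y by rewrite (LF_sym _ _ h1).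
  rewrite /M2 deg_del_linkC -ltnS.
  by apply: leq_trans (deg_del_link_lt ms) _; apply: LF_deg h1.
- by apply: connect_trans (connect1 m2); rewrite (LF_connectC h); apply: connect1.
by move=> u uy u1 u2 v; rewrite /M2 !del_link_out.
Qed.

(* s takes the place of one of the two neighbours of y, which becomes an end; the
   side is chosen so that this end stays apart from the prescribed vertex o. *)
Lemma hop_inner k M s y z1 z2 (o : option T) : LF k M -> deg M s <= 1 -> e s y ->
  links M y = [set z1; z2] -> z1 != z2 -> s != z1 -> s != z2 ->
  (forall t, o = Some t -> ~~ connect M s t /\ t != y) ->
  exists z M', [/\ z \in [set z1; z2], LF k M', deg M' z <= 1,
     (forall t, o = Some t -> ~~ connect M' z t) &
     forall u, u != s -> u != y -> u != z -> M' u =1 M u].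
Proof.
move=> h ds esy E n12 sz1 sz2 ho.
(* By symmetry [z2] is the side joined to [y] again and [z1] the end set free. If [s] lies on one
   side, the other one has to be rejoined, or a cycle would close; if it lies on neither, a side
   without [t] is set free. *)
wlog [nc2 nct] : z1 z2 E n12 sz1 sz2 / let M2 := del_link (del_link M y z1) y z2 in
   ~~ connect M2 s z2 /\ (forall t, o = Some t -> ~~ connect M2 z1 t).
  move=> W; have [h2 dy nc12 sub [[_ _ _] _]] := detach_inner h E n12.
  have E' : links M y = [set z2; z1] by rewrite setUC.
  have n21 : z2 != z1 by rewrite eq_sym.
  have C := LF_connectC h2.
  set M2 := del_link (del_link M y z1) y z2 in h2 dy nc12 sub C.
  have MM : connect (del_link (del_link M y z2) y z1) =2 connect M2.
    by apply: eq_connect => u v; rewrite /M2 /del_link -!andbA; congr (_ && _); rewrite andbC.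
  have W1 := W z1 z2 E n12 sz1 sz2; have W2 := W z2 z1 E' n21 sz2 sz1.
  have [c1|c1] := boolP (connect M2 s z1).
    apply: W1; split=> [|t /ho[nst _]].
      by apply: contra nc12 => c2; rewrite C in c1; apply: connect_trans c1 c2.
    by apply: contra nst => c2; apply: sub; apply: connect_trans c1 c2.
  rewrite /= in W2.
  have [c2|c2] := boolP (connect M2 s z2).
    have [|z [M' [zz a b c d]]] := W2; last by exists z, M'; split=> //; rewrite setUC.
    rewrite MM c1; split=> // t /ho[nst _]; rewrite MM.
    by apply: contra nst => c3; apply: sub; apply: connect_trans c2 c3.
  case: o ho W1 W2 {W} => [t|] ho W1 W2; last by apply: W1.
  have [ct|ct] := boolP (connect M2 z1 t); last by apply: W1; split=> // t' [<-].
  have [|z [M' [zz a b c d]]] := W2; last by exists z, M'; split=> //; rewrite setUC.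
  rewrite MM c1; split=> // t' [<-]; rewrite MM.
  by apply: contra nc12 => c3; rewrite C in c3; apply: connect_trans ct c3.
have [h2 dy nc12 sub [[d1 d2 c12] out2]] := detach_inner h E n12.
set M2 := del_link (del_link M y z1) y z2 in nc2 nct h2 dy nc12 sub d1 d2 out2.
have C := LF_connectC h2.
have m1 : M y z1 by move/setP: E => /(_ z1); rewrite !inE eqxx.
have m2 : M y z2 by move/setP: E => /(_ z2); rewrite !inE eqxx orbT.
have yz1 : y != z1 by apply: contraTneq m1 => <-; rewrite (LF_irr y h).
have yz2 : y != z2 by apply: contraTneq m2 => <-; rewrite (LF_irr y h).
have sy : s != y by apply: contraTneq esy => ->; rewrite eirr.
have [zy1 zy2] : z1 != y /\ z2 != y by rewrite ![_ == y]eq_sym.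
have [zs1 zs2] : z1 != s /\ z2 != s by rewrite ![_ == s]eq_sym.
have ds2 : deg M2 s <= 1 by rewrite (deg_eq (M' := M)) //; apply: out2.
have ncsy : ~~ connect M2 s y.
  by rewrite C; apply/negP => /(connect_isolated dy) E1; rewrite E1 eqxx in sy.
have h3 : LF k.+1 (add_link M2 s y).
  by apply: LF_join => //; rewrite dy.
set M3 := add_link M2 s y in h3.
have d3y : deg M3 y <= 1.
  rewrite (deg_eq (M' := add_link M2 y s)); last by move=> u; rewrite /M3 add_linkC.
  by apply: leq_trans (deg_add_link _ _ _) _; rewrite dy.
have d3z2 : deg M3 z2 <= 1.
  rewrite (deg_eq (M' := M2)) // => u; by rewrite /M3 add_link_out.
have nc3 : ~~ connect M3 y z2.
  by apply: contra nc2 => /(connect_from_isolated h2 dy); apply.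
have h4 : LF k (add_link M3 y z2) by apply: LF_join => //; apply: LF_edge h m2.
exists z1, (add_link M3 y z2); split=> //; first by rewrite !inE eqxx.
- rewrite (deg_eq (M' := M2)) // => u; by rewrite /M3 !add_link_out.
- move=> t ot; have [nst ty] := ho t ot; have nt := nct t ot.
  apply/negP => /(connect_add (LF_symm h3))[c|[c c']|[c c']].
  + by move/negP: nt; apply; apply: (connect_add_isolated h2 dy c).
  + have c1 : connect M2 s z1.
      by rewrite (LF_connectC h3) in c; apply: (connect_from_isolated h2 dy c).
    have c2 : connect M2 z2 t by apply: (connect_add_isolated h2 dy c').
    move/negP: nst; apply; apply: connect_trans (sub _ _ c1) _.
    by apply: connect_trans c12 (sub _ _ c2).
  + by move/negP: nc12; apply; apply: (connect_add_isolated h2 dy c).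
move=> u us uy u1 v.
(* [z2] loses its link to [y] and gets it back, so its row of the relation is the old one. *)
have [->|u2] := eqVneq u z2.
  rewrite /add_link /M3 /add_link /M2 /del_link !same_pairE !eqxx (negbTE zy2) (negbTE zs2) [z2 == z1]eq_sym (negbTE n12) /= !andbT !orbF.
  have [->|] := eqVneq v y; last by rewrite andbT orbF.
  by rewrite (LF_sym _ _ h) m2 !orbT.
by rewrite /M3 !add_link_out // out2.
Qed.

Lemma cut_leaf k M y z : LF k M -> links M y = [set z] ->
  let M1 := del_link M y z in
  [/\ LF k.+1 M1, deg M1 y = 0, deg M1 z <= 1, z != y & M y z].
Proof.
move=> h E M1.
have m1 : M y z by move/setP: E => /(_ z); rewrite !inE eqxx.
have [h1 _] := LF_cut e_sym h m1; split=> //.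
- apply/eqP; rewrite cards_eq0; apply/eqP/setP => u; rewrite !inE /M1 /del_link same_pairE !eqxx /=.
  apply/negbTE; apply/negP => /andP[yu]; rewrite negb_or => /andP[a1 _].
  by move/setP: E => /(_ u); rewrite !inE yu (negbTE a1).
- have ms : M z y by rewrite (LF_sym _ _ h).
  rewrite /M1 deg_del_linkC -ltnS.
  by apply: leq_trans (deg_del_link_lt ms) _; apply: LF_deg h.
by apply: contraTneq m1 => ->; rewrite (LF_irr y h).
Qed.

(** The end [y] moves from [z] over to [s]. What is left with [z] is part of the old path of [y], so
    [z] stays apart from everything that [y] was apart from. *)
Lemma hop_leaf k M s y z : LF k M -> deg M s <= 1 -> e s y ->
  links M y = [set z] -> s != z ->
  exists M', [/\ LF k M', deg M' z <= 1, deg M' y <= 1,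
     (forall t, ~~ connect M y t -> ~~ connect M' z t) &
     forall u, u != s -> u != y -> u != z -> M' u =1 M u].
Proof.
move=> h ds esy E sz; have [h1 dy dz zy myz] := cut_leaf h E.
set M1 := del_link M y z in h1 dy dz.
have sy : s != y by apply: contraTneq esy => ->; rewrite eirr.
have zs : z != s by rewrite eq_sym.
have d1s : deg M1 s <= 1 by rewrite (deg_eq (M' := M)) // => u; rewrite /M1 del_link_out.
have nc : ~~ connect M1 s y.
  by rewrite (LF_connectC h1); apply/negP => /(connect_isolated dy) E1; rewrite E1 eqxx in sy.
have h2 : LF k (add_link M1 s y) by apply: LF_join => //; rewrite dy.
exists (add_link M1 s y); split=> //.
- by rewrite (deg_eq (M' := M1)) // => u; rewrite add_link_out.
- by rewrite deg_add_linkC; apply: leq_trans (deg_add_link _ _ _) _; rewrite dy.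
- move=> t nt; have ty : t != y by apply: contraNneq nt => ->; apply: connect0.
  apply: contra nt => c; apply: connect_trans (connect1 myz) _.
  exact: connect_del (connect_add_isolated h1 dy c zy ty).
by move=> u us uy uz v; rewrite add_link_out // /M1 del_link_out.
Qed.

(** [y] leaves its path to bridge [e1] and [e2]: the bridge saves the path that the break costs. A
    connection of [z1] and [z2] would have to run through the bridge, and then [e1] and [e2] were
    connected in [M] through [y]. *)
Lemma join2_inner k M e1 e2 y z1 z2 : LF k M -> deg M e1 <= 1 -> deg M e2 <= 1 ->
  ~~ connect M e1 e2 -> e e1 y -> e e2 y -> links M y = [set z1; z2] -> z1 != z2 ->
  e1 != z1 -> e1 != z2 -> e2 != z1 -> e2 != z2 ->
  exists M', [/\ LF k M', deg M' z1 <= 1, deg M' z2 <= 1, ~~ connect M' z1 z2 &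
     forall u, u != e1 -> u != e2 -> u != y -> u != z1 -> u != z2 -> M' u =1 M u].
Proof.
move=> h d1 d2 nc12 e1y e2y E n12 a1 a2 b1 b2.
have [h2 dy ncz sub [[dz1 dz2 cz] out2]] := detach_inner h E n12.
set M2 := del_link (del_link M y z1) y z2 in h2 dy ncz sub dz1 dz2 out2.
have [m1 m2] : M y z1 /\ M y z2 by split; [move/setP: E => /(_ z1) | move/setP: E => /(_ z2)]; rewrite !inE eqxx ?orbT.
have z1y : z1 != y by apply: contraTneq m1 => ->; rewrite (LF_irr y h).
have z2y : z2 != y by apply: contraTneq m2 => ->; rewrite (LF_irr y h).
have y1 : e1 != y by apply: contraTneq e1y => ->; rewrite eirr.
have y2 : e2 != y by apply: contraTneq e2y => ->; rewrite eirr.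
have n1 : e1 != e2 by apply: contraNneq nc12 => ->; apply: connect0.
have [a1' a2' b1' b2'] : [/\ z1 != e1, z2 != e1, z1 != e2 & z2 != e2] by split; rewrite eq_sym.
have n1' : e2 != e1 by rewrite eq_sym.
have D1 : deg M2 e1 <= 1 by rewrite (deg_eq (M' := M)) //; apply: out2.
have D2 : deg M2 e2 <= 1 by rewrite (deg_eq (M' := M)) //; apply: out2.
have nc : ~~ connect M2 e1 y.
  by rewrite (LF_connectC h2); apply/negP => /(connect_isolated dy) E1; rewrite E1 eqxx in y1.
have h3 : LF k.+1 (add_link M2 e1 y) by apply: LF_join => //; rewrite dy.
set M3 := add_link M2 e1 y in h3.
have d3y : deg M3 y <= 1.
  by rewrite /M3 deg_add_linkC; apply: leq_trans (deg_add_link _ _ _) _; rewrite dy.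
have D3 : deg M3 e2 <= 1.
  by rewrite (deg_eq (M' := M2)) // => u; rewrite /M3 add_link_out.
have nc3 : ~~ connect M3 y e2.
  by apply: contra nc12 => c; apply: sub; apply: (connect_from_isolated h2 dy c).
have h4 : LF k (add_link M3 y e2) by apply: LF_join => //; rewrite e_sym.
exists (add_link M3 y e2); split=> //.
- by rewrite (deg_eq (M' := M2)) // => u; rewrite /M3 !add_link_out.
- by rewrite (deg_eq (M' := M2)) // => u; rewrite /M3 !add_link_out.
- have aux u v : u != y -> v != y -> connect M3 u y -> connect M3 e2 v -> connect M u e1 /\ connect M e2 v.
    move=> uy vy c c'; split; last by apply: sub; apply: (connect_add_isolated h2 dy c').
    rewrite (LF_connectC h); rewrite (LF_connectC h3) in c; apply: sub; exact: (connect_from_isolated h2 dy c).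
  apply/negP => /(connect_add (LF_symm h3))[c|[c c']|[c c']].
  + by move/negP: ncz; apply; apply: (connect_add_isolated h2 dy c).
  + have [q1 q2] := aux _ _ z1y z2y c c'; have C := LF_connectC h.
    move/negP: nc12; apply; rewrite C in q1; rewrite C in q2.
    exact: connect_trans q1 (connect_trans cz q2).
  + rewrite (LF_connectC h3) in c; rewrite (LF_connectC h3) in c'.
    have [q1 q2] := aux _ _ z2y z1y c' c; have C := LF_connectC h.
    move/negP: nc12; apply; rewrite C in q1; rewrite C in q2; rewrite C in cz.
    exact: connect_trans q1 (connect_trans cz q2).
by move=> u u1 u2 uy v1 v2 v; rewrite /M3 !add_link_out // out2.
Qed.

(** Since [y] is an end, its removal leaves only one remnant, and the bridge saves a path. *)
Lemma join2_leaf k M e1 e2 y z : LF k.+1 M -> deg M e1 <= 1 -> deg M e2 <= 1 ->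
  ~~ connect M e1 e2 -> e e1 y -> e e2 y -> links M y = [set z] -> e1 != z -> e2 != z ->
  exists M', [/\ LF k M', deg M' z <= 1 &
     forall u, u != e1 -> u != e2 -> u != y -> u != z -> M' u =1 M u].
Proof.
move=> h d1 d2 nc12 e1y e2y E a1 a2.
have [h2 dy dz zy myz] := cut_leaf h E.
set M2 := del_link M y z in h2 dy dz.
have y1 : e1 != y by apply: contraTneq e1y => ->; rewrite eirr.
have y2 : e2 != y by apply: contraTneq e2y => ->; rewrite eirr.
have n1 : e1 != e2 by apply: contraNneq nc12 => ->; apply: connect0.
have [a1' a2'] : z != e1 /\ z != e2 by split; rewrite eq_sym.
have n1' : e2 != e1 by rewrite eq_sym.
have D1 : deg M2 e1 <= 1 by rewrite (deg_eq (M' := M)) // => u; rewrite /M2 del_link_out.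
have D2 : deg M2 e2 <= 1 by rewrite (deg_eq (M' := M)) // => u; rewrite /M2 del_link_out.
have nc : ~~ connect M2 e1 y.
  by rewrite (LF_connectC h2); apply/negP => /(connect_isolated dy) E1; rewrite E1 eqxx in y1.
have h3 : LF k.+1 (add_link M2 e1 y) by apply: LF_join => //; rewrite dy.
set M3 := add_link M2 e1 y in h3.
have d3y : deg M3 y <= 1.
  by rewrite /M3 deg_add_linkC; apply: leq_trans (deg_add_link _ _ _) _; rewrite dy.
have D3 : deg M3 e2 <= 1.
  by rewrite (deg_eq (M' := M2)) // => u; rewrite /M3 add_link_out.
have nc3 : ~~ connect M3 y e2.
  by apply: contra nc12 => c; apply: connect_del; apply: (connect_from_isolated h2 dy c).
have h4 : LF k (add_link M3 y e2) by apply: LF_join => //; rewrite e_sym.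
exists (add_link M3 y e2); split=> //.
  by rewrite (deg_eq (M' := M2)) // => u; rewrite /M3 !add_link_out.
by move=> u u1 u2 uy uz v; rewrite /M3 !add_link_out // /M2 del_link_out.
Qed.
End Hops.

(** * The levels of the core *)

Section Levels.
Variables (T : finType) (e : rel T) (P : seq (seq T)).
Hypotheses (e_sym : symmetric e) (eirr : irreflexive e).
Hypotheses (HP : ppart e P) (Pmin : forall Q, ppart e Q -> size P <= size Q).
Implicit Types (l r D : seq T) (Q R : seq (seq T)) (x y a b c s u v w z : T) (M : rel T) (S A : {set T}).

Local Notation lkP := (linked P).
Local Notation LF := (LF e).
Local Notation degP := (pdeg P).
Local Notation cmp := (pcomp P).
Local Notation intact := (intact P).

Definition in_flexible v := flexible e (cmp v).
Local Notation Hv := in_flexible.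
Definition slot_end v := (degP v <= 1) && ~~ Hv v.
Local Notation Ev := slot_end.
Definition own v := if Hv v then head v (cmp v) else v.
(* A flexible path is represented by its head: any of its vertices can be made an
   end, but only one of them at a time. *)
Definition slots v : {set T} :=
  [set c | (Ev c && e v c) || [&& Hv c, own c == c & has (e v) (cmp c)]].
Definition many_slots : {set T} := [set v | 2 < #|slots v|].
Definition saturated S : {set T} := [set y | (links lkP y != set0) && (links lkP y \subset S)].
Definition nbrs_of A : {set T} := [set v | [exists y in A, e v y]].
(** Starting from the empty set makes level 1 equal to [many_slots], since nothing is saturated by
    the empty set. *)
Definition level n : {set T} := iter n (fun X => many_slots :|: nbrs_of (saturated X)) set0.
(* The slots outside A can still be joined to in the modified forest M. *)
Definition free_slots M A :=
  (forall c, Ev c -> c \notin A -> deg M c <= 1) /\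
  (forall u, Hv u -> own u \notin A -> intact M u).

Lemma Hv_cmp u v : cmp u = cmp v -> Hv u = Hv v.
Proof. by rewrite /Hv => ->. Qed.

Lemma head_mem D x y : y \in D -> head x D \in D.
Proof. by case: D => //= *; rewrite mem_head. Qed.

Lemma cmp_own v : cmp (own v) = cmp v.
Proof.
rewrite /own; case: (Hv v) => //; apply/eqP; rewrite -(mem_cmp_eq HP).
exact: head_mem (mem_cmp HP v).
Qed.

Lemma own_cmp u v : cmp u = cmp v -> Hv u -> own u = own v.
Proof.
move=> E h; rewrite /own -(Hv_cmp E) h E.
by have := mem_cmp HP v; case: (cmp v).
Qed.

Lemma own_nH v : ~~ Hv v -> own v = v.
Proof. by rewrite /own => /negbTE ->. Qed.

Lemma free_slots0 A : free_slots lkP A.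
Proof. by split=> [c /andP[]|]. Qed.

Lemma cycH v : Hv v -> cyc e (cmp v).
Proof. by case/and3P. Qed.

(** [A] collects the spent slots. A flexible path is first rotated so that a neighbour of [s]
    becomes its end; it cannot contain [s], because the slot of [s] itself counts as spent. *)
Lemma join_slot j M A s c : LF j.+1 M -> deg M s <= 1 -> free_slots M A ->
  (Ev s || Hv s -> own s \in A) -> c \in slots s -> c \notin A ->
  (Ev c -> ~~ connect M s c) ->
  exists M', [/\ LF j M', free_slots M' (c |: A) &
    forall y, y != s -> y != c -> ~~ Hv y -> M' y =1 M y].
Proof.
move=> h ds [okE okH] sA; rewrite inE => /orP[/andP[Ec sc] cA /(_ Ec) nc|/and3P[Hc oc hs] cA _].
  have nHc : ~~ Hv c by case/andP: Ec.
  exists (add_link M s c); split=> //; first by apply: LF_join => //; apply: okE.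
    split=> [d Ed|u Hu]; rewrite !inE negb_or => /andP[dc dA].
      rewrite (deg_eq (M' := M)); first exact: okE.
      move=> v; rewrite add_link_out //; apply: contraNneq dA => E; move: sA; rewrite -E Ed => /(_ isT).
      by rewrite own_nH //; case/andP: Ed.
    move=> v; rewrite add_link_out ?okH //; last by apply: contraNneq nHc => <-.
    by apply: contraNneq dA => E; rewrite E in Hu *; apply: sA; rewrite Hu orbT.
  by move=> y ys yc _ v; rewrite add_link_out.
have /hasP[w wD esw] := hs; set D := cmp c in wD hs.
have DP : D \in P := cmp_in HP c.
have memD u : (u \in D) = (cmp u == D) by rewrite /D (mem_cmp_eq HP).
have HD u : u \in D -> Hv u /\ own u = c.
  rewrite memD => /eqP E; have Hu : Hv u by rewrite (Hv_cmp E).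
  by rewrite (own_cmp E) // (eqP oc).
have sD : s \notin D.
  by apply/negP => /HD[Hs os]; move: sA; rewrite Hs orbT os => /(_ isT); rewrite (negbTE cA).
have iD u : u \in D -> intact M u by move=> /HD[Hu ou]; apply: okH; rewrite ?ou.
have [M1 [h1 d1 out1 cl1]] := rotate_cyc e_sym HP h DP (cycH Hc) iD wD.
have nc : ~~ connect M1 s w.
  by rewrite (LF_connectC h1); apply: contra sD; apply: cl1.
have ds1 : deg M1 s <= 1 by rewrite (deg_eq (M' := M)) //; apply: out1.
have sw : s != w by apply: contraNneq sD => ->.
have h2 : LF j (add_link M1 s w) by apply: LF_join.
have outD u : u \notin D -> u != s -> add_link M1 s w u =1 M u.
  move=> uD us v; rewrite add_link_out ?out1 //; by apply: contraNneq uD => ->.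
exists (add_link M1 s w); split=> //.
- split=> [d Ed|u Hu]; rewrite !inE negb_or => /andP[dc dA].
    have dD : d \notin D by apply/negP => /HD[Hd _]; move: Ed; rewrite /Ev Hd andbF.
    rewrite (deg_eq (M' := M)); first exact: okE.
    apply: outD => //; apply: contraNneq dA => E; move: sA; rewrite -E Ed => /(_ isT).
    by rewrite own_nH //; case/andP: Ed.
  have uD : u \notin D by apply/negP => /HD[_ E]; rewrite E eqxx in dc.
  have us : u != s by apply: contraNneq dA => E; rewrite E in Hu *; apply: sA; rewrite Hu orbT.
  by move=> v; rewrite outD // okH.
- by move=> y ys yc nHy; apply: outD => //; apply/negP => /HD[]; rewrite (negbTE nHy).
Qed.

(** Two unspent slots are required because one may be the other end of the path of [s]; by [LF_ends]
    not both are. *)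
Lemma join_some_slot j M A s : LF j.+1 M -> deg M s <= 1 -> free_slots M A ->
  (Ev s || Hv s -> own s \in A) -> 1 < #|slots s :\: A| ->
  exists c M', [/\ c \in slots s, LF j M', free_slots M' (c |: A) &
    forall y, y != s -> y != c -> ~~ Hv y -> M' y =1 M y].
Proof.
move=> h ds ok sA card.
suff [c [/setDP[cs cA] nc]] : exists c, c \in slots s :\: A /\ (Ev c -> ~~ connect M s c).
  by have [M' [h1 h2 h3]] := join_slot h ds ok sA cs cA nc; exists c, M'.
have [c1 [c2 [m1 m2 n12]]] := card_gt1P card.
have [/andP[E1 k1]|] := boolP (Ev c1 && connect M s c1); last first.
  by rewrite negb_and => nc; exists c1; split=> // E1; rewrite E1 in nc.
have [/andP[E2 k2]|] := boolP (Ev c2 && connect M s c2); last first.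
  by rewrite negb_and => nc; exists c2; split=> // E2; rewrite E2 in nc.
have sE c : Ev c -> c \in slots s :\: A -> [/\ s != c & deg M c <= 1].
  move=> Ec; rewrite !inE Ec; case/andP: (Ec) => _ /negbTE -> /=; rewrite orbF => /andP[cA sc].
  by split; [apply: contraTneq sc => ->; rewrite eirr | apply: ok.1].
have [n1 d1] := sE _ E1 m1; have [n2 d2] := sE _ E2 m2.
by have E := LF_ends h ds d1 d2 k1 k2 n1 n2; rewrite E eqxx in n12.
Qed.

Lemma levelS n : level n.+1 = many_slots :|: nbrs_of (saturated (level n)). Proof. by []. Qed.

Lemma saturated_mono S S' : S \subset S' -> saturated S \subset saturated S'.
Proof.
move=> sub; apply/subsetP => y; rewrite !inE => /andP[-> h]; exact: subset_trans h sub.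
Qed.

Lemma nbrs_of_mono A A' : A \subset A' -> nbrs_of A \subset nbrs_of A'.
Proof.
move=> /subsetP sub; apply/subsetP => y; rewrite !inE => /existsP[z /andP[zA yz]].
by apply/existsP; exists z; rewrite sub.
Qed.

Lemma level_mono n : level n \subset level n.+1.
Proof.
elim: n => [|n IH]; first exact: sub0set.
by rewrite (levelS n.+1) levelS; apply: setUS; apply: nbrs_of_mono; apply: saturated_mono.
Qed.

Lemma saturated_links S y : y \in saturated S -> exists2 z, z \in S & lkP y z.
Proof.
rewrite inE => /andP[/set0Pn[z zy] /subsetP sub]; exists z; first exact: sub.
by rewrite inE in zy.
Qed.

Lemma saturated_link S y z : y \in saturated S -> lkP y z -> z \in S.
Proof. by rewrite inE => /andP[_ /subsetP sub] yz; apply: sub; rewrite inE. Qed.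

Lemma saturated_shape S y : y \in saturated S ->
  (exists2 z, z \in S & links lkP y = [set z]) \/
  (exists z1 z2, [/\ z1 \in S, z2 \in S, z1 != z2 & links lkP y = [set z1; z2]]).
Proof.
rewrite inE => /andP[n0 /subsetP sub].
have d2 : #|links lkP y| <= 2 := LF_deg y (LF_P HP).
have [d1|] := leqP #|links lkP y| 1.
  have /cards1P[z E] : #|links lkP y| == 1 by rewrite eqn_leq d1 card_gt0.
  by left; exists z => //; apply: sub; rewrite E set11.
move=> d1; have /cards2P[z1 [z2 [n12 E]]] : #|links lkP y| == 2 by rewrite eqn_leq d2.
by right; exists z1, z2; split=> //; apply: sub; rewrite E !inE eqxx ?orbT.
Qed.

Lemma nbr_saturated_level n y s : y \in saturated (level n.-1) -> e y s -> s \in level n.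
Proof.
case: n => [|n] yT ys; first by have [z] := saturated_links yT; rewrite inE.
rewrite levelS inE [s \in nbrs_of _]inE; apply/orP; right; apply/existsP; exists y.
by rewrite yT e_sym.
Qed.

Definition level_inner n := forall v, v \in level n -> 1 < degP v /\ ~~ Hv v.
Definition level_unlinked n := forall u v, u \in level n -> v \in level n -> lkP u v -> False.

Lemma saturated_notin_level n y : level_unlinked n -> y \in saturated (level n) -> y \notin level n.
Proof.
by move=> ns yT; apply/negP => yL; have [z zL yz] := saturated_links yT; apply: ns yz.
Qed.

Lemma saturated_pred n y : y \in saturated (level n.-1) -> y \in saturated (level n).
Proof.
apply/subsetP; apply: saturated_mono; case: n => //= n; exact: level_mono.
Qed.

Lemma saturated_nflexible n y : level_inner n -> y \in saturated (level n) -> ~~ Hv y.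
Proof.
move=> fr yT; have [z zL yz] := saturated_links yT; have [_] := fr _ zL.
by rewrite (Hv_cmp (lkP_cmp HP yz)).
Qed.

Lemma level_not_end n v : level_inner n -> v \in level n -> ~~ Ev v.
Proof. by move=> fr /fr[d _]; rewrite /Ev leqNgt d. Qed.

Lemma free_slots_change M M' A : free_slots M A ->
  (forall u, M' u =1 M u \/ (Ev u -> u \notin A -> deg M' u <= 1) /\ (Hv u -> own u \in A)) ->
  free_slots M' A.
Proof.
move=> [okE okH] ch; split=> [c Ec cA|u Hu uA].
  by case: (ch c) => [E|[h _]]; [rewrite (deg_eq E); apply: okE | apply: h].
by case: (ch u) => [E v|[_ h]]; [rewrite E; apply: okH | rewrite h in uA].
Qed.

(** Keeps a hop from [s] to [y] away from what earlier levels rely on: an edge at a saturated vertex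
    of the previous level would put [y], respectively [s], into [level n]. *)
Lemma fresh_end n s y : level_unlinked n -> s \notin level n -> y \in saturated (level n) -> e s y ->
  s \notin saturated (level n.-1) /\ y \notin saturated (level n.-1).
Proof.
move=> ns sL yT sy; split; apply/negP => h.
  by have yL := nbr_saturated_level h sy; have := saturated_notin_level ns yT; rewrite yL.
by rewrite e_sym in sy; rewrite (nbr_saturated_level h sy) in sL.
Qed.

(** The induction statement of the backward hops. [A] allows for the one slot destroyed while a
    vertex was exposed; the saturated vertices that generate the level must still have their
    original links, so that the next hop can use them. *)
Definition no_level_end n := forall M A s, LF (size P) M -> #|A| <= 1 -> free_slots M A ->
  (Ev s || Hv s -> own s \in A) -> s \in level n -> deg M s <= 1 ->
  (forall y, y \in saturated (level n.-1) -> y != s -> intact M y) -> False.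

Lemma sizeP_gt0 v : exists j, size P = j.+1.
Proof. by have := cmp_in HP v; case: (P) => // D R _; exists (size R). Qed.

Lemma one_pick M A s : LF (size P) M -> #|A| <= 1 -> free_slots M A ->
  (Ev s || Hv s -> own s \in A) -> s \in many_slots -> deg M s <= 1 -> False.
Proof.
have [j Ej] := sizeP_gt0 s; rewrite Ej inE => h cA ok sA s0 ds.
(* Three slots minus the single spent one leave the two that [join_some_slot] asks for. *)
have card : 1 < #|slots s :\: A|.
  have h1 := subset_leq_card (subsetIr (slots s) A).
  rewrite cardsD; move: s0 cA h1; move: #|_| #|_| #|_| => *; lia.
have [c [M' [_ h' _ _]]] := join_some_slot h ds ok sA card.
by have := LF_size_min Pmin h'; rewrite Ej ltnn.
Qed.

(* Attaching s to y cuts y off a link that lies in the previous level. *)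
Lemma one_hop n M A s y : level_inner n -> level_unlinked n -> no_level_end n ->
  LF (size P) M -> #|A| <= 1 -> free_slots M A ->
  (Ev s || Hv s -> own s \in A) -> deg M s <= 1 ->
  y \in saturated (level n) -> s \notin level n -> e s y -> intact M y ->
  (forall y, y \in saturated (level n.-1) -> y != s -> intact M y) -> False.
Proof.
move=> fr ns one h cA ok sA ds yT sL sy iy iT.
have nHy := saturated_nflexible fr yT.
have [sT yT'] := fresh_end ns sL yT sy.
have sEA : Ev s -> s \in A.
  by move=> Es; have := sA; rewrite Es own_nH; [apply | case/andP: Es].
have sHA : Hv s -> own s \in A by move=> Hs; apply: sA; rewrite Hs orbT.
have finish M' z : z \in level n -> LF (size P) M' -> deg M' z <= 1 ->
    (Ev y -> deg M' y <= 1) ->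
    (forall u, u != s -> u != y -> u != z -> M' u =1 M u) -> False.
  move=> zL h' dz dy out; have [_ nHz] := fr _ zL.
  apply: (one M' A z) => //.
  - apply: (free_slots_change ok) => u; have [->|us] := eqVneq u s.
      by right; split=> // /sEA ->.
    have [->|uy] := eqVneq u y.
      by right; split=> [Ey _|]; [exact: dy | rewrite (negbTE nHy)].
    have [->|uz] := eqVneq u z; last by left; apply: out.
    by right; split; [rewrite (negbTE (level_not_end fr zL)) | rewrite (negbTE nHz)].
  - by rewrite (negbTE (level_not_end fr zL)) (negbTE nHz).
  - move=> y' y'T y'z v; rewrite out //.
    + by apply: iT => //; apply: contraNneq sT => <-.
    + by apply: contraNneq sT => <-.
    + by apply: contraNneq yT' => <-.
have El := intact_links iy.
case: (saturated_shape yT) => [[z zL Ez]|[z1 [z2 [z1L z2L n12 Ez]]]].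
  have sz : s != z by apply: contraNneq sL => ->.
  have [M' [h' dz dy _ out]] := hop_leaf e_sym eirr h ds sy (etrans El Ez) sz.
  by apply: (finish M' z).
have sz1 : s != z1 by apply: contraNneq sL => ->.
have sz2 : s != z2 by apply: contraNneq sL => ->.
have [//|z [M' [zz h' dz _ out]]] := hop_inner (o := None) e_sym eirr h ds sy (etrans El Ez) n12 sz1 sz2.
apply: (finish M' z) => //; first by move: zz; rewrite !inE => /orP[] /eqP ->.
by case/andP; rewrite /pdeg /deg Ez cards2 n12.
Qed.

Lemma one_step n : level_inner n -> level_unlinked n -> no_level_end n -> no_level_end n.+1.
Proof.
move=> fr ns one M A s h cA ok sA; rewrite levelS => /setUP[s0|sN] ds iT.
  exact: (one_pick h cA ok sA s0 ds).
have [sL|sL] := boolP (s \in level n).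
  by apply: (one M A s) => // y yT ys; apply: iT => //; apply: saturated_pred.
move: sN; rewrite inE => /existsP[y /andP[yT sy]].
have ys : y != s by apply: contraTneq sy => ->; rewrite eirr.
apply: (one_hop fr ns one h cA ok sA ds yT sL sy); first exact: iT.
by move=> y' y'T y's; apply: iT => //; apply: saturated_pred.
Qed.

(** An end, or after a rotation any vertex of a flexible path, is exposed at the cost of its own
    slot only, which [no_level_end] tolerates. *)
Lemma level_inner_step n : level_inner n -> no_level_end n.+1 -> level_inner n.+1.
Proof.
move=> fr one v vL; apply/andP; apply: contraT; rewrite negb_and -leqNgt negbK => bad.
have [Hv_v|nHv] := boolP (Hv v).
  set D := cmp v; have DP : D \in P := cmp_in HP v.
  have [M [h dv out cl]] := rotate_cyc e_sym HP (LF_P HP) DP (cycH Hv_v) (fun _ _ _ => erefl) (mem_cmp HP v).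
  exfalso; apply: (one M [set own v] v) => //.
  - by rewrite cards1.
  - apply: (free_slots_change (free_slots0 [set own v])) => u; have [uD|uD] := boolP (u \in D); last by left; apply: out.
    right; have E : cmp u = cmp v by apply/eqP; rewrite -(mem_cmp_eq HP).
    split=> [|Hu]; first by rewrite /Ev (Hv_cmp E) Hv_v andbF.
    by rewrite (own_cmp E) // set11.
  - by rewrite set11.
  - move=> y yT yv u; rewrite out //; apply/negP => yD.
    have := saturated_nflexible fr yT; rewrite (@Hv_cmp y v) ?Hv_v //.
    by apply/eqP; rewrite -(mem_cmp_eq HP).
rewrite (negbTE nHv) orbF in bad; exfalso; apply: (one lkP [set v] v) => //.
- exact: LF_P.
- by rewrite cards1.
- exact: free_slots0.
- by rewrite own_nH // set11.
Qed.

(* Applied to the two ends created by cutting a link inside a level, this shows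
   that levels contain no link; one path too many is allowed here. *)
Definition no_two_level_ends n := forall M e1 e2, LF (size P).+1 M -> e1 \in level n -> e2 \in level n ->
  deg M e1 <= 1 -> deg M e2 <= 1 -> ~~ connect M e1 e2 -> free_slots M set0 ->
  (forall y, y \in saturated (level n.-1) -> y != e1 -> y != e2 -> intact M y) ->
  (e1 \in saturated (level n.-1) -> e2 \in level n.-1) -> (e2 \in saturated (level n.-1) -> e1 \in level n.-1) -> False.

Definition ordinary v := ~~ Ev v && ~~ Hv v.

Lemma level_ordinary n v : level_inner n -> v \in level n -> ordinary v.
Proof. by move=> fr vL; rewrite /ordinary (level_not_end fr vL) (fr _ vL).2. Qed.

(** The first end spends at most one slot of the second, which keeps two. Two paths are saved from
    one above the minimum, which ends one below it. *)
Lemma two_base M e1 e2 : LF (size P).+1 M -> e1 \in many_slots -> e2 \in many_slots -> ordinary e1 -> ordinary e2 ->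
  deg M e1 <= 1 -> deg M e2 <= 1 -> e1 != e2 -> free_slots M set0 -> False.
Proof.
have [j Ej] := sizeP_gt0 e1; rewrite Ej !inE => h s1 s2 /andP[E1 H1] /andP[E2 H2] d1 d2 n12 ok.
have [||c [M' [cs h' ok' out]]] := join_some_slot (A := set0) (s := e1) h d1 ok.
- by rewrite (negbTE E1) (negbTE H1).
- by rewrite setD0; apply: ltnW.
have c2 : e2 != c.
  apply: contraTneq cs => <-; by rewrite inE (negbTE E2) (negbTE H2).
have d2' : deg M' e2 <= 1.
  by rewrite (deg_eq (M' := M)) //; apply: out => //; rewrite eq_sym.
have [||c' [M'' [_ h'' _ _]]] := join_some_slot (A := c |: set0) (s := e2) h' d2' ok'.
- by rewrite (negbTE E2) (negbTE H2).
- have := cardsD1 c (slots e2); rewrite setU0; move: s2; move: (_ \in _) => b; move: #|_| #|_| => ? ?; clear; lia.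
by have := LF_size_min Pmin h''; rewrite Ej ltnn.
Qed.

(* In the second case y is an end of the path of e2: joining e1 to y already saves
   one path, and e2 remains as an exposed end. *)
Lemma two_hop n M e1 e2 y : level_inner n -> LF (size P).+1 M -> ordinary e1 -> e1 \notin level n ->
  deg M e1 <= 1 -> ~~ connect M e1 e2 -> free_slots M set0 ->
  y \in saturated (level n) -> e e1 y -> y != e2 -> intact M y ->
  (exists z M', [/\ z \in level n, LF (size P).+1 M', deg M' z <= 1, ~~ connect M' z e2 &
     free_slots M' set0 /\ forall u, u != e1 -> u != y -> u != z -> M' u =1 M u]) \/
  (exists M', [/\ LF (size P) M', free_slots M' [set y] &
      forall u, u != e1 -> u != y -> M' u =1 M u]).
Proof.
move=> fr h /andP[nE1 nH1] e1L d1 nc ok yT e1y y2 iy.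
have nHy := saturated_nflexible fr yT; have El := intact_links iy.
have okM M' z A : z \in level n -> (Ev y -> y \notin A -> deg M' y <= 1) ->
    (forall u, u != e1 -> u != y -> u != z -> M' u =1 M u) -> free_slots M A -> free_slots M' A.
  move=> zL dy out okA; apply: (free_slots_change okA) => u.
  have [->|us] := eqVneq u e1; first by right; rewrite (negbTE nE1) (negbTE nH1).
  have [->|uy] := eqVneq u y; first by right; split=> //; rewrite (negbTE nHy).
  have [->|uz] := eqVneq u z; last by left; apply: out.
  by right; have /andP[/negbTE -> /negbTE ->] := level_ordinary fr zL.
case: (saturated_shape yT) => [[z zL Ez]|[z1 [z2 [z1L z2L n12 Ez]]]].
  have [c|c] := boolP (connect M y e2).
    right; have e1y' : e1 != y by apply: contraTneq e1y => ->; rewrite eirr.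
    exists (add_link M e1 y); split.
    - apply: LF_join => //; first by rewrite /deg El Ez cards1.
      by apply: contra nc => c'; apply: connect_trans c.
    - apply: (okM _ z) => //; first by rewrite inE eqxx.
        by move=> u u1 uy _ v; rewrite add_link_out.
      by case: ok => h1 h2; split=> [c' ? _|u ? _]; [apply: h1 | apply: h2]; rewrite ?inE.
    - by move=> u u1 uy v; rewrite add_link_out.
  have e1z : e1 != z by apply: contraNneq e1L => ->.
  have [M' [h' dz dy nc' out]] := hop_leaf e_sym eirr h d1 e1y (etrans El Ez) e1z.
  left; exists z, M'; split=> //; first exact: nc'.
  by split=> //; apply: (okM _ z).
have sz1 : e1 != z1 by apply: contraNneq e1L => ->.
have sz2 : e1 != z2 by apply: contraNneq e1L => ->.
have [|z [M' [zz h' dz nc' out]]] := hop_inner (o := Some e2) e_sym eirr h d1 e1y (etrans El Ez) n12 sz1 sz2.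
  by move=> t [<-]; rewrite eq_sym.
have zL : z \in level n by move: zz; rewrite !inE => /orP[] /eqP ->.
left; exists z, M'; split=> //; first exact: nc'.
split=> //; apply: (okM _ z) => //.
by case/andP; rewrite /pdeg /deg Ez cards2 n12.
Qed.

Lemma two_hop_first n M e1 e2 y : level_inner n -> level_unlinked n -> no_level_end n -> no_two_level_ends n ->
  LF (size P).+1 M -> ordinary e1 -> e1 \notin level n -> e2 \in level n ->
  deg M e1 <= 1 -> deg M e2 <= 1 -> ~~ connect M e1 e2 -> free_slots M set0 ->
  y \in saturated (level n) -> e e1 y -> y != e2 -> intact M y ->
  (forall y, y \in saturated (level n.-1) -> y != e1 -> y != e2 -> intact M y) -> False.
Proof.
move=> fr ns one two h i1 e1L e2L d1 d2 nc ok yT e1y y2 iy iT.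
have n12 : e2 != e1 by apply: contraNneq nc => ->; apply: connect0.
have [e1T yT'] := fresh_end ns e1L yT e1y.
have nTL z : z \in level n -> z \notin saturated (level n.-1).
  by move=> zL; apply: contraTN zL => /(@saturated_pred n) zT; apply: saturated_notin_level ns zT.
have ot y' : y' \in saturated (level n.-1) -> y' != e1 /\ y' != y.
  by move=> y'T; split; [apply: contraNneq e1T | apply: contraNneq yT'] => <-.
have y2' : e2 != y by rewrite eq_sym.
case: (two_hop fr h i1 e1L d1 nc ok yT e1y y2 iy) => [[z [M' [zL h' dz nc' [ok' out]]]]|[M' [h' ok' out]]].
  have z2 : e2 != z by apply: contraNneq nc' => ->; apply: connect0.
  apply: (two M' z e2) => //.
  - by rewrite (deg_eq (M' := M)) //; apply: out.
  - move=> y' y'T yz ye u; have [? ?] := ot _ y'T; rewrite out //; exact: iT.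
  - by rewrite (negbTE (nTL _ zL)).
  - by rewrite (negbTE (nTL _ e2L)).
apply: (one M' [set y] e2) => //.
- by rewrite cards1.
- by have /andP[/negbTE -> /negbTE ->] := level_ordinary fr e2L.
- by rewrite (deg_eq (M' := M)) //; apply: out.
- move=> y' y'T ye u; have [? ?] := ot _ y'T; rewrite out //; exact: iT.
Qed.

Lemma two_step n : level_inner n -> level_inner n.+1 -> level_unlinked n -> no_level_end n -> no_two_level_ends n -> no_two_level_ends n.+1.
Proof.
move=> fr fr' ns one two M e1 e2 h l1 l2 d1 d2 nc ok iT x1 x2.
have n12 : e1 != e2 by apply: contraNneq nc => ->; apply: connect0.
have n21 : e2 != e1 by rewrite eq_sym.
have nc2 : ~~ connect M e2 e1 by rewrite (LF_connectC h).
have [i1 i2] := (level_ordinary fr' l1, level_ordinary fr' l2).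
have nTL z : z \in level n -> z \notin saturated (level n).
  by move=> zL; apply: contraTN zL => zT; apply: saturated_notin_level ns zT.
have iTn y : y \in saturated (level n.-1) -> y != e1 -> y != e2 -> intact M y.
  by move=> yT; apply: iT; apply: saturated_pred.
have shape z : z \in level n.+1 -> z \notin level n -> z \in many_slots \/ exists2 y, y \in saturated (level n) & e z y.
  rewrite levelS => /setUP[|]; first by left.
  by rewrite inE => /existsP[y /andP[yT zy]] _; right; exists y.
(* Vertices with many slots are new only at level 1. From there on, a new vertex always comes from a
   saturated neighbour. *)
have [n0|n_gt0] := posnP n.
  move: l1 l2; rewrite n0 levelS !inE.
  have N z : [exists y in saturated (level 0), e z y] = false.
    by apply/existsP => -[y /andP[yT _]]; have [u] := saturated_links yT; rewrite inE.
  rewrite !N !orbF => s1 s2; apply: (two_base h _ _ i1 i2 d1 d2 n12 ok); by rewrite inE.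
have S0L z : z \in many_slots -> z \in level n by case: (n) n_gt0 => // m _ z0; rewrite levelS in_setU z0.
have [e1L|e1L] := boolP (e1 \in level n); have [e2L|e2L] := boolP (e2 \in level n).
- apply: (two M e1 e2) => // /(@saturated_pred n); [have := nTL _ e1L | have := nTL _ e2L]; by move/negP.
- have [/S0L|[y yT ey]] := shape _ l2 e2L; first by rewrite (negbTE e2L).
  have [ye1 ye2] : y != e1 /\ y != e2.
    split; first by apply: contraNneq (nTL _ e1L) => <-.
    by apply: contraTneq ey => ->; rewrite eirr.
  apply: (two_hop_first fr ns one two h i2 e2L e1L d2 d1 nc2 ok yT ey ye1); first exact: iT.
  by move=> y' y'T q1 q2; apply: iTn.
- have [/S0L|[y yT ey]] := shape _ l1 e1L; first by rewrite (negbTE e1L).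
  have [ye1 ye2] : y != e1 /\ y != e2.
    split; last by apply: contraNneq (nTL _ e2L) => <-.
    by apply: contraTneq ey => ->; rewrite eirr.
  exact: (two_hop_first fr ns one two h i1 e1L e2L d1 d2 nc ok yT ey ye2 (iT _ yT ye1 ye2) iTn).
have [/S0L|[y1 y1T ey1]] := shape _ l1 e1L; first by rewrite (negbTE e1L).
have [/S0L|[y2 y2T ey2]] := shape _ l2 e2L; first by rewrite (negbTE e2L).
(* The last two hypotheses of [no_two_level_ends] serve this point: a saturated end would force the
   other end into [level n]. *)
have e1T : e1 \notin saturated (level n) by apply: contraNN e2L; apply: x1.
have e2T : e2 \notin saturated (level n) by apply: contraNN e1L; apply: x2.
have yne y : y \in saturated (level n) -> y != e1 /\ y != e2.
  by move=> yT; split; [apply: contraNneq e1T | apply: contraNneq e2T] => <-.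
have [e1T' y1T'] := fresh_end ns e1L y1T ey1.
have [e2T' y2T'] := fresh_end ns e2L y2T ey2.
have [y11 y12] := yne _ y1T; have [y21 y22] := yne _ y2T.
(* A common saturated neighbour becomes a bridge between the two ends; distinct ones allow two hops
   in succession, neither of which disturbs the other. *)
have [E|y1y2] := eqVneq y1 y2.
  subst y2; have El := intact_links (iT _ y1T y11 y12); have nHy := saturated_nflexible fr y1T.
  have nz z (zL : z \in level n) : e1 != z /\ e2 != z.
    by split; [apply: contraNneq e1L | apply: contraNneq e2L] => ->.
  case: (saturated_shape y1T) => [[z zL Ez]|[z1 [z2 [z1L z2L nz12 Ez]]]].
    have [a1 a2] := nz _ zL.
    have [M' [h' dz out]] := join2_leaf e_sym eirr h d1 d2 nc ey1 ey2 (etrans El Ez) a1 a2.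
    apply: (one M' [set y1] z) => //.
    - by rewrite cards1.
    - have ok1 : free_slots M [set y1].
        by case: ok => h1 h2; split=> [c' ? _|u ? _]; [apply: h1 | apply: h2]; rewrite ?inE.
      apply: (free_slots_change ok1) => u.
      have [->|u1] := eqVneq u e1; first by right; case/andP: i1 => /negbTE -> /negbTE ->.
      have [->|u2] := eqVneq u e2; first by right; case/andP: i2 => /negbTE -> /negbTE ->.
      have [->|uy] := eqVneq u y1; first by right; rewrite set11 (negbTE nHy).
      have [->|uz] := eqVneq u z; last by left; apply: out.
      by right; have /andP[/negbTE -> /negbTE ->] := level_ordinary fr zL.
    - by have /andP[/negbTE -> /negbTE ->] := level_ordinary fr zL.
    - move=> y yT yz u; have [? ?] := yne _ (saturated_pred yT); rewrite out //; first exact: iTn.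
      by apply: contraNneq y1T' => <-.
  have [a1 b1] := nz _ z1L; have [a2 b2] := nz _ z2L.
  have [M' [h' dz1 dz2 nc' out]] :=
    join2_inner e_sym eirr h d1 d2 nc ey1 ey2 (etrans El Ez) nz12 a1 a2 b1 b2.
  apply: (two M' z1 z2) => //.
  - apply: (free_slots_change ok) => u.
    have [->|u1] := eqVneq u e1; first by right; case/andP: i1 => /negbTE -> /negbTE ->.
    have [->|u2] := eqVneq u e2; first by right; case/andP: i2 => /negbTE -> /negbTE ->.
    have [->|uy] := eqVneq u y1.
      right; split; last by rewrite (negbTE nHy).
      by case/andP; rewrite /pdeg /deg Ez cards2 nz12.
    have [->|uz1] := eqVneq u z1; first by right; have /andP[/negbTE -> /negbTE ->] := level_ordinary fr z1L.
    have [->|uz2] := eqVneq u z2; last by left; apply: out.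
    by right; have /andP[/negbTE -> /negbTE ->] := level_ordinary fr z2L.
  - move=> y yT yz1 yz2 u; have [? ?] := yne _ (saturated_pred yT); rewrite out //; first exact: iTn.
    by apply: contraNneq y1T' => <-.
  - by move/saturated_pred; rewrite (negbTE (nTL _ z1L)).
  - by move/saturated_pred; rewrite (negbTE (nTL _ z2L)).
have ot y' : y' \in saturated (level n.-1) -> y' != e1 /\ y' != y1.
  by move=> y'T; split; [apply: contraNneq e1T' | apply: contraNneq y1T'] => <-.
have iy1 := iT _ y1T y11 y12; have iy2 := iT _ y2T y21 y22.
have y21' : y2 != y1 by rewrite eq_sym.
have y12' : e2 != y1 by rewrite eq_sym.
case: (two_hop fr h i1 e1L d1 nc ok y1T ey1 y12 iy1) => [[z [M' [zL h' dz nc' [ok' out]]]]|[M' [h' ok' out]]].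
  have z2 : e2 != z by apply: contraNneq nc' => ->; apply: connect0.
  have y2z : y2 != z by apply: contraNneq (nTL _ zL) => <-.
  have nc'' : ~~ connect M' e2 z by rewrite (LF_connectC h').
  apply: (two_hop_first fr ns one two h' i2 e2L zL _ dz nc'' ok' y2T ey2 y2z).
  - by rewrite (deg_eq (M' := M)) //; apply: out.
  - by move=> u; rewrite out.
  - move=> y' y'T ye yz u; have [? ?] := ot _ y'T; rewrite out //; exact: iTn.
apply: (one_hop fr ns one h' _ ok' _ _ y2T e2L ey2) => //.
- by rewrite cards1.
- by case/andP: i2 => /negbTE -> /negbTE ->.
- by rewrite (deg_eq (M' := M)) //; apply: out.
- by move=> u; rewrite out.
- move=> y' y'T ye u; have [? ?] := ot _ y'T; rewrite out //; exact: iTn.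
Qed.

(** Cutting the link exposes both its vertices without spending a slot. If one of them is saturated
    by the previous level, the cut link itself shows that the other lies in that level. *)
Lemma level_unlinked_step n : level_inner n.+1 -> no_two_level_ends n.+1 -> level_unlinked n.+1.
Proof.
move=> fr two u v uL vL uv.
have [h nc] := LF_cut e_sym (LF_P HP) uv.
have [du _] := fr _ uL.
have nT w w' : lkP w w' -> w' \in level n.+1 -> w \in saturated (level n) -> w' \in level n.
  by move=> ww' _ wT; apply: (saturated_link wT).
apply: (two (del_link lkP u v) u v) => //.
- by rewrite -ltnS; apply: leq_trans (deg_del_link_lt uv) (LF_deg u (LF_P HP)).
- rewrite deg_del_linkC -ltnS; rewrite lkP_sym in uv.
  by apply: leq_trans (deg_del_link_lt uv) (LF_deg v (LF_P HP)).
- apply: (free_slots_change (free_slots0 set0)) => w.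
  have [->|wu] := eqVneq w u; first by right; have /andP[/negbTE -> /negbTE ->] := level_ordinary fr uL.
  have [->|wv] := eqVneq w v; first by right; have /andP[/negbTE -> /negbTE ->] := level_ordinary fr vL.
  by left=> w'; rewrite del_link_out.
- by move=> y _ yu yv w; rewrite del_link_out.
- exact: nT.
- by apply: nT; rewrite // lkP_sym.
Qed.

(** The order is forced: exposing one vertex of the next level is refuted from the data of this one,
    which makes the next level inner; only then can two exposed ends be refuted, and this in turn
    forbids links. *)
Lemma levels n : [/\ level_inner n, level_unlinked n, no_level_end n & no_two_level_ends n].
Proof.
elim: n => [|n [fr ns one two]].
  by split=> [v|u v|M A s _ _ _ _|M e1 e2 _]; rewrite inE.
have one' := one_step fr ns one; have fr' := level_inner_step fr one'.
have two' := two_step fr fr' ns one two; have ns' := level_unlinked_step fr' two'.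
by split.
Qed.

End Levels.

Lemma perm_exchange (T : eqType) (x y : T) (l r : seq T) :
  perm_eq ((x :: l) ++ y :: r) (y :: l ++ x :: r).
Proof. by apply/seq.permP => p; rewrite /= !count_cat /=; lia. Qed.

(** * The core *)

Section Facts.
Variables (T : finType) (e : rel T) (P : seq (seq T)).
Hypotheses (e_sym : symmetric e) (eirr : irreflexive e).
Hypotheses (HP : ppart e P) (Pmin : forall Q, ppart e Q -> size P <= size Q).
Implicit Types (l r D : seq T) (Q R : seq (seq T)) (x y a b c s u v w z : T) (M : rel T) (A : {set T}).

Local Notation lkP := (linked P).
Local Notation LF := (LF e).
Local Notation degP := (pdeg P).
Local Notation cmp := (pcomp P).
Local Notation intact := (intact P).
Local Notation Hv := (in_flexible e P).
Local Notation Ev := (slot_end e P).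
Local Notation slots := (slots e P).
Local Notation saturated := (saturated P).
Local Notation free_slots := (free_slots e P).

(* D is a path of the partition, read in either direction. *)
Definition oriented D := (D \in P) || (rev D \in P).
Local Notation pc := oriented.

Lemma pc_rev D : pc (rev D) = pc D.
Proof. by rewrite /pc revK orbC. Qed.

Lemma pc_front D : pc D -> exists R, [/\ ppart e (D :: R), size P = (size R).+1 &
  forall x y, lkP x y = linked (D :: R) x y].
Proof.
case/orP => [/(comp_front HP)//|/(comp_frontr e_sym HP)].
by rewrite revK.
Qed.

Lemma pc_nb D x y : pc D -> x \in D -> lkP x y = consec D x y.
Proof.
move=> /pc_front[R [h _ E]] xD; rewrite E; exact: (linked_in _ h (mem_head _ _) xD).
Qed.

Lemma pc_uniq D : pc D -> uniq D.
Proof. by move=> /pc_front[R [h _ _]]; apply: (ppart_uniq h (mem_head _ _)). Qed.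

Lemma pc_cmp D x : pc D -> x \in D -> cmp x = D \/ cmp x = rev D.
Proof.
case/orP => DP xD; first by left; apply: (cmp_eq HP DP xD).
by right; apply: (cmp_eq HP DP); rewrite mem_rev.
Qed.

Lemma pc_mem D x y : pc D -> x \in D -> (y \in cmp x) = (y \in D).
Proof. by move=> h /(pc_cmp h)[] ->; rewrite ?mem_rev. Qed.

Lemma pc_size D x : pc D -> x \in D -> size (cmp x) = size D.
Proof. by move=> h /(pc_cmp h)[] ->; rewrite ?size_rev. Qed.

Lemma head_rev x D : head x (rev D) = last x D.
Proof. by case/lastP: D => // s y; rewrite rev_rcons last_rcons. Qed.

Lemma cyc_rev D : cyc e (rev D) = cyc e D.
Proof.
rewrite /cyc size_rev; case: (D =P [::]) => [->|/eqP n] //.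
have [x _] : exists x, x \in D by case: (D) n => // x r _; exists x; rewrite mem_head.
have n0 : rev D != [::] by rewrite -size_eq0 size_rev size_eq0.
have lr : last x (rev D) = head x D by rewrite -head_rev revK.
by rewrite !(ends_adjE e x) // head_rev lr e_sym.
Qed.

Lemma flexible_rev D : flexible e (rev D) = flexible e D.
Proof.
rewrite /flexible cyc_rev size_rev /clique all_rev; congr [&& _, _ & ~~ _].
by apply: eq_all => x; rewrite all_rev.
Qed.

Lemma pc_cyc D x : pc D -> x \in D -> cyc e (cmp x) = cyc e D.
Proof. by move=> h /(pc_cmp h)[] ->; rewrite ?cyc_rev. Qed.

Lemma pc_Hv D x : pc D -> x \in D -> Hv x = flexible e D.
Proof. by rewrite /in_flexible => h /(pc_cmp h)[] ->; rewrite ?flexible_rev. Qed.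

Lemma pc_inner l a x b r : pc (l ++ [:: a, x, b & r]) -> links lkP x = [set a; b] /\ a != b.
Proof.
move=> /pc_front[R [h _ E]]; have [<- nab] := inner_links h (mem_head _ _); split=> //.
by apply/setP => y; rewrite !inE E.
Qed.

Lemma pc_degi l a x b r : pc (l ++ [:: a, x, b & r]) -> degP x = 2.
Proof. by move=> /pc_inner[E ab]; rewrite /pdeg /deg E cards2 ab. Qed.

Lemma pc_head x r : pc (x :: r) -> degP x <= 1.
Proof.
by move=> /pc_front[R [h _ E]]; have := head_deg h (mem_head _ _); rewrite (@deg_eq _ _ lkP) // => y; rewrite E.
Qed.

Lemma pc_last l x : pc (rcons l x) -> degP x <= 1.
Proof. by rewrite -pc_rev rev_rcons; apply: pc_head. Qed.

(** Unlike [in_flexible], this admits every closed path: rotation works on all of them, and only the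
    charge count keeps the short or complete ones from being flexible. *)
Definition endlike v := (degP v <= 1) || cyc e (cmp v).

Lemma rotate_endlike M v : LF (size P) M -> (forall u, u \in cmp v -> intact M u) -> endlike v ->
  exists M', [/\ LF (size P) M', deg M' v <= 1, (forall u, u \notin cmp v -> M' u =1 M u) &
    (forall u w, u \in cmp v -> connect M' u w -> w \in cmp v)].
Proof.
move=> h iD /orP[d|c].
  exists M; split=> // [|u w uD]; first by rewrite (intact_deg (iD _ (mem_cmp HP v))).
  exact: (intact_connect HP (cmp_in HP v) iD uD).
have := rotate_cyc e_sym HP h (cmp_in HP v) c iD (mem_cmp HP v); by [].
Qed.

(** On different paths the two rotations do not interfere, so [u] and [v] become ends
    simultaneously, and an edge between them would merge the two paths. *)
Lemma endlike_nonadj u v : endlike u -> endlike v -> cmp u != cmp v -> ~~ e u v.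
Proof.
move=> eu ev nuv; have [M [h d out cl]] := rotate_endlike (LF_P HP) (fun _ _ _ => erefl) eu.
have nv w : w \in cmp v -> w \notin cmp u.
  by rewrite !(mem_cmp_eq HP) => /eqP ->; rewrite eq_sym.
have iD w : w \in cmp v -> intact M w by move=> /nv/out.
have [M' [h' d' out' cl']] := rotate_endlike h iD ev.
have uv : u \notin cmp v by rewrite (mem_cmp_eq HP).
have du : deg M' u <= 1 by rewrite (deg_eq (M' := M)) //; apply: out'.
apply: contra uv => euv; apply: (cl' v) (mem_cmp HP v) _.
rewrite (LF_connectC h'); exact: (join_min e_sym HP Pmin h' du d' euv).
Qed.

(** A monotone operator on sets of vertices reaches its least fixed point within [#|T|]
    iterations. *)
Definition core := level e P #|T|.
Local Notation S := core.

Lemma core_fix : S = many_slots e P :|: nbrs_of e (saturated S).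
Proof.
have mono : {homo (fun X => many_slots e P :|: nbrs_of e (saturated X)) : X Y / X \subset Y}.
  by move=> X Y XY; apply: setUS; apply: nbrs_of_mono; apply: saturated_mono.
exact: esym (fixsetK mono).
Qed.

Lemma slots_notin_core v : v \notin S -> #|slots v| <= 2.
Proof. by rewrite core_fix !inE negb_or -leqNgt => /andP[]. Qed.

Lemma many_slots_core v : 2 < #|slots v| -> v \in S.
Proof. by move=> h; rewrite core_fix !inE h. Qed.

Lemma core_nbr y v : y \in saturated S -> e y v -> v \in S.
Proof.
move=> yT yv; rewrite core_fix inE [v \in nbrs_of _ _]inE; apply/orP; right; apply/existsP; exists y.
by rewrite yT e_sym.
Qed.

Lemma core_inner v : v \in S -> degP v = 2 /\ ~~ Hv v.
Proof.
have [fr _ _ _] := levels e_sym eirr HP Pmin #|T|.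
move=> /fr[d ->]; split=> //; have := LF_deg v (LF_P HP); rewrite -/(degP v); move: d; lia.
Qed.

Lemma core_unlinked u v : u \in S -> v \in S -> ~~ lkP u v.
Proof. by have [_ ns _ _] := levels e_sym eirr HP Pmin #|T| => uS vS; apply/negP; apply: ns. Qed.

Lemma core_not_end v : v \in S -> ~~ Ev v.
Proof. by move=> /core_inner[d _]; rewrite /slot_end d. Qed.

Lemma level_core n : level e P n \subset S.
Proof.
elim: n => [|n IH]; first exact: sub0set.
by rewrite core_fix; apply: setUS; apply: nbrs_of_mono; apply: saturated_mono.
Qed.

Lemma core_level v : v \in S -> exists n, v \in level e P n.+1 /\ v \notin level e P n.
Proof.
move=> vS; have ex : exists n, v \in level e P n by exists #|T|.
case: (ex_minnP ex) => -[|n] vn mn; first by rewrite inE in vn.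
by exists n; split=> //; apply/negP => /mn; rewrite ltnn.
Qed.

(** Saturated vertices linked to [s] may be damaged: at the first level containing [s] they were not
    yet saturated by the previous one. *)
Lemma no_core_end M A s : LF (size P) M -> #|A| <= 1 -> free_slots M A -> s \in S -> deg M s <= 1 ->
  (forall y, y \in saturated S -> y != s -> ~~ lkP y s -> intact M y) -> False.
Proof.
move=> h cA ok sS ds iT; have [n [sn sn']] := core_level sS.
have [_ _ one _] := levels e_sym eirr HP Pmin n.+1.
apply: (one M A s) => //; first by rewrite (negbTE (core_not_end sS)) (negbTE (core_inner sS).2).
move=> y yT ys; apply: iT => //; first by apply: subsetP yT; apply: saturated_mono (level_core n).
by apply: contra sn' => ysl; apply: (saturated_link yT).
Qed.

Lemma saturated_core_nflexible y : y \in saturated S -> ~~ Hv y.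
Proof.
by move=> /saturated_links[z /core_inner[_ zH] yz]; rewrite (Hv_cmp e (lkP_cmp HP yz)).
Qed.

Lemma Ev_endlike v : Ev v -> endlike v.
Proof. by rewrite /endlike => /andP[->]. Qed.

Lemma Hv_endlike v : Hv v -> endlike v.
Proof. by move=> /cycH c; rewrite /endlike c orbT. Qed.

Lemma slots_end c v : endlike v -> c \in slots v -> c \in cmp v.
Proof.
move=> ev; rewrite inE (mem_cmp_eq HP) => /orP[/andP[Ec vc]|/and3P[Hc _ /hasP[w wD vw]]].
  by apply: contraLR vc => n; apply: endlike_nonadj ev (Ev_endlike Ec) _; rewrite eq_sym.
have E : cmp w = cmp c by apply/eqP; rewrite -(mem_cmp_eq HP).
apply: contraLR vw => n; apply: endlike_nonadj ev _ _; last by rewrite E eq_sym.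
by apply: Hv_endlike; rewrite (Hv_cmp e E).
Qed.

Lemma pc_ends D u : pc D -> u \in D -> degP u <= 1 -> u = head u D \/ u = last u D.
Proof.
move=> /pc_front[R [h _ E]] uD; rewrite /pdeg (@deg_eq _ _ (linked (D :: R))) // => d.
exact: deg_end h (mem_head _ _) uD d.
Qed.

Lemma reorder_path D D' : pc D -> perm_eq D D' -> is_graph_path e D' ->
  exists R, [/\ ppart e (D' :: R), LF (size P) (linked (D' :: R)),
    forall u, u \notin D -> linked (D' :: R) u =1 lkP u &
    forall u v, u \in D -> linked (D' :: R) u v = consec D' u v].
Proof.
move=> /pc_front[R [h sz E]] pD gD; have h' := ppart_head_perm gD pD h; exists R; split=> //.
- by exists (D' :: R).
- move=> u uD v; rewrite E !linked_cons; congr (_ || _).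
  by apply/idP/idP => /consec_mem/andP[]; rewrite -?(perm_mem pD) (negbTE uD).
by move=> u v uD; rewrite (linked_in _ h' (mem_head _ _)) // -(perm_mem pD).
Qed.

(* At the least level meeting D nothing saturated lies in D, so D may be reordered
   freely. *)
Lemma core_ncyc_reorder n D s a r : pc D -> perm_eq D (s :: r) -> is_graph_path e (s :: r) ->
  (forall u, u \in D -> degP u <= 1 -> u = a \/ u = last s r) -> s \in level e P n.+1 ->
  (forall u, u \in D -> u \notin level e P n) -> False.
Proof.
move=> hD pD gD ends sL nL; have sS := subsetP (level_core n.+1) _ sL.
have [R [h hM out inD]] := reorder_path hD pD gD.
have sD : s \in D by rewrite (perm_mem pD) mem_head.
have nH : ~~ flexible e D by rewrite -(pc_Hv hD sD) (core_inner sS).2.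
have [_ _ one _] := levels e_sym eirr HP Pmin n.+1.
apply: (one _ [set a] s hM) => //.
- by rewrite cards1.
- apply: (free_slots_change (free_slots0 e P _)) => u.
  have [uD|uD] := boolP (u \in D); last by left; apply: out.
  right; split; last by rewrite (pc_Hv hD uD) (negbTE nH).
  case/andP=> du _; rewrite inE; case: (ends _ uD du) => [->|->]; first by rewrite eqxx.
  by move=> _; apply: (@last_deg _ e _ (belast s r)) h _; rewrite -lastI mem_head.
- by rewrite (negbTE (core_not_end sS)) (negbTE (core_inner sS).2).
- exact: (head_deg h (mem_head _ _)).
- move=> y yT ys u; rewrite out //; apply: contraL yT => yD.
  apply/negP => /saturated_links[z zL]; rewrite (pc_nb _ hD yD) => /consec_mem/andP[_ zD].
  by have := nL _ zD; rewrite zL.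
Qed.

Lemma clique_sorted D r : clique e D -> uniq r -> {subset r <= D} -> sorted e r.
Proof.
move=> /allP cl; elim: r => [|x [|y s] IH] // us sub.
have /andP[xn us'] := us; apply/andP; split; last by apply: IH => // z zs; apply: sub; rewrite inE zs orbT.
have xD : x \in D by apply: sub; rewrite mem_head.
have yD : y \in D by apply: sub; rewrite !inE eqxx orbT.
have := allP (cl _ xD) _ yD; case/orP => // /eqP E; by rewrite E mem_head in xn.
Qed.

(** A core vertex is on no flexible path, so a closed path through it has at most four vertices or
    is complete. Either way a reordering makes a core vertex of least level an end and spends a
    single slot. *)
Lemma core_ncyc v : v \in S -> ~~ cyc e (cmp v).
Proof.
move=> vS; apply/negP => cy; have nH := (core_inner vS).2.
have ex : exists n, has (mem (level e P n)) (cmp v).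
  by exists #|T|; apply/hasP; exists v => //; apply: mem_cmp HP v.
case: (ex_minnP ex) => -[|n] vn mn; first by case/hasP: vn => x _; rewrite !inE.
have nL u : u \in cmp v -> u \notin level e P n.
  move=> uD; apply/negP => uL; suff: n.+1 <= n by rewrite ltnn.
  by apply: mn; apply/hasP; exists u.
case/hasP: vn => s sD /= sL; have sS := subsetP (level_core n.+1) _ sL; have [ds _] := core_inner sS.
have pv : pc (cmp v) by rewrite /pc (cmp_in HP).
have gpc D : pc D -> is_graph_path e D.
  by case/pc_front => R [h _ _]; apply: ppart_path h (mem_head _ _).
(* If [s] is next to the end [a], moving [a] to the other side of the closed path exposes [s]; only
   the former last vertex ceases to be an end. *)
have short a r : pc [:: a, s & r] -> e a (last s r) -> (forall u, u \in [:: a, s & r] -> u \notin level e P n) -> False.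
  move=> hD az nL'; apply: (core_ncyc_reorder (r := rcons r a) (a := last s r) hD _ _ _ sL nL').
  - by rewrite -rcons_cons -[_ :: _]cat1s perm_sym -cats1 perm_catC.
  - rewrite -rcons_cons -cats1 (graph_path_cat e a) //; have := gpc _ hD; rewrite -cat1s (graph_path_cat e a) //.
    case/and4P => -> -> /hasPn hn _; rewrite e_sym az !andbT /= orbF inE.
    by apply/negP => as_; move: (hn a as_); rewrite /= mem_head.
  - move=> u uD du; case: (pc_ends hD uD du) => /= ->; by [right; rewrite last_rcons | left].
move: (sD) => /splitPr E; case E: (cmp v) / E => [l r].
move: sD pv nL cy nH => sD pv nL cy; rewrite /in_flexible /flexible; rewrite E in sD pv nL cy *.
case/andP: (cy) => sz ea; rewrite cy /= => nH.
case: l E sD pv nL cy sz ea nH => [|a l] E sD pv nL cy sz ea nH.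
  by have := pc_head pv; rewrite ds.
case/lastP: r E sD pv nL cy sz ea nH => [|r z] E sD pv nL cy sz ea nH.
  by rewrite cats1 in pv; have := pc_last pv; rewrite ds.
have az : e a z by move: ea; rewrite /ends_adj /= last_cat /= last_rcons.
case: l E sD pv nL cy sz ea nH => [|a' l] E sD pv nL cy sz ea nH.
  by apply: (short _ _ pv) => //; rewrite last_rcons.
case/lastP: r E sD pv nL cy sz ea nH => [|r z'] E sD pv nL cy sz ea nH.
  rewrite -pc_rev in pv; have E' : rev ((a :: a' :: l) ++ s :: rcons [::] z) = [:: z, s & rev (a :: a' :: l)].
    by rewrite rev_cat /=.
  rewrite E' in pv; apply: (short _ _ pv); first by rewrite -head_rev revK /= e_sym.
  by move=> u; rewrite -E' mem_rev; apply: nL.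
(* Now two vertices precede [s] and two follow it, so the path has at least five vertices and, not
   being flexible, is complete. Hence [s] may change places with the end [a]. *)
have cl : clique e ((a :: a' :: l) ++ s :: rcons (rcons r z') z).
  by apply: contraNT nH => ->; rewrite andbT size_cat /= !size_rcons; lia.
set D := _ ++ _ in pv nL cl.
have pD : perm_eq D (s :: (a' :: l) ++ a :: rcons (rcons r z') z).
  exact: perm_exchange.
apply: (core_ncyc_reorder (a := a) pv pD _ _ sL nL).
  have u2 : uniq (s :: (a' :: l) ++ a :: rcons (rcons r z') z) by rewrite -(perm_uniq pD) (pc_uniq pv).
  apply/and3P; split=> //; apply: (clique_sorted cl) => // u.
  by rewrite (perm_mem pD).
move=> u uD du; case: (pc_ends pv uD du) => ->; first by left.
by right; rewrite /D !last_cat /= !last_rcons.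
Qed.

(** A Pósa rotation: the part after [v] is reversed along the edge from [b] to [v], and [u] replaces
    [b] as an end. *)
Lemma rotate_path l v u r b : pc (l ++ v :: u :: rcons r b) -> e b v ->
  exists M, [/\ LF (size P) M, deg M u <= 1, Ev v -> deg M v <= 1,
    forall x, x != v -> x != u -> x != b -> M x =1 lkP x &
    forall x y, x \in l ++ v :: u :: rcons r b -> connect M x y = (y \in l ++ v :: u :: rcons r b)].
Proof.
move=> hD bv; set D := _ ++ _ in hD *.
have ED : D = rcons l v ++ (u :: rcons r b) by rewrite cat_rcons.
have ErD : rev (u :: rcons r b) = b :: rcons (rev r) u by rewrite rev_cons rev_rcons.
pose D' := rcons l v ++ rev (u :: rcons r b).
have pD : perm_eq D D' by rewrite ED perm_cat2l perm_sym perm_rev.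
have n1 : rcons l v != [::] by case: (l).
have gD : is_graph_path e D' .
  have [R [h _ _]] := pc_front hD; have := ppart_path h (mem_head _ _).
  rewrite ED (graph_path_cat e u n1) // (graph_path_cat e u n1) ?ErD // -ErD (graph_path_rev e_sym).
  case/and4P => -> -> hn _; rewrite ErD last_rcons [head _ _]/= (e_sym v) bv andbT !andTb.
  apply: contra hn => hh; have [x xr xl] := hasP hh; apply/hasP; exists x => //.
  by rewrite -mem_rev ErD.
have [R [h hM out inD]] := reorder_path hD pD gD; exists (linked (D' :: R)); split=> //.
- apply: (@last_deg _ e _ (rcons l v ++ b :: rev r)) h _.
  by rewrite /D' ErD rcons_cat rcons_cons mem_head.
- case: l @D hD ED @D' pD n1 gD h hM out inD => [|a l] D hD ED D' pD n1 gD h hM out inD.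
    by move=> _; apply: (head_deg h (mem_head _ _)).
  rewrite /slot_end; have [q|[l' [c El]]] : False \/ exists l' c, a :: l = rcons l' c.
  + by right; case/lastP: (l) => [|l' c]; [exists [::], a | exists (a :: l'), c].
  + by [].
  + by rewrite /D El cat_rcons in hD; rewrite (pc_degi hD).
- move=> x xv xu xb y; have [xD|xD] := boolP (x \in D); last exact: out.
  rewrite inD // (pc_nb _ hD xD) ED /D' ErD !consec_cat -ErD consec_rev !same_pairE.
  by rewrite (negbTE xv) (negbTE xu) (negbTE xb).
- by move=> x y xD; rewrite (connect_in _ h (mem_head _ _)) -?(perm_mem pD).
Qed.

(** The rotation makes [u] an end, so joining it to a slot would save a path. Only [a], the other
    end of this path, and [b], the slot spent by the rotation, escape. *)
Lemma rotated_end_slots a l v u r b : pc ((a :: l) ++ v :: u :: rcons r b) -> e b v ->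
  ~~ flexible e ((a :: l) ++ v :: u :: rcons r b) -> slots u \subset [set a; b].
Proof.
move=> hD bv nH; apply/subsetP => c cs; rewrite !inE; apply: contraT; rewrite negb_or => /andP[ca cb].
have [M [h du dv out cn]] := rotate_path hD bv; set D := _ ++ _ in hD nH cn.
have [j Ej] := sizeP_gt0 HP u; rewrite Ej in h.
have [vD uD bD] : [/\ v \in D, u \in D & b \in D].
  by split; rewrite !mem_cat !inE ?mem_rcons ?inE ?eqxx ?orbT.
have nHx x : x \in D -> ~~ Hv x by move=> xD; rewrite (pc_Hv hD xD).
have du2 : degP u = 2.
  case: (r) @D hD {nH cn vD uD bD nHx} => [|d r'] D hD;
  rewrite /D -cat_rcons -(cats1 _ v) -catA in hD; exact: (pc_degi hD).
have ok : free_slots M [set b].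
  apply: (free_slots_change (free_slots0 e P _)) => x.
  have [->|xv] := eqVneq x v; first by right; split=> [E _|]; [first [exact: dv | exact: (dv E)] | rewrite (negbTE (nHx _ vD))].
  have [->|xu] := eqVneq x u; first by right; split=> // ; rewrite (negbTE (nHx _ uD)).
  have [->|xb] := eqVneq x b; first by right; split; rewrite ?set11 // (negbTE (nHx _ bD)).
  by left; apply: out.
have [|||M' [h' _ _]] := join_slot e_sym HP h du ok _ cs.
- by rewrite /slot_end du2 (negbTE (nHx _ uD)).
- by rewrite inE.
- move=> /andP[dc _]; rewrite cn //; apply/negP => cD.
  case: (pc_ends hD cD dc) => E; first by rewrite E /= eqxx in ca.
  by rewrite E /D last_cat /= last_rcons eqxx in cb.
by have := LF_size_min Pmin h'; rewrite Ej ltnn.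
Qed.

(* Cut the link v-s and attach v to the slot: this would expose s. *)
Lemma core_link_slots a l v s r : pc ((a :: l) ++ v :: s :: r) -> s \in S -> v \notin S ->
  slots v \subset [set a].
Proof.
move=> hD sS vS; apply/subsetP => c cs; rewrite !inE; apply: contraT => ca.
set D := _ ++ _ in hD; have ED : D = rcons (a :: l) v ++ (s :: r) by rewrite cat_rcons.
have [R [h sz lkE]] := pc_front hD.
have n1 : rcons (a :: l) v != [::] by [].
have h2 : ppart e [:: rcons (a :: l) v, s :: r & R].
  by move: h; rewrite ED (ppart_cat e _ s n1) // => /andP[].
set Q := [:: _, _ & R] in h2; have hM : LF (size P).+1 (linked Q) by exists Q; rewrite sz.
have [vD sD] : v \in D /\ s \in D by split; rewrite !mem_cat !inE ?eqxx ?orbT.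
have nHx x : x \in D -> ~~ Hv x.
  by move=> xD; rewrite (pc_Hv hD xD) -(pc_Hv hD sD) (core_inner sS).2.
have out x : x != v -> x != s -> linked Q x =1 lkP x.
  move=> xv xs y; rewrite lkE ED /Q !linked_cons consec_cat same_pairE (negbTE xv) (negbTE xs) /=.
  by rewrite !orbA.
have dv : deg (linked Q) v <= 1 by apply: last_deg h2 (mem_head _ _).
have ds : deg (linked Q) s <= 1 by apply: (@head_deg _ e _ r s h2); rewrite in_cons mem_head orbT.
have dv2 : degP v = 2.
  have [l' [d El]] : exists l' d, a :: l = rcons l' d.
    by case/lastP: (l) => [|l' d]; [exists [::], a | exists (a :: l'), d].
  by rewrite /D El cat_rcons in hD; rewrite (pc_degi hD).
have ok : free_slots (linked Q) set0.
  apply: (free_slots_change (free_slots0 e P _)) => x.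
  have [->|xv] := eqVneq x v; first by right; split=> [E _|]; [first [exact: dv | exact: (dv E)] | rewrite (negbTE (nHx _ vD))].
  have [->|xs] := eqVneq x s; first by right; split=> // ; rewrite (negbTE (nHx _ sD)).
  by left; apply: out.
have sc : s != c.
  by apply: contraTneq cs => <-; rewrite inE (negbTE (core_not_end sS)) (negbTE (nHx _ sD)).
have [|||M' [h' ok' out']] := join_slot e_sym HP hM dv ok _ cs.
- by rewrite /slot_end dv2 (negbTE (nHx _ vD)).
- by rewrite inE.
- move=> /andP[dc _]; rewrite (connect_in _ h2 (mem_head _ _)) ?mem_rcons ?mem_head //.
  rewrite -mem_rcons; apply/negP => cl.
  have cD : c \in D by rewrite ED mem_cat cl.
  case: (pc_ends hD cD dc) => E; first by rewrite E /= eqxx in ca.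
  have := ppart_disj h2 cl (mem_head _ _); rewrite {1}E ED last_cat /=.
  by rewrite mem_last.
exfalso; apply: (no_core_end (A := c |: set0) h' _ ok' sS).
- by rewrite setU0 cards1.
- rewrite (deg_eq (M' := linked Q)) //; apply: out' => //; last exact: nHx.
  by apply: contraNneq vS => <-.
move=> y yT ys nys u; have yv : y != v.
  by apply: contraNneq nys => ->; rewrite (pc_nb _ hD vD) ED consec_cat /same_pair !eqxx /= orbT.
have yc : y != c.
  apply: contraNneq vS => E; rewrite E in yT; apply: (core_nbr yT).
  by move: cs; rewrite inE (negbTE (saturated_core_nflexible yT)) orbF e_sym => /andP[].
by rewrite out' ?out // saturated_core_nflexible.
Qed.

End Facts.

(** * The second minimization: arithmetic of the penalties *)

Definition penalty (m : nat) : nat := if m == 1 then 3 else (m == 3).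
Definition penalties (T : Type) (Q : seq (seq T)) := sumn [seq penalty (size D) | D <- Q].

Lemma penalties_cons (T : Type) (D : seq T) Q : penalties (D :: Q) = penalty (size D) + penalties Q.
Proof. by []. Qed.

Lemma penalties_perm (T : eqType) (Q Q' : seq (seq T)) : perm_eq Q Q' -> penalties Q = penalties Q'.
Proof. by move=> pq; rewrite /penalties; apply: perm_sumn; apply: perm_map. Qed.

Lemma addn_swap4 a b c d : a + d + b + c = b + (c + d) + a.
Proof. lia. Qed.

(** The reason for the weight 3: dissolving a singleton must outweigh two new paths on three
    vertices. *)
Lemma penalty_bound1 a b G : 0 < a -> 0 < b ->
  penalty 1 + penalty (a + b.+1) + G <= penalty a + (penalty b.+2 + G) -> a = 1.
Proof.
move=> a0 b0 le; apply/eqP; apply: contraTT le => a1; rewrite -ltnNge.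
have ga : penalty a <= 1 by rewrite /penalty (negbTE a1) leq_b1.
have gb : penalty b.+2 <= 1 by rewrite /penalty leq_b1.
by move: ga gb; move: (penalty a) (penalty b.+2) (penalty (a + b.+1)) => x y z; rewrite /penalty /=; lia.
Qed.

(** [m] is the size of the path that absorbs a leftover pair; growing by two never raises a penalty.
    Dissolving a three-vertex path thus pays off unless one of the pieces of sizes [a] and [b.+2] is
    itself penalized. *)
Lemma penalty_bound3 a b m p q G : 0 < a -> 0 < b -> p = penalty 3 + penalty (a + b.+1) + G ->
  q + penalty 2 + penalty m = penalty a + (penalty b.+2 + (penalty 2 + G)) + penalty (2 + m) -> p <= q ->
  [\/ a = 1, a = 3 | b = 1].
Proof.
move=> a0 b0 -> E le; have [|a1] := eqVneq a 1; first by constructor 1.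
have [|a3] := eqVneq a 3; first by constructor 2.
constructor 3; apply/eqP; apply: contraTT le => b1; rewrite -ltnNge.
have gm : penalty (2 + m) <= penalty m by rewrite /penalty; case: m {E} => [|[|[|[|m]]]].
have ga : penalty a = 0 by rewrite /penalty (negbTE a1) (negbTE a3).
have gb : penalty b.+2 = 0 by rewrite /penalty; case: (b) b0 b1 => [|[|b']].
by move: E gm; rewrite ga gb /=; move: (penalty m) (penalty (2 + m)) (penalty (a + b.+1)) => x y z; rewrite /penalty /=; lia.
Qed.

Lemma sum3_left a b : 0 < a -> 0 < b -> a + b.+1 = 3 -> a = 1.
Proof. lia. Qed.

Lemma perm_surgery (T : eqType) (a b Z f : seq T) x w :
  perm_eq (a ++ [:: x, w & b ++ Z ++ f]) (x :: Z ++ a ++ (w :: b) ++ f).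
Proof. by apply/seq.permP => q; rewrite !count_cat /= !count_cat /= !count_cat /=; lia. Qed.

(** * Shifting ends along a chain of paths *)

Section Chains.
Variables (T : finType) (e : rel T) (P : seq (seq T)).
Hypothesis e_sym : symmetric e.
Hypothesis HP : ppart e P.
Hypothesis Gmin : forall Q, ppart e Q -> size Q = size P -> penalties P <= penalties Q.
Implicit Types (r D : seq T) (Q R : seq (seq T)) (x y a b c l s u v w z : T) (A B : {set T}).

Local Notation lkP := (linked P).
Local Notation degP := (pdeg P).
Local Notation cmp := (pcomp P).
Local Notation pc := (oriented P).

(** The counterpart of [LF_join] that exhibits the joined lists, because penalties depend on their
    sizes. *)
Lemma join_lists Q x y : ppart e Q -> deg (linked Q) x <= 1 -> deg (linked Q) y <= 1 ->
  ~~ connect (linked Q) x y -> e x y ->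
  exists D1 D2 Q', [/\ [/\ D1 \in Q, x \in D1, D2 \in Q & y \in D2], ppart e Q', size Q = (size Q').+1 &
    penalties Q' + penalty (size D1) + penalty (size D2) = penalties Q + penalty (size D1 + size D2)].
Proof.
move=> h dx dy nc exy.
have [D1 Q1 x1] := ppart_mem x h; have [D2 Q2 y2] := ppart_mem y h.
have n12 : D2 != D1.
  by apply: contraNneq nc => E; rewrite (connect_in _ h Q1 x1) -E.
have [l' E1] := end_shape h Q1 x1 dx; have [r E2] := end_shape h Q2 y2 dy.
have p1 := perm_to_rem Q1.
have h2 : D2 \in rem D1 Q by move: Q2; rewrite (perm_mem p1) inE (negbTE n12).
have p2 := perm_to_rem h2; set R := rem D2 _ in p2.
have pQ : perm_eq Q [:: D1, D2 & R] by apply: perm_trans p1 _; rewrite perm_cons.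
have h1 : ppart e [:: rev (x :: l'), D2 & R].
  have h' : ppart e [:: D1, D2 & R] by rewrite -(ppart_perm e pQ).
  by case: E1 h' => <- h'; [apply: ppart_rev | rewrite revK].
have {}h2 : ppart e [:: rev (x :: l'), y :: r & R].
  rewrite ppart_swap; rewrite ppart_swap in h1.
  by case: E2 h1 => <- h1 //; apply: ppart_rev.
have s1 : size D1 = (size l').+1 by case: E1 => [->|E] //; rewrite -(size_rev D1) E.
have s2 : size D2 = (size r).+1 by case: E2 => [->|E] //; rewrite -(size_rev D2) E.
rewrite rev_cons in h1 h2.
have ne1 : rcons (rev l') x != [::] by case: (rev l').
exists D1, D2, ((rcons (rev l') x ++ (y :: r)) :: R); split=> //.
- by rewrite (ppart_cat _ _ x ne1 (isT : y :: r != [::])) h2 last_rcons.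
- by rewrite (perm_size pQ).
have hs : size (rcons (rev l') x ++ y :: r) = size D1 + size D2.
  by rewrite size_cat size_rcons size_rev /= s1 s2.
by rewrite (penalties_perm pQ) !penalties_cons hs addn_swap4.
Qed.

(* An end l joins the closure when its link w sees a member c of it: c can replace
   l as the end next to w. *)
Definition closure_step B (X : {set T}) : {set T} :=
  B :|: [set l | (degP l == 1) && [exists w, [&& lkP l w, degP w == 2 & [exists c in X, e w c]]]].
Definition closure_iter B n := iter n (closure_step B) set0.
Definition root_closure B := closure_iter B #|T|.

Lemma closure_step_mono B : {homo closure_step B : X Y / X \subset Y}.
Proof.
move=> X Y /subsetP XY; apply: setUS; apply/subsetP => l; rewrite !inE => /andP[-> /existsP[w]].
case/and3P => lw dw /existsP[c /andP[cX wc]]; apply/existsP; exists w; rewrite lw dw /=.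
by apply/existsP; exists c; rewrite XY.
Qed.

Lemma root_closure_fix B : root_closure B = closure_step B (root_closure B).
Proof. exact: esym (fixsetK (@closure_step_mono B)). Qed.

Lemma root_closure_base B x : x \in B -> x \in root_closure B.
Proof. by move=> xB; rewrite root_closure_fix inE xB. Qed.

Lemma root_closure_step B l w c : degP l = 1 -> lkP l w -> degP w = 2 -> c \in root_closure B -> e w c -> l \in root_closure B.
Proof.
move=> dl lw dw cB wc; rewrite root_closure_fix !inE dl eqxx /=; apply/orP; right.
by apply/existsP; exists w; rewrite lw dw /=; apply/existsP; exists c; rewrite cB.
Qed.

Lemma closure_iter_mono B n : closure_iter B n \subset closure_iter B n.+1.
Proof. by elim: n => [|n IH]; [apply: sub0set | apply: closure_step_mono]. Qed.

Lemma closure_iter_deg B n x : (forall y, y \in B -> degP y <= 1) -> x \in closure_iter B n -> degP x <= 1.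
Proof.
move=> dB; case: n => [|n]; first by rewrite inE.
by rewrite [closure_iter _ _]iterS inE => /orP[/dB//|]; rewrite inE => /andP[/eqP ->].
Qed.

(* Shifting the ends along the chain from z to c is a permutation p of the ends; it
   only breaks the links at the position of z. *)
Lemma chain B n c : (forall y, y \in B -> degP y <= 1) -> c \in closure_iter B n ->
  exists z (p : {perm T}), [/\ z \in B, p z = c, forall x, degP x = 2 -> p x = x,
    forall x, p x != x -> x \in closure_iter B n /\ (x = z \/ x \notin B) &
    forall u v, lkP u v -> u != z -> v != z -> e (p u) (p v)].
Proof.
move=> dB; elim: n c => [|n IH] c; first by rewrite inE.
move=> cX1; have [cB|cB] := boolP (c \in B).
  exists c, 1%g; split=> [||x _|x|u v uv _ _]; rewrite ?perm1 ?perm1 ?eqxx //.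
  exact: (linked_edge e_sym HP uv).
have := cX1; rewrite [closure_iter _ _]iterS -/(closure_iter B n) inE (negbTE cB) inE.
case/andP => /eqP dc /existsP[w /and3P[cw /eqP dw /existsP[c' /andP[c'X wc']]]].
have [z [p [zB pz fix2 mov lnk]]] := IH _ c'X.
have up x : x \in closure_iter B n -> x \in closure_iter B n.+1 by apply: subsetP (closure_iter_mono B n) x.
have [cX|cX] := boolP (c \in closure_iter B n).
  have [z' [p' [h1 h2 h3 h4 h5]]] := IH _ cX; exists z', p'; split=> // x /h4[xX]; split=> //; exact: up.
have pc : p c = c by apply/eqP; apply: contraNT cX => /mov[].
(* After [p] the vertex [c'] stands at the position of [z]. The transposition puts [c'] next to [w],
   which sees it, and brings [c] to the position of [z] instead. *)
exists z, (p * tperm c' c)%g; split=> //.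
- by rewrite permM pz tpermL.
- move=> x dx; rewrite permM (fix2 _ dx) tpermD //.
    by apply: contra_eq_neq dx => <-; rewrite neq_ltn ltnS (closure_iter_deg dB c'X).
  by apply: contra_eq_neq dx => <-; rewrite dc.
- move=> x; rewrite permM; have [->|xc] := eqVneq x c; first by move=> _; split=> //; right.
  have [px|px] := eqVneq (p x) x; last by move=> _; have [xX] := mov _ px; split=> //; apply: up.
  rewrite px; case: tpermP => [xc' _|E|]; last by rewrite eqxx.
    have E : x = z by apply: (@perm_inj _ p); rewrite pz px.
    by split; [apply: up; rewrite xc' | left].
  by rewrite E eqxx in xc.
have pl u v : lkP u v -> u != z -> v != z -> u = c -> e ((p * tperm c' c)%g u) ((p * tperm c' c)%g v).
  move=> uv uz vz E; rewrite E in uv *; have -> : v = w.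
    move/eqP: dc => /cards1P[w' E']; have : v \in links lkP c by rewrite inE.
    have : w \in links lkP c by rewrite inE.
    by rewrite E' !inE => /eqP -> /eqP ->.
  have tw : tperm c' c w = w.
    apply: tpermD; apply: contra_eq_neq dw => <-; last by rewrite dc.
    by rewrite neq_ltn ltnS (closure_iter_deg dB c'X).
  by rewrite !permM pc tpermR (fix2 _ dw) tw e_sym.
move=> u v uv uz vz; have [uc|uc] := eqVneq u c; first exact: pl.
have [vc|vc] := eqVneq v c; first by rewrite e_sym; apply: pl => //; rewrite lkP_sym.
have tp x : x != z -> x != c -> tperm c' c (p x) = p x.
  move=> xz xc; rewrite tpermD //; first by rewrite -pz (inj_eq perm_inj) eq_sym.
  by rewrite -{1}pc (inj_eq perm_inj) eq_sym.
by rewrite !permM !tp //; apply: lnk.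
Qed.

Lemma two_front_oriented Z D x : pc Z -> pc D -> x \in D -> x \notin Z ->
  exists R, [/\ ppart e [:: Z, D & R], size P = (size R).+2, penalties P = penalty (size Z) + penalty (size D) + penalties R &
     forall D', D' \in R -> pc D'].
Proof.
have aux E : pc E -> exists2 E0, E0 \in P & E0 = E \/ E0 = rev E.
  by case/orP => h; [exists E | exists (rev E)] => //; [left | right].
move=> /aux[Z0 PZ EZ] /aux[D0 PD ED] xD xZ.
have n0 : D0 != Z0.
  apply: contraNneq xZ => E; move: xD; have -> : (x \in D) = (x \in D0).
    by case: ED => ->; rewrite ?mem_rev.
  by rewrite E; case: EZ => ->; rewrite ?mem_rev.
have p1 := perm_to_rem PZ.
have h2 : D0 \in rem Z0 P by move: PD; rewrite (perm_mem p1) inE (negbTE n0).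
have p2 := perm_to_rem h2; set R := rem D0 _ in p2.
have pP : perm_eq P [:: Z0, D0 & R] by apply: perm_trans p1 _; rewrite perm_cons.
have h : ppart e [:: Z0, D0 & R] by rewrite -(ppart_perm e pP).
exists R; split.
- have h1 : ppart e [:: Z, D0 & R].
    by case: EZ h => -> // /(ppart_rev e_sym); rewrite revK.
  rewrite ppart_swap; rewrite ppart_swap in h1.
  by case: ED h1 => -> // /(ppart_rev e_sym); rewrite revK.
- by rewrite (perm_size pP).
- rewrite (penalties_perm pP) !penalties_cons.
  have -> : size Z0 = size Z by case: EZ => ->; rewrite ?size_rev.
  have -> : size D0 = size D by case: ED => ->; rewrite ?size_rev.
  by rewrite addnA.
by move=> D' D'R; rewrite /oriented (perm_mem pP) !inE D'R !orbT.
Qed.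

Lemma sorted_map (p : T -> T) D : (forall u v, consec D u v -> e (p u) (p v)) -> sorted e (map p D).
Proof.
elim: D => [|x [|y D] IH] // h; rewrite /= h; last by rewrite consec_cons2 /same_pair !eqxx.
by apply: IH => u v uv; apply: h; rewrite consec_cons2 uv orbT.
Qed.

Lemma consec_catl (l r : seq T) u v : consec l u v -> consec (l ++ r) u v.
Proof.
case/lastP: l => // l a h; case: r => [|b r]; first by rewrite cats0.
by rewrite consec_cat h.
Qed.

Lemma consec_catr (l r : seq T) u v : consec r u v -> consec (l ++ r) u v.
Proof.
case: r => // b r h; case/lastP: l => // l a; by rewrite consec_cat h !orbT.
Qed.

(* After the shift, remove the vertex p z from the position of z and put it next to
   w, where the path through w is cut. *)
Lemma surgery z Z (A1 : seq T) w (A2 : seq T) (p : {perm T}) : pc (z :: Z) -> pc (A1 ++ w :: A2) ->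
  A1 != [::] -> A2 != [::] -> w \notin z :: Z -> p w = w -> {in Z, p =1 id} ->
  (forall u v, lkP u v -> u != z -> v != z -> e (p u) (p v)) -> e w (p z) ->
  exists R, let Q := [:: map p A1, p z :: w :: map p A2 & (if Z is [::] then [::] else [:: Z]) ++ R] in
    [/\ ppart e Q, size P = (size R).+2, 
     penalties P = penalty (size Z).+1 + penalty (size A1 + (size A2).+1) + penalties R &
     forall u, u \notin Z -> degP u <= 1 -> deg (linked Q) (p u) <= 1].
Proof.
set D := A1 ++ w :: A2 => hZ hD n1 n2 wZ pw pZ lnk wz.
have wD : w \in D by rewrite mem_cat mem_head orbT.
have [R0 [h0 sz gE pcR]] := two_front_oriented hZ hD wD wZ.
pose Zl := if Z is [::] then [::] else [:: Z].
have fZl : flatten Zl = Z by rewrite /Zl; case: (Z) => //= *; rewrite cats0.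
exists (map (map p) R0); set Q := [:: _, _ & _].
have zn E x : E \in D :: R0 -> x \in E -> x != z.
  move=> EI xE; apply: contraTneq xE => ->; exact: (ppart_disj h0 (mem_head z Z) EI).
have pcE E : E \in D :: R0 -> pc E by rewrite inE => /orP[/eqP ->|/pcR].
have nbE E u v : E \in D :: R0 -> consec E u v -> e (p u) (p v).
  move=> EI uv; have /andP[uE vE] := consec_mem uv; apply: lnk; rewrite ?(zn E) //.
  by rewrite (pc_nb e_sym HP _ (pcE _ EI)).
have DI : D \in D :: R0 := mem_head _ _.
have pfl : perm_eq (flatten Q) (map p (flatten [:: z :: Z, D & R0])).
  rewrite /Q /= -/Zl flatten_cat fZl !map_cat -map_flatten.
  have -> : map p Z = Z by apply: map_id_in.
  by rewrite /= pw -!catA perm_surgery.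
have [/= gp0 un0 cov0] := and3P h0.
have uQ : uniq (flatten Q) by rewrite (perm_uniq pfl) (map_inj_uniq perm_inj).
have uE E : E \in Q -> uniq E.
  move=> EQ; have := uQ; have pE := perm_to_rem EQ.
  by rewrite (perm_uniq (perm_flatten pE)) cat_uniq => /and3P[].
have ppQ : ppart e Q.
  apply/and3P; split=> //; last first.
    apply/forallP => x; rewrite (perm_mem pfl); apply/mapP; exists (p^-1 x)%g; rewrite ?permKV //.
    exact: (forallP cov0).
  apply/allP => E EQ; rewrite /is_graph_path uE //.
  move: EQ; rewrite !inE mem_cat => /or3P[/eqP ->|/eqP ->|/orP[|/mapP[E0 E0R ->]]].
  - rewrite -size_eq0 size_map size_eq0 n1 /=; apply: sorted_map => u v uv.
    by apply: (nbE D) => //; apply: consec_catl.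
  - rewrite /= e_sym wz /= -{1}pw -[path _ _ _]/(sorted e (map p (w :: A2))).
    by apply: sorted_map => u v uv; apply: (nbE D) => //; apply: consec_catr.
  - rewrite /Zl; case: (Z) (gp0) => // x Z' /andP[/and3P[_ _ /= /andP[_ sZ]] _].
    by rewrite inE => /eqP ->.
  - have E0I : E0 \in D :: R0 by rewrite inE E0R orbT.
    have /andP[_ /andP[_ /allP gR]] := gp0.
    have /and3P[nE _ _] := gR _ E0R.
    rewrite -size_eq0 size_map size_eq0 nE /=; apply: sorted_map => u v; exact: nbE.
split=> //.
- by rewrite size_map.
- rewrite gE /= size_cat /=; congr (_ + _ + _).
  by rewrite /penalties -map_comp; congr sumn; apply: eq_map => E; rewrite /= size_map.
move=> u uZ du.
have [->|uz] := eqVneq u z.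
  by apply: (@head_deg _ e Q (w :: map p A2) (p z) ppQ); rewrite /Q !in_cons eqxx orbT.
have ends E : E \in D :: R0 -> u \in E -> u = head u E \/ u = last u E.
  by move=> EI uIE; apply: (pc_ends e_sym HP (pcE _ EI) uIE du).
have qh E : map p E \in Q -> u = head u E -> E != [::] -> deg (linked Q) (p u) <= 1.
  by case: E => //= x E EQ -> _; apply: (head_deg ppQ EQ).
have ql E : map p E \in Q -> u = last u E -> E != [::] -> deg (linked Q) (p u) <= 1.
  case/lastP: E => // E x; rewrite last_rcons map_rcons => EQ -> _; exact: (last_deg ppQ EQ).
have := forallP cov0 u; rewrite inE (negbTE uz) /= mem_cat (negbTE uZ) /= mem_cat.
case/orP => [uD|/flattenP[E ER uIE]].
  case: (ends _ DI uD) => Eu.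
    apply: (qh A1) => //; first by rewrite inE eqxx.
    by move: Eu; rewrite /D; case: (A1) n1.
  have [A' [x E2]] : exists (l' : seq T) x, A2 = rcons l' x by case/lastP: (A2) n2 => // l' x; exists l', x.
  have -> : u = x by rewrite Eu /D last_cat /= E2 last_rcons.
  apply: (@last_deg _ e Q (p z :: w :: map p A') (p x) ppQ).
  by rewrite /Q E2 map_rcons !in_cons /= eqxx orbT.
have EI : E \in D :: R0 by rewrite inE ER orbT.
have nE : E != [::] by case: (E) uIE.
have EQ : map p E \in Q by rewrite /Q !inE mem_cat (map_f (map p)) ?orbT.
by case: (ends _ EI uIE) => Eu; [apply: (qh E) | apply: (ql E)].
Qed.

Definition single_roots : {set T} := [set z | size (cmp z) == 1].
(** The outside slot [c] is there to receive the two vertices left over when the root leaves its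
    path. *)
Definition triple_roots : {set T} := [set z | [&& degP z == 1, size (cmp z) == 3 &
  [exists R0, exists c, [&& lkP z R0, degP R0 == 2, slot_end e P c, c \notin cmp z & e R0 c]]]].
Definition LZ := root_closure single_roots.
Definition L3 := root_closure triple_roots.

Lemma pc_cmpv v : pc (cmp v).
Proof. by rewrite /oriented (cmp_in HP). Qed.

Lemma single_roots_deg z : z \in single_roots -> degP z <= 1.
Proof.
rewrite inE => /eqP s1; have := mem_cmp HP z; have := pc_cmpv z.
case: (cmp z) s1 => [|x [|]] //= _ h; rewrite inE => /eqP ->; exact: (pc_head e_sym HP h).
Qed.

Lemma triple_roots_deg z : z \in triple_roots -> degP z <= 1.
Proof. by rewrite inE => /and3P[/eqP ->]. Qed.

Lemma inner_deg (A1 : seq T) w (A2 : seq T) : pc (A1 ++ w :: A2) -> A1 != [::] -> A2 != [::] -> degP w = 2.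
Proof.
case/lastP: A1 => // A1 a; case: A2 => // b A2; rewrite cat_rcons => h _ _.
exact: (pc_degi e_sym HP h).
Qed.

(** Cutting before [w] and putting the content of the singleton there keeps the number of paths, so
    the penalties decide. Read in the other direction, the same bound holds for [A2], and the path
    of [w] has three vertices. *)
Lemma LZ_claim c (A1 : seq T) w (A2 : seq T) : c \in LZ -> pc (A1 ++ w :: A2) -> A1 != [::] -> A2 != [::] ->
  e w c -> size A1 = 1.
Proof.
move=> cZ hD n1 n2 wc; have dw := inner_deg hD n1 n2.
have [z [p [zB pz fix2 _ lnk]]] := chain single_roots_deg cZ.
have hz : pc [:: z].
  move: zB; rewrite inE => /eqP s1; have := mem_cmp HP z; have := pc_cmpv z.
  by case: (cmp z) s1 => [|x [|]] //= _ h; rewrite inE => /eqP ->.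
have wz : w \notin [:: z].
  by rewrite inE; apply: contraTneq zB => <-; apply/negP => /single_roots_deg; rewrite dw.
rewrite -pz in wc.
have [R /= [hQ sz gE _]] := surgery hz hD n1 n2 wz (fix2 _ dw) (fun _ => ltac:(by [])) lnk wc.
have := Gmin hQ; rewrite /= sz !penalties_cons gE /= !size_map => /(_ erefl).
by apply: penalty_bound1; rewrite lt0n size_eq0.
Qed.

(* The leftover two-vertex part of the root path is attached to the end d. *)
Lemma L3_claim c (A1 : seq T) w (A2 : seq T) : c \in L3 -> pc (A1 ++ w :: A2) -> A1 != [::] -> A2 != [::] ->
  e w c -> [\/ size A1 = 1, size A1 = 3 | size A2 = 1].
Proof.
move=> cZ hD n1 n2 wc; have dw := inner_deg hD n1 n2.
have [z [p [zB pz fix2 mov lnk]]] := chain triple_roots_deg cZ.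
move: (zB); rewrite inE => /and3P[/eqP dz /eqP s3 /existsP[r0 /existsP[d]]].
case/and5P=> zr /eqP dr Ed dcz rd; have /andP[dd _] := Ed.
have [b hz] : exists b, pc [:: z; r0; b].
  have [r E] : exists r, cmp z = z :: r \/ rev (cmp z) = z :: r.
    by apply: (end_shape HP (cmp_in HP z) (mem_cmp HP z)); rewrite -/(degP z) dz.
  have hr : pc (z :: r) by case: E => <-; rewrite ?(pc_rev P) pc_cmpv.
  have sr : size (z :: r) = 3 by rewrite -s3; case: E => <-; rewrite ?size_rev.
  case: r hr sr {E} => [|x [|b [|]]] // hr _; exists b.
  have xl : x \in links lkP z by rewrite inE (pc_nb e_sym HP _ hr) ?mem_head // consec_cons2 /same_pair !eqxx.
  have rl : r0 \in links lkP z by rewrite inE.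
  by move/eqP: dz => /cards1P[y Ey]; move: xl rl; rewrite Ey !inE => /eqP E1 /eqP ->; rewrite -E1.
have uz := pc_uniq e_sym HP hz.
have cz x : (x \in cmp z) = (x \in [:: z; r0; b]) by apply: (pc_mem HP x hz); rewrite mem_head.
have bz : b != z by apply: contraTneq uz => ->; rewrite /= !inE eqxx orbT.
(* The opposite end [b] is a root as well, and a shift moves no root but [z]; so the pair [r0], [b]
   stays in place. *)
have bB : b \in triple_roots.
  have hb : pc [:: b; r0; z] by rewrite -(pc_rev P).
  have br : lkP b r0 by rewrite (pc_nb e_sym HP _ hb) ?mem_head // consec_cons2 /same_pair !eqxx.
  rewrite inE; apply/and3P; split.
  - rewrite eqn_leq (pc_head e_sym HP hb) card_gt0; apply/set0Pn; exists r0; by rewrite inE.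
  - by rewrite (pc_size HP hb) ?mem_head.
  apply/existsP; exists r0; apply/existsP; exists d; rewrite br dr Ed rd eqxx !andbT /=.
  rewrite (pc_mem HP _ hb) ?mem_head //; move: dcz; rewrite cz !inE.
  by case: (d == z); case: (d == r0); case: (d == b).
have pb : p b = b.
  apply/eqP; apply/negPn/negP => /mov[_ []]; first by move/eqP; rewrite (negbTE bz).
  by rewrite bB.
have [E|wr] := eqVneq w r0.
  have : size (A1 ++ w :: A2) = 3.
    rewrite -(pc_size HP hD (x := w)) ?mem_cat ?mem_head ?orbT // E.
    by rewrite (pc_size HP hz) // !inE eqxx orbT.
  by rewrite size_cat /= => sA; constructor 1; apply: sum3_left sA; rewrite lt0n size_eq0.
have wz : w \notin [:: z; r0; b].
  rewrite !inE (negbTE wr) /= negb_or; apply/andP; split; apply: contra_eq_neq dw => ->.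
    by rewrite dz.
  by move: bB; rewrite inE => /and3P[/eqP ->].
have pZ : {in [:: r0; b], p =1 id}.
  by move=> x; rewrite !inE => /orP[]/eqP ->; rewrite ?pb ?fix2.
rewrite -pz in wc.
have [R /= [hQ sz gE dQ]] := surgery hz hD n1 n2 wz (fix2 _ dw) pZ lnk wc.
set Q := [:: _, _, _ & R] in hQ dQ.
(* The shift may have moved the slot [d]: it now occupies the position of [d'], which is again that
   of an end. *)
pose d' := (p^-1 d)%g; have pd : p d' = d by rewrite permKV.
have nd : d \notin [:: r0; b].
  by move: dcz; rewrite cz !inE !negb_or => /and3P[_ -> ->].
have dd' : deg (linked Q) d <= 1.
  rewrite -pd; apply: dQ.
    by apply: contra nd => d'Z; rewrite -pd (pZ _ d'Z).
  have [d2|d2] := leqP (degP d') 1; first by [].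
  have E2 : degP d' = 2.
    by apply/eqP; rewrite eqn_leq d2 andbT; exact: (LF_deg d' (LF_P HP)).
  by move: dd; rewrite -pd (fix2 _ E2) E2.
have RQ : [:: r0; b] \in Q by rewrite !inE eqxx !orbT.
have nc : ~~ connect (linked Q) r0 d by rewrite (connect_in _ hQ RQ) ?mem_head.
have dr0 : deg (linked Q) r0 <= 1 by apply: head_deg hQ RQ.
have [D1 [D2 [Q' [[m1 r1 m2 c2] hQ' sQ gQ]]]] := join_lists hQ dr0 dd' nc rd.
have E1 : D1 = [:: r0; b] by apply: ppart_same hQ m1 RQ r1 (mem_head _ _).
have sQ' : size Q' = size P by rewrite sz; case: sQ.
have n21 : D2 != [:: r0; b] by apply: contraNneq nd => <-.
move: gQ; rewrite E1 /Q !penalties_cons /= !size_map => gQ.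
by apply: (penalty_bound3 _ _ gE gQ (Gmin hQ' sQ')); rewrite lt0n size_eq0.
Qed.

End Chains.

Lemma leq_card_subset (T : finType) (A B : {set T}) n : n <= #|A| -> A \subset B -> n <= #|B|.
Proof. by move=> h /subset_leq_card; apply: leq_trans. Qed.

(** * How the closures of singletons and triples relate to the core *)

Section Closures.
Variables (T : finType) (e : rel T) (P : seq (seq T)).
Hypotheses (e_sym : symmetric e) (eirr : irreflexive e).
Hypotheses (HP : ppart e P) (Pmin : forall Q, ppart e Q -> size P <= size Q).
Hypothesis Gmin : forall Q, ppart e Q -> size Q = size P -> penalties P <= penalties Q.
Implicit Types (A D r : seq T) (Q : seq (seq T)) (x y a b c l s u v w z : T) (B : {set T}).

Local Notation lkP := (linked P).
Local Notation degP := (pdeg P).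
Local Notation cmp := (pcomp P).
Local Notation pc := (oriented P).
Local Notation Hv := (in_flexible e P).
Local Notation Ev := (slot_end e P).
Local Notation slots := (slots e P).
Local Notation saturated := (saturated P).
Local Notation S := (core e P).
Local Notation LZ := (LZ e P).
Local Notation L3 := (L3 e P).

Definition nonlinks v : {set T} := [set u | e v u && ~~ lkP v u].

Lemma inner_split v : degP v = 2 -> exists A1 A2, [/\ pc (A1 ++ v :: A2), A1 != [::] & A2 != [::]].
Proof.
move=> d2; have := pc_cmpv HP v; have := mem_cmp HP v => /splitPr[A1 A2] h.
exists A1, A2; split=> //.
  by apply: contra_eq_neq d2 => E; rewrite E in h; have := pc_head e_sym HP h; case: (degP v) => [|[]].
apply: contra_eq_neq d2 => E; rewrite E cats1 in h.
by have := pc_last e_sym HP h; case: (degP v) => [|[]].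
Qed.

Lemma ends_adjacent_cyc u v : degP u <= 1 -> degP v <= 1 -> e u v -> ~~ lkP u v -> cyc e (cmp u).
Proof.
move=> du dv uv nuv; have [E|n] := eqVneq (cmp u) (cmp v); last first.
  have := endlike_nonadj e_sym HP Pmin (u := u) (v := v); rewrite /endlike du dv uv => /(_ isT isT n); by [].
have nuv' : u != v by apply: contraTneq uv => ->; rewrite eirr.
have uD := mem_cmp HP u; have vD : v \in cmp u by rewrite E (mem_cmp HP).
have hD := pc_cmpv HP u.
have nD : cmp u != [::] by apply: contraTneq uD => ->.
have ha : ends_adj e (cmp u) /\ (forall a, size (cmp u) = 2 -> lkP u v).
  case: (pc_ends e_sym HP hD uD du) (pc_ends e_sym HP hD vD dv) => Eu [] Ev'; rewrite (ends_adjE e u nD).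
  - by move: Eu Ev' nuv'; case: (cmp u) uD => //= a r _ -> ->; rewrite eqxx.
  - split; first by rewrite -Eu; have -> : last u (cmp u) = v by rewrite Ev'; case: (cmp u) uD.
    move=> _ s2; rewrite (pc_nb e_sym HP _ hD uD).
    by move: Eu Ev' s2; case: (cmp u) => [|a [|b [|]]] //= -> -> _; rewrite !eqxx.
  - split; first by rewrite -Eu e_sym; have -> : head u (cmp u) = v by rewrite Ev'; case: (cmp u) uD.
    move=> _ s2; rewrite (pc_nb e_sym HP _ hD uD).
    by move: Eu Ev' s2; case: (cmp u) => [|a [|b [|]]] //= -> -> _; rewrite !eqxx orbT.
  - have : last u (cmp u) = last v (cmp u) by case: (cmp u) uD.
    by rewrite -Eu -Ev' => E'; rewrite E' eqxx in nuv'.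
rewrite /cyc ha.1 andbT; move: ha.2 => /(_ u) s2.
have : 1 < size (cmp u).
  case Ec: (cmp u) uD vD => [|a [|]] //; rewrite !inE => /eqP E1 /eqP E2.
  by rewrite E1 E2 eqxx in nuv'.
rewrite leq_eqVlt => /orP[/eqP s|//]; by rewrite s2 in nuv.
Qed.

Lemma root_closure_ind B (X : T -> Prop) : (forall z, z \in B -> X z) ->
  (forall l w c, degP l = 1 -> lkP l w -> degP w = 2 -> X c -> e w c -> X l) ->
  forall l, l \in root_closure e P B -> X l.
Proof.
move=> hB hs; suff : forall n l, l \in closure_iter e P B n -> X l by move=> h l; apply: h.
elim=> [|n IH] l; first by rewrite inE.
rewrite [closure_iter _ _ _ _]iterS -/(closure_iter e P B n) => /setUP[/hB//|]; rewrite inE => /andP[/eqP dl /existsP[w]].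
by case/and3P => lw /eqP dw /existsP[c /andP[/IH cX wc]]; apply: hs wc.
Qed.

Lemma endlike_cyc u v : degP u <= 1 -> cyc e (cmp v) -> e v u -> cmp u = cmp v.
Proof.
move=> du cv vu; apply/eqP; apply: contraTT vu => n.
by apply: (endlike_nonadj e_sym HP Pmin); rewrite /endlike ?du ?cv ?orbT // eq_sym.
Qed.

(** Closedness would propagate back to the roots: if the path of [w] closes up, the end [c] seen by
    [w] lies on that same path. *)
Lemma root_closure_end B : (forall z, z \in B -> degP z <= 1 /\ ~~ cyc e (cmp z)) ->
  forall l, l \in root_closure e P B -> degP l <= 1 /\ ~~ cyc e (cmp l).
Proof.
move=> hB; apply: (root_closure_ind (X := fun l => degP l <= 1 /\ ~~ cyc e (cmp l))) => // l w c dl lw dw [dc nc] wc; split; first by rewrite dl.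
rewrite (lkP_cmp HP lw); apply: contra nc => cw.
by rewrite (endlike_cyc dc cw wc).
Qed.

Lemma triple_roots_end z : z \in triple_roots e P -> degP z <= 1 /\ ~~ cyc e (cmp z).
Proof.
rewrite inE => /and3P[/eqP -> _ /existsP[r0 /existsP[d /and5P[zr _ /andP[dd _] dz rd]]]]; split=> //.
apply: contra dz => cz; rewrite (mem_cmp_eq HP); apply/eqP.
by rewrite (lkP_cmp HP zr) in cz *; apply: endlike_cyc.
Qed.

Lemma single_roots_end z : z \in single_roots P -> degP z <= 1 /\ ~~ cyc e (cmp z).
Proof. by move=> zB; split; [apply: (single_roots_deg e_sym HP) | move: zB; rewrite inE /cyc => /eqP ->]. Qed.

Lemma LZ_end l : l \in LZ -> degP l <= 1 /\ ~~ cyc e (cmp l).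
Proof. exact: (root_closure_end single_roots_end). Qed.

Lemma L3_end l : l \in L3 -> degP l <= 1 /\ ~~ cyc e (cmp l).
Proof. exact: (root_closure_end triple_roots_end). Qed.

Lemma ncyc_nflexible v : ~~ cyc e (cmp v) -> ~~ Hv v.
Proof. by apply: contra; apply: cycH. Qed.

Lemma ncyc_slot_end v : degP v <= 1 -> ~~ cyc e (cmp v) -> Ev v.
Proof. by move=> d n; rewrite /slot_end d (ncyc_nflexible n). Qed.

Lemma Ev_slot c v : Ev c -> e v c -> c \in slots v.
Proof. by move=> h1 h2; rewrite inE h1 h2. Qed.

Lemma slots3 v x y z : x \in slots v -> y \in slots v -> z \in slots v ->
  x != y -> x != z -> y != z -> v \in S.
Proof.
move=> hx hy hz xy xz yz; apply: many_slots_core; apply: (@leq_card_subset _ [set x; y; z]).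
  by rewrite setUC cardsU1 cards2 !inE negb_or ![z == _]eq_sym xy xz yz.
by apply/subsetP => t /setUP[/set2P[]|/set1P] ->.
Qed.

Lemma leaf_saturated l w : degP l = 1 -> lkP l w -> w \in S -> l \in saturated S.
Proof.
move=> dl lw wS; move/eqP: dl => /cards1P[w' E]; have : w \in links lkP l by rewrite inE.
rewrite {1}E => /set1P Ew; rewrite inE E -Ew sub1set wS andbT.
by apply/set0Pn; exists w; rewrite inE.
Qed.

Lemma link_e u v : lkP u v -> e u v. Proof. exact: (linked_edge e_sym HP). Qed.

Lemma pc_nbx D x y : pc D -> x \in D -> lkP x y = consec D x y.
Proof. exact: (pc_nb e_sym HP). Qed.

Lemma slots_P3 a v b c : pc [:: a; v; b] -> ~~ flexible e [:: a; v; b] -> Ev c -> e v c ->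
  c != a -> c != b -> v \in S.
Proof.
move=> hD nH Ec vc ca cb.
have inD x : x \in [:: a; v; b] -> ~~ Hv x by move=> xD; rewrite (pc_Hv e_sym HP hD xD).
have [_ ab] := pc_inner e_sym HP (l := [::]) hD.
have Ea : Ev a by rewrite /slot_end (pc_head e_sym HP hD) inD // mem_head.
have Eb : Ev b by rewrite /slot_end (@pc_last _ _ _ e_sym HP [:: a; v]) // inD // !inE eqxx !orbT.
have va : lkP v a by rewrite (pc_nbx _ hD) ?inE ?eqxx ?orbT // consec_cons2 /same_pair !eqxx orbT.
have vb : lkP v b by rewrite (pc_nbx _ hD) ?inE ?eqxx ?orbT // !consec_cons2 /same_pair !eqxx !orbT.
by apply: (@slots3 _ a b c); rewrite 1?[_ == c]eq_sym //; apply: Ev_slot => //; apply: link_e.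
Qed.

Lemma triple_nflexible a v b : ~~ flexible e [:: a; v; b].
Proof. by rewrite /flexible /= andbF. Qed.

(** The middle vertex of a root path sees three slots, its two ends and the outside one, so it is in
    the core. Along the closure, a saturated [c] puts its neighbour [w] into the core, and this
    saturates [l]. *)
Lemma L3_saturated l : l \in L3 -> l \in saturated S.
Proof.
move: l; apply: (root_closure_ind (X := fun l => l \in saturated S)) => [z|l w c dl lw dw cT wc]; last first.
  by apply: leaf_saturated dl lw _; apply: (core_nbr e_sym cT); rewrite e_sym.
rewrite inE => /and3P[/eqP dz /eqP s3 /existsP[r0 /existsP[d /and5P[zr /eqP dr Ed dz' rd]]]].
apply: (leaf_saturated dz zr); have [A1 [A2 [hD n1 n2]]] := inner_split dr.
have rD : r0 \in A1 ++ r0 :: A2 by rewrite mem_cat mem_head orbT.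
have sD : size (A1 ++ r0 :: A2) = 3 by rewrite -s3 (lkP_cmp HP zr) (pc_size HP hD rD).
have dD : d \notin A1 ++ r0 :: A2.
  by rewrite -(pc_mem HP _ hD rD) -(lkP_cmp HP zr).
case: A1 n1 hD sD dD {rD} => // a [|? A1] _; last by case: A2 n2 => // ? ? _ _; rewrite size_cat /= => *; lia.
case: A2 n2 => // b [|//] _ hD _; rewrite !inE !negb_or => /and3P[da _ db].
exact: slots_P3 hD (triple_nflexible _ _ _) Ed rd da db.
Qed.

Lemma rev_mid A1 v A2 : pc (A1 ++ v :: A2) -> pc (rev A2 ++ v :: rev A1).
Proof. by rewrite -(pc_rev P) rev_cat rev_cons cat_rcons. Qed.

Lemma revn A1 : A1 != [::] -> rev A1 != [::].
Proof. by rewrite -!size_eq0 size_rev. Qed.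

Lemma LZ_P3 c v : c \in LZ -> degP v = 2 -> e v c -> exists a b, pc [:: a; v; b].
Proof.
move=> cZ dv vc; have [A1 [A2 [hD n1 n2]]] := inner_split dv.
have s1 := LZ_claim e_sym HP Gmin cZ hD n1 n2 vc.
have := LZ_claim e_sym HP Gmin cZ (rev_mid hD) (revn n2) (revn n1) vc; rewrite size_rev => s2.
case: A1 n1 s1 hD => // a [|//] _ _; case: A2 n2 s2 => // b [|//] _ _ hD.
by exists a, b.
Qed.

Lemma P3_links a v b u : pc [:: a; v; b] -> lkP v u = (u == a) || (u == b).
Proof. by move=> hD; have [E _] := pc_inner e_sym HP (l := [::]) hD; move/setP/(_ u): E; rewrite !inE. Qed.

(** [v] is the middle of a three-vertex path, and its two ends together with [c] are three slots. *)
Lemma LZ_S c v : c \in LZ -> degP v = 2 -> c \in nonlinks v -> v \in S.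
Proof.
move=> cZ dv; rewrite inE => /andP[vc nvc]; have [a [b hD]] := LZ_P3 cZ dv vc.
move: nvc; rewrite (P3_links _ hD) negb_or => /andP[ca cb].
by apply: slots_P3 hD (triple_nflexible _ _ _) _ vc ca cb; have [d n] := LZ_end cZ; apply: ncyc_slot_end.
Qed.

End Closures.

Ltac arith := clear; lia.

Lemma sum_mem (T : finType) (X B : {set T}) (k : nat) :
  \sum_(u in X) k * (u \in B) = k * #|X :&: B|.
Proof.
rewrite -big_distrr /= -sum1_card [in RHS]big_mkcond [in LHS]big_mkcond /=; congr (_ * _).
by apply: eq_bigr => u _; rewrite inE; case: (u \in X); case: (u \in B).
Qed.

(** * Discharging *)

Section Payments.
Variables (T : finType) (e : rel T) (P : seq (seq T)).
Hypotheses (e_sym : symmetric e) (eirr : irreflexive e).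
Hypotheses (HP : ppart e P) (Pmin : forall Q, ppart e Q -> size P <= size Q).
Hypothesis Gmin : forall Q, ppart e Q -> size Q = size P -> penalties P <= penalties Q.
Hypothesis reg : forall v, #|nbhd e v| = 6.
Implicit Types (Q : seq (seq T)) (x y u v : T) (B : {set T}).

Local Notation lkP := (linked P).
Local Notation degP := (pdeg P).
Local Notation cmp := (pcomp P).
Local Notation Hv := (in_flexible e P).
Local Notation Ev := (slot_end e P).
Local Notation own := (own e P).
Local Notation slots := (slots e P).
Local Notation saturated := (saturated P).
Local Notation S := (core e P).
Local Notation LZ := (LZ e P).
Local Notation L3 := (L3 e P).
Local Notation nonlinks := (nonlinks e P).

(* An end in LZ or L3 receives a bonus along its five non-links and passes part of
   it on to the vertex it is linked to. *)
Definition bonus u := if u \in LZ then 6 else if u \in L3 then 2 else 0.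
Local Notation ext := bonus.
(** Four times the bonus: an inner vertex has four non-links, and this is the most it pays them in
    bonuses of that kind. *)
Definition refund u := if u \in LZ then 24 else if u \in L3 then 8 else 0.
Local Notation ret := refund.
Definition inner_saturated u := (u \in saturated S) && (degP u == 2).
Definition other_flexible u v := Hv u && (cmp u != cmp v).
Definition tariff u v := 6 * Ev u + 3 * inner_saturated u + 2 * other_flexible u v + ext u.
Local Notation rate := tariff.
(* The amount that v pays to its neighbour u. *)
Definition payment u v := if lkP u v then 6 * (u \in S) + ret v else rate u v.
Definition pay v := \sum_(u in nbhd e v) payment u v.
Definition gain v := \sum_(u in nbhd e v) payment v u.

Lemma in_nonlinks u v : (u \in nonlinks v) = e v u && ~~ lkP v u.
Proof. by rewrite inE. Qed.

Lemma sum_gain : \sum_v gain v = \sum_v pay v.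
Proof.
rewrite /gain /pay [RHS](exchange_big_dep predT) //=; apply: eq_bigr => v _.
by apply: eq_bigl => u; rewrite !inE e_sym.
Qed.

Lemma split_nbhd v (F : T -> nat) :
  \sum_(u in nbhd e v) F u = \sum_(u in links lkP v) F u + \sum_(u in nonlinks v) F u.
Proof.
rewrite (bigID (fun u => lkP v u)) /=; congr (_ + _); apply: eq_bigl => u; rewrite !inE.
  by case uv: (lkP v u); rewrite ?andbF // (link_e e_sym HP uv).
by [].
Qed.

Lemma card_nonlinks v : degP v + #|nonlinks v| = 6.
Proof. by have := split_nbhd v (fun=> 1); rewrite !sum1_card reg. Qed.

Lemma pay_split v :
  pay v = 6 * #|links lkP v :&: S| + degP v * ret v + \sum_(u in nonlinks v) rate u v.
Proof.
rewrite /pay split_nbhd; congr (_ + _).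
  rewrite (eq_bigr (fun u => 6 * (u \in S) + ret v)).
    by rewrite big_split /= sum_mem sum_nat_const.
  by move=> u; rewrite inE lkP_sym /payment => ->.
by apply: eq_bigr => u; rewrite inE lkP_sym /payment => /andP[_ /negbTE ->].
Qed.

Lemma gain_split v :
  gain v = degP v * (6 * (v \in S)) + \sum_(u in links lkP v) ret u + \sum_(u in nonlinks v) rate v u.
Proof.
rewrite /gain split_nbhd; congr (_ + _).
  rewrite (eq_bigr (fun u => 6 * (v \in S) + ret u)).
    by rewrite big_split /= sum_nat_const.
  by move=> u; rewrite inE /payment => ->.
by apply: eq_bigr => u; rewrite inE /payment => /andP[_ /negbTE ->].
Qed.

Lemma gain_lb v : degP v * (6 * (v \in S)) + \sum_(u in links lkP v) ret u +
  #|nonlinks v| * (6 * Ev v + 3 * inner_saturated v + ext v) <= gain v.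
Proof.
rewrite gain_split leq_add2l -sum_nat_const; apply: leq_sum => u _.
by rewrite /rate; arith.
Qed.

Lemma refund_eq0 v : degP v = 2 -> ret v = 0.
Proof.
move=> d2; rewrite /ret; case: ifP => [/(LZ_end e_sym HP Pmin)[]|_]; first by rewrite d2.
by case: ifP => [/(L3_end e_sym HP Pmin)[]|_]; first by rewrite d2.
Qed.

Lemma refund_cyc v : cyc e (cmp v) -> ret v = 0.
Proof.
move=> cv; rewrite /ret; case: ifP => [/(LZ_end e_sym HP Pmin)[]|_]; first by rewrite cv.
by case: ifP => [/(L3_end e_sym HP Pmin)[]|_]; first by rewrite cv.
Qed.

Lemma refund_bonus v : ret v <= 5 * ext v.
Proof. by rewrite /ret /ext; case: ifP => _ //; case: ifP. Qed.

Lemma inner_saturated_eq0 u v : v \notin S -> u \in nonlinks v -> inner_saturated u = false.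
Proof.
move=> vS; rewrite inE => /andP[vu _]; apply/negbTE; apply: contra vS => /andP[uT _].
by apply: (core_nbr e_sym uT); rewrite e_sym.
Qed.

(** Bonuses are a burden of core vertices only: neighbours of [L3] are in the core because [L3] is
    saturated, and inner non-links of [LZ] are in the core by [LZ_S]. *)
Lemma bonus_eq0 u v : v \notin S -> u \in nonlinks v -> ext u = 0.
Proof.
move=> vS uv; have := uv; rewrite inE => /andP[vu nvu]; rewrite /ext.
case: ifP => [uZ|_].
  have [du nu] := LZ_end e_sym HP Pmin uZ.
  have [d1|d2] := leqP (degP v) 1.
    have uv' : e u v by rewrite e_sym.
    by move: nu; rewrite (ends_adjacent_cyc e_sym eirr HP Pmin du d1 uv') // lkP_sym.
  have {}d2 : degP v = 2.
    by apply/eqP; rewrite eqn_leq d2 andbT; apply: (LF_deg v (LF_P HP)).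
  by move: vS; rewrite (LZ_S e_sym HP Pmin Gmin uZ d2).
case: ifP => // uL; have uT := L3_saturated e_sym HP uL.
have uv' : e u v by rewrite e_sym.
by rewrite (core_nbr e_sym uT uv') in vS.
Qed.

Lemma tariff_notin_core u v : v \notin S -> u \in nonlinks v -> rate u v = 6 * Ev u + 2 * other_flexible u v.
Proof. by move=> vS uv; rewrite /rate (inner_saturated_eq0 vS uv) (bonus_eq0 vS uv) muln0 !addn0. Qed.

Lemma flexible_slot u v : Hv u -> e v u -> own u \in slots v.
Proof.
move=> Hu vu; rewrite inE; apply/orP; right.
have E := cmp_own HP u; have Ho : Hv (own u) by rewrite (Hv_cmp e E).
rewrite Ho (own_cmp HP E) // eqxx E /=.
by apply/hasP; exists u => //; apply: (mem_cmp HP).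
Qed.

Lemma own_flexible u : Hv u -> Hv (own u).
Proof. by move=> Hu; rewrite (Hv_cmp e (cmp_own HP u)). Qed.

Lemma tariff_sum_slots v B : v \notin S -> slots v \subset B -> (forall x, x \in B -> ~~ Hv x) ->
  \sum_(u in nonlinks v) rate u v <= 6 * #|nonlinks v :&: B|.
Proof.
move=> vS /subsetP sB nH; rewrite -sum_mem; apply: leq_sum => u uv; rewrite (tariff_notin_core vS uv).
have := uv; rewrite inE => /andP[vu _].
have -> : other_flexible u v = false.
  apply/negbTE/negP => /andP[Hu _]; have := nH _ (sB _ (flexible_slot Hu vu)); by rewrite own_flexible.
rewrite muln0 addn0 leq_mul2l /=; case Eu: (Ev u) => //.
by rewrite (sB _ (Ev_slot Eu vu)).
Qed.

(** Many neighbours may share one flexible path, but that path already uses one of the two slots.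
    The extremes are two ends, or one end and three flexible neighbours; both cost 12. *)
Lemma tariff_sum_le12 v : v \notin S -> degP v = 2 -> \sum_(u in nonlinks v) rate u v <= 12.
Proof.
move=> vS d2; rewrite (eq_bigr (fun u => 6 * (u \in [set u | Ev u]) + 2 * (u \in [set u | other_flexible u v]))).
  rewrite big_split /= !sum_mem; set X := nonlinks v :&: _; set Y := nonlinks v :&: _.
  have cXY : #|X| + #|Y| <= 4.
    have <- : #|nonlinks v| = 4 by have := card_nonlinks v; rewrite d2 => -[].
    rewrite -cardsUI; have -> : X :&: Y = set0.
      apply/setP => u; rewrite !inE /other_flexible /slot_end; case: (Hv u); by rewrite ?andbF.
    by rewrite cards0 addn0 subset_leq_card // subUset !subsetIl.
  have sX : X \subset slots v.
    apply/subsetP => u /setIP[]; rewrite in_nonlinks in_set => /andP[vu _] Eu; exact: Ev_slot.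
  have sl := slots_notin_core vS; have cX := leq_trans (subset_leq_card sX) sl.
  have cY : 0 < #|Y| -> #|X| <= 1.
    rewrite card_gt0 => /set0Pn[u /setIP[]]; rewrite in_nonlinks in_set => /andP[vu _] /andP[Hu _]; have oX : own u \notin X.
      by rewrite !inE /slot_end own_flexible // !andbF.
    rewrite -ltnS; apply: leq_trans sl; have <- : #|own u |: X| = #|X|.+1 by rewrite cardsU1 oX.
    by apply: subset_leq_card; rewrite subUset sub1set sX (flexible_slot Hu vu).
  by move: cXY cX cY; move: #|X| #|Y| => x y; arith.
by move=> u uv; rewrite (tariff_notin_core vS uv) !inE.
Qed.

Lemma tariff_sum_end v : degP v <= 1 -> ~~ cyc e (cmp v) -> \sum_(u in nonlinks v) rate u v = 0.
Proof.
move=> dv nc; apply: big1 => u uv.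
have vS : v \notin S.
  by apply/negP => /(core_inner e_sym eirr HP Pmin)[d _]; rewrite d in dv.
rewrite (tariff_notin_core vS uv); have := uv; rewrite inE => /andP[vu nvu].
have -> : Ev u = false.
  apply/negbTE/negP => /andP[du _].
  by move: nc; rewrite (ends_adjacent_cyc e_sym eirr HP Pmin dv du vu nvu).
have -> // : other_flexible u v = false.
apply/negbTE/negP => /andP[Hu n]; have := endlike_nonadj e_sym HP Pmin (Hv_endlike Hu) _ n.
by rewrite /endlike dv e_sym vu => /(_ isT).
Qed.

End Payments.

(** * Final charge of inner vertices *)

Section Slack.
Variables (T : finType) (e : rel T) (P : seq (seq T)).
Hypotheses (e_sym : symmetric e) (eirr : irreflexive e).
Hypotheses (HP : ppart e P) (Pmin : forall Q, ppart e Q -> size P <= size Q).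
Hypothesis Gmin : forall Q, ppart e Q -> size Q = size P -> penalties P <= penalties Q.
Hypothesis reg : forall v, #|nbhd e v| = 6.
Implicit Types (r : seq T) (Q : seq (seq T)) (x y a c s u v w z : T) (B : {set T}).

Local Notation lkP := (linked P).
Local Notation degP := (pdeg P).
Local Notation pc := (oriented P).
Local Notation Hv := (in_flexible e P).
Local Notation Ev := (slot_end e P).
Local Notation slots := (slots e P).
Local Notation saturated := (saturated P).
Local Notation S := (core e P).
Local Notation LZ := (LZ e P).
Local Notation L3 := (L3 e P).
Local Notation nonlinks := (nonlinks e P).
Local Notation pay := (pay e P).
Local Notation gain := (gain e P).
Local Notation ret := (refund e P).
Local Notation ext := (bonus e P).
Local Notation rate := (tariff e P).

(* Natural-number form of: the final charge of v is at least k. *)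
Definition slackness v k := pay v + k <= 12 + gain v.
Local Notation slack := slackness.

Lemma slack_le v k k' : k' <= k -> slack v k -> slack v k'.
Proof. by rewrite /slack; move: (pay v) (gain v) => p penalty; arith. Qed.

Definition frame (l : seq T) x v y r := pc (rcons l x ++ v :: y :: r).

Lemma frame_rev l x v y r : frame l x v y r -> frame (rev r) y v x (rev l).
Proof.
by rewrite /frame -(pc_rev P) rev_cat rev_rcons !rev_cons cat_rcons.
Qed.

Lemma frame_links l x v y r : frame l x v y r -> links lkP v = [set x; y] /\ x != y.
Proof. by rewrite /frame cat_rcons; apply: (pc_inner e_sym HP). Qed.

Lemma frame_deg l x v y r : frame l x v y r -> degP v = 2.
Proof. by move=> /frame_links[E n]; rewrite /pdeg /deg E cards2 n. Qed.

Lemma frame_nl l x v y r : frame l x v y r -> #|nonlinks v| = 4.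
Proof. by move=> /frame_deg d; have := card_nonlinks e_sym HP reg v; rewrite d => -[]. Qed.

Lemma cards2I x y B : x != y -> #|[set x; y] :&: B| = (x \in B) + (y \in B).
Proof.
move=> n; have h z : [set z] :&: B = if z \in B then [set z] else set0.
  by apply/setP => u; rewrite !inE; case: eqP => [->|]; case: ifP; rewrite ?inE ?eqxx // => _ /eqP/negbTE ->.
rewrite setIUl cardsU; have -> : [set x] :&: B :&: ([set y] :&: B) = set0.
  by apply/setP => u; rewrite !inE; case: eqP => // ->; rewrite (negbTE n) andbF.
by rewrite cards0 subn0 !h; do 2!case: ifP; rewrite ?cards1 ?cards0.
Qed.

Lemma frame_pay l x v y r : frame l x v y r ->
  pay v = 6 * ((x \in S) + (y \in S)) + \sum_(u in nonlinks v) rate u v.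
Proof.
move=> hD; have [E n] := frame_links hD.
rewrite (pay_split e_sym HP) E cards2I // (refund_eq0 e_sym HP Pmin (frame_deg hD)) muln0 addn0 //.
Qed.

Lemma slots_left_end l x v y r : frame l x v y r -> y \in S -> v \notin S ->
  slots v \subset [set head x (rcons l x)].
Proof. by case: l => [|a l]; apply: (core_link_slots e_sym eirr HP Pmin). Qed.

Lemma slots_right_end l x v y r : frame l x v y r -> x \in S -> v \notin S ->
  slots v \subset [set last y r].
Proof.
move=> /frame_rev h xS vS; have := slots_left_end h xS vS.
by rewrite -rev_cons head_rev.
Qed.

Lemma frame_nH l x v y r s u : frame l x v y r -> s \in S -> s \in rcons l x ++ v :: y :: r ->
  u \in rcons l x ++ v :: y :: r -> ~~ Hv u.
Proof.
move=> h sS sD uD; rewrite (pc_Hv e_sym HP h uD) -(pc_Hv e_sym HP h sD).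
by case: (core_inner e_sym eirr HP Pmin sS).
Qed.

Lemma head_in x l : head x (rcons l x) \in rcons l x.
Proof. by case: l => [|a l]; rewrite /= mem_head. Qed.

Lemma frame_neq l x v y r : frame l x v y r -> head x (rcons l x) != last y r.
Proof.
move=> /(pc_uniq e_sym HP); rewrite cat_uniq => /and3P[_ /hasPn hn _].
have := hn (last y r); rewrite inE mem_last orbT => /(_ isT) /= h.
by apply: contraNneq h => <-; apply: head_in.
Qed.

Lemma slack_slots l x v y r B n k : frame l x v y r -> v \notin S -> slots v \subset B ->
  (forall u, u \in B -> ~~ Hv u) -> #|nonlinks v :&: B| <= n ->
  6 * ((x \in S) + (y \in S)) + 6 * n + k <= 12 -> slack v k.
Proof.
move=> h vS sB nH hn; rewrite /slack (frame_pay h).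
have := tariff_sum_slots e_sym eirr HP Pmin Gmin vS sB nH.
by move: hn; move: #|_| (\sum_(_ in _) _) (gain v) ((x \in S) + _) => c1 c2 c3 c4; arith.
Qed.

(** Each core neighbour confines the slots of [v] to one end of the path, and the two ends differ,
    so [v] sees no slot. The 6 + 6 paid to the core comes back as 3 from each of four non-links. *)
Lemma inner_saturated_slack l x v y r : frame l x v y r -> x \in S -> y \in S -> slack v 12.
Proof.
move=> h xS yS; have [E n] := frame_links h.
have vS : v \notin S.
  apply/negP => vS; have := core_unlinked e_sym eirr HP Pmin vS xS.
  by have : x \in links lkP v; [rewrite E !inE eqxx | rewrite inE => ->].
have s0 : slots v \subset set0.
  apply/subsetP => c cs; have := subsetP (slots_left_end h yS vS) _ cs; have := subsetP (slots_right_end h xS vS) _ cs.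
  by rewrite !inE => /eqP -> /eqP E'; have := frame_neq h; rewrite E' eqxx.
have := tariff_sum_slots e_sym eirr HP Pmin Gmin vS s0 (fun x => ltac:(by rewrite inE)).
have vT : inner_saturated e P v.
  rewrite /inner_saturated (frame_deg h) eqxx andbT inE E; apply/andP; split.
    by apply/set0Pn; exists x; rewrite !inE eqxx.
  by apply/subsetP => u /set2P[] ->.
have := gain_lb e_sym HP v; rewrite /slack (frame_pay h) xS yS setI0 cards0 (frame_nl h) vT.
move: (gain v) (\sum_(u in nonlinks v) _) (_ + \sum_(u in links _ _) _) (slot_end _ _ _) (ext v) => c1 c2 c3 c4 c5; arith.
Qed.

(** A single link into the core costs 6 but leaves at most one slot to pay for; with no such link,
    [tariff_sum_le12] applies. *)
Lemma inner_slack_notin_core l x v y r : frame l x v y r -> v \notin S -> slack v 0.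
Proof.
move=> h vS; have [xS|xS] := boolP (x \in S).
  have [yS|yS] := boolP (y \in S); first exact: slack_le (inner_saturated_slack h xS yS).
  apply: (slack_slots (n := 1) h vS (slots_right_end h xS vS)); last by rewrite xS (negbTE yS).
    move=> u /set1P ->; apply: (frame_nH h xS); rewrite !mem_cat ?mem_rcons ?mem_head //.
    by apply/orP; right; rewrite in_cons mem_last orbT.
  by apply: leq_trans (subset_leq_card (subsetIr _ _)) _; rewrite cards1.
have [yS|yS] := boolP (y \in S).
  apply: (slack_slots (n := 1) h vS (slots_left_end h yS vS)); last by rewrite yS (negbTE xS).
    move=> u /set1P ->; apply: (frame_nH h yS); rewrite !mem_cat ?head_in //.
    by rewrite !inE eqxx !orbT.
  by apply: leq_trans (subset_leq_card (subsetIr _ _)) _; rewrite cards1.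
have := tariff_sum_le12 e_sym eirr HP Pmin Gmin reg vS (frame_deg h).
rewrite /slack (frame_pay h) (negbTE xS) (negbTE yS).
move: (gain v) (\sum_(u in nonlinks v) _) => c1 c2; arith.
Qed.

Lemma deg_link u w : degP u <= 1 -> lkP u w -> degP u = 1.
Proof.
move=> d uw; apply/eqP; rewrite eqn_leq d card_gt0; apply/set0Pn; exists w; by rewrite inE.
Qed.

Lemma frame_head x v y r : frame [::] x v y r -> degP x = 1 /\ lkP x v.
Proof.
move=> h; have xv : lkP x v by rewrite (pc_nb e_sym HP _ h) ?mem_head // consec_cons2 /same_pair !eqxx.
by split=> //; apply: deg_link xv; apply: (pc_head e_sym HP h).
Qed.

(** The rates 6, 3 and 2 exclude each other. *)
Lemma tariff_core u v : v \in S -> rate u v <= 6 + ext u.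
Proof.
move=> vS; rewrite /tariff leq_add2r /other_flexible /inner_saturated.
have [/andP[du nu]|nE] := boolP (Ev u).
  by rewrite (negbTE nu) (_ : (degP u == 2) = false) ?andbF //; apply: contraTF du => /eqP ->.
have [uT|uT] := boolP (u \in saturated S); last by rewrite /=; case: (_ && _).
rewrite (negbTE (saturated_core_nflexible e_sym eirr HP Pmin uT)) /=; by case: (_ == _).
Qed.

Lemma refund_L3 v : v \in L3 -> 8 <= ret v.
Proof. by rewrite /refund => ->; case: ifP. Qed.

Lemma refund_LZ v : v \in LZ -> ret v = 24.
Proof. by rewrite /refund => ->. Qed.

Lemma sum_bonus v k n : #|nonlinks v| = n -> (forall u, u \in nonlinks v -> ext u <= k) ->
  \sum_(u in nonlinks v) ext u <= n * k.
Proof. by move=> <- h; rewrite -sum_nat_const; apply: leq_sum. Qed.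

Lemma bonus_le6 u : ext u <= 6.
Proof. by rewrite /bonus; case: ifP => // _; case: ifP. Qed.

(** Without bonuses a core vertex breaks even. By the claims on [LZ] and [L3], a payer of bonuses
    has an adjacent end whose refund covers them, except in the middle of a seven-vertex path, where
    up to four bonuses of 2 may be missing. *)
Lemma inner_slack_core l x v y r : frame l x v y r -> v \in S ->
  pay v + (ret x + ret y) <= gain v + 12 + \sum_(u in nonlinks v) ext u /\
  (slack v 0 \/ [/\ size l = 2, size r = 2 & pay v <= 20 + gain v]).
Proof.
move=> h vS; have [E n] := frame_links h.
have lkS u : lkP v u -> u \notin S.
  by apply: contraL => uS; apply: (core_unlinked e_sym eirr HP Pmin).
have xS : x \notin S by apply: lkS; have : x \in links lkP v; [rewrite E !inE eqxx | rewrite inE].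
have yS : y \notin S by apply: lkS; have : y \in links lkP v; [rewrite E !inE eqxx orbT | rewrite inE].
have hg : 12 + (ret x + ret y) <= gain v.
  have := gain_lb e_sym HP v; rewrite (frame_deg h) vS E big_setU1 ?inE //= big_set1.
  rewrite muln1; move: (gain v) (#|_| * _) (ret x + ret y) => c1 c2 c3; arith.
have hp : pay v <= 24 + \sum_(u in nonlinks v) ext u.
  rewrite (frame_pay h) (negbTE xS) (negbTE yS) muln0 add0n.
  have <- : \sum_(u in nonlinks v) 6 = 24 by rewrite sum_nat_const (frame_nl h).
  by rewrite -big_split; apply: leq_sum => u _; apply: tariff_core.
split; first by move: hg hp; move: (gain v) (pay v) (ret x + ret y) (\sum_(_ in _) _) => c1 c2 c3 c4; arith.
have main k j : \sum_(u in nonlinks v) ext u <= k -> k <= j -> j <= ret x + ret y -> slack v 0.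
  move: hg hp; rewrite /slack; move: (gain v) (pay v) (ret x + ret y) (\sum_(_ in _) _) => c1 c2 c3 c4; arith.
have vD : degP v = 2 := frame_deg h.
have n1 : rcons l x != [::] by case: (l).
have step B (z : T) (w : T) : degP z = 1 -> lkP z v -> w \in root_closure e P B -> e v w -> z \in root_closure e P B.
  by move=> dz zv wB vw; apply: (root_closure_step dz zv vD wB vw).
have [/existsP[c /andP[cnl cZ]]|/existsPn noZ] := boolP [exists c, (c \in nonlinks v) && (c \in LZ)].
  have vc : e v c by move: cnl; rewrite in_nonlinks => /andP[].
  have := LZ_claim e_sym HP Gmin cZ h n1 isT vc.
  have := LZ_claim e_sym HP Gmin cZ (frame_rev h) _ isT vc.
  rewrite !size_rcons size_rev => H [] /size0nil l0; have {H} := H (ltac:(by case: (rev r))).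
  case=> /size0nil r0; rewrite l0 r0 in h; left.
  have [dx xv] := frame_head h; have [dy yv] := frame_head (frame_rev h).
  apply: (main 24 48) => //; first by apply: (@sum_bonus _ 6 4 (frame_nl h)) => u _; apply: bonus_le6.
  by rewrite !refund_LZ //; apply: (step _ _ c).
have e2 u : u \in nonlinks v -> ext u <= 2.
  by move=> uv; have := noZ u; rewrite uv /bonus => /= /negbTE ->; case: ifP.
have [/existsP[c /andP[cnl cL]]|/existsPn noL] := boolP [exists c, (c \in nonlinks v) && (c \in L3)].
  have vc : e v c by move: cnl; rewrite in_nonlinks => /andP[].
  have sx : \sum_(u in nonlinks v) ext u <= 8 by apply: (@sum_bonus _ 2 4 (frame_nl h)).
  have := L3_claim e_sym HP Gmin cL h n1 isT vc.
  have := L3_claim e_sym HP Gmin cL (frame_rev h) _ isT vc.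
  rewrite !size_rcons size_rev => /(_ (ltac:(by case: (rev r)))).
  have lx0 : size l = 0 -> slack v 0.
    move/size0nil => l0; rewrite l0 in h; have [dx xv] := frame_head h.
    apply: (main 8 8) => //; apply: leq_trans (leq_addr _ _); apply: refund_L3; exact: (step _ _ c).
  have ly0 : size r = 0 -> slack v 0.
    move/size0nil => r0; rewrite r0 in h; have [dy yv] := frame_head (frame_rev h).
    apply: (main 8 8) => //; apply: leq_trans (leq_addl _ _); apply: refund_L3; exact: (step _ _ c).
  rewrite /= size_rev; case=> [[r0]|[r2]|[l0]]; [by left; apply: ly0 | | by left; apply: lx0].
  case=> [[l0]|[l2]|[r0]]; [by left; apply: lx0 | | by left; apply: ly0].
  right; split=> //; move: hg hp sx; move: (gain v) (pay v) (ret x + ret y) (\sum_(_ in _) _) => c1 c2 c3 c4; arith.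
left; apply: (main 0 0) => //; rewrite -[0](muln0 4); apply: (@sum_bonus _ 0 4 (frame_nl h)) => u uv.
have := noL u; have := noZ u; rewrite uv /bonus => /= /negbTE -> /negbTE ->.
by [].
Qed.

End Slack.

(** * Surplus near the ends of open paths *)

Section Components.
Variables (T : finType) (e : rel T) (P : seq (seq T)).
Hypotheses (e_sym : symmetric e) (eirr : irreflexive e).
Hypotheses (HP : ppart e P) (Pmin : forall Q, ppart e Q -> size P <= size Q).
Hypothesis Gmin : forall Q, ppart e Q -> size Q = size P -> penalties P <= penalties Q.
Hypothesis reg : forall v, #|nbhd e v| = 6.
Implicit Types (A D C r t Z : seq T) (Q : seq (seq T)) (x y a b c s u v w z : T) (B : {set T}).

Local Notation lkP := (linked P).
Local Notation degP := (pdeg P).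
Local Notation cmp := (pcomp P).
Local Notation pc := (oriented P).
Local Notation Hv := (in_flexible e P).
Local Notation slots := (slots e P).
Local Notation saturated := (saturated P).
Local Notation S := (core e P).
Local Notation nonlinks := (nonlinks e P).
Local Notation pay := (pay e P).
Local Notation gain := (gain e P).
Local Notation ret := (refund e P).
Local Notation ext := (bonus e P).
Local Notation slack := (slackness e P).
Local Notation frame := (frame P).

Definition heavy_comp D := \sum_(v <- D) pay v + 84 <= \sum_(v <- D) (12 + gain v).

Lemma sum_slack C (f : T -> nat) : (forall v, v \in C -> slack v (f v)) ->
  \sum_(v <- C) pay v + \sum_(v <- C) f v <= \sum_(v <- C) (12 + gain v).
Proof. by move=> h; rewrite -big_split /= big_seq [leqRHS]big_seq; apply: leq_sum. Qed.

Lemma sum_single C x k : x \in C -> k <= \sum_(v <- C) (if v == x then k else 0).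
Proof. by move=> xC; rewrite (big_rem x) //= eqxx leq_addr. Qed.

Lemma links1 a w : degP a = 1 -> lkP a w -> links lkP a = [set w].
Proof.
move=> /eqP/cards1P[w' E] aw; have : w \in links lkP a by rewrite inE.
by rewrite E => /set1P ->.
Qed.

Lemma cards1I w B : #|[set w] :&: B| = (w \in B).
Proof.
case wB: (w \in B); last by rewrite (_ : _ :&: _ = set0) ?cards0 //; apply/setP => u; rewrite !inE; case: eqP => // ->.
by rewrite (_ : _ :&: _ = [set w]) ?cards1 //; apply/setP => u; rewrite !inE; case: eqP => // ->.
Qed.

(** By [tariff_sum_end] an end of an open path pays nothing over its non-links, while all five pay
    it 6 and the bonus; 42 is 12 + 30. *)
Lemma end_open a w : degP a = 1 -> lkP a w -> ~~ cyc e (cmp a) ->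
  pay a + 42 + 5 * ext a <= 12 + gain a + 6 * (w \in S) + ret a.
Proof.
move=> d1 aw nc; have d1' : degP a <= 1 by rewrite d1.
have n5 : #|nonlinks a| = 5 by have := card_nonlinks e_sym HP reg a; rewrite d1 => -[].
have := gain_lb e_sym HP a; rewrite n5 (ncyc_slot_end d1' nc).
rewrite (pay_split e_sym HP) (links1 d1 aw) cards1I d1 (tariff_sum_end e_sym eirr HP Pmin Gmin d1' nc).
move: (gain a) (ext a) (_ + \sum_(u in _) _) (inner_saturated _ _ _) (w \in S) (ret a) => c1 c2 c3 c4 c5 c6; arith.
Qed.

Lemma end_open_slack a w : degP a = 1 -> lkP a w -> ~~ cyc e (cmp a) ->
  pay a + 42 <= 12 + gain a + 6 * (w \in S).
Proof.
move=> d1 aw nc; have := end_open d1 aw nc; have := refund_bonus e P a.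
move: (pay a) (gain a) (ext a) (ret a) (_ * (w \in S)) => c1 c2 c3 c4 c5; arith.
Qed.

Lemma leaf_slack12 a v1 v2 y t : pc [:: a, v1, v2, y & t] -> v1 \in S -> y \in S -> slack v2 12.
Proof. exact: (@inner_saturated_slack _ _ _ e_sym eirr HP Pmin Gmin reg [:: a] v1 v2 y t). Qed.

Lemma linked_pc A x y r : pc (A ++ [:: x, y & r]) -> lkP x y.
Proof.
move=> h; rewrite (pc_nb e_sym HP _ h); last by rewrite mem_cat mem_head orbT.
by rewrite -cat_rcons consec_cat /same_pair !eqxx orbT.
Qed.

Lemma linked_notin_core x y : lkP x y -> x \in S -> y \notin S.
Proof. by move=> xy xS; apply/negP => yS; have := core_unlinked e_sym eirr HP Pmin xS yS; rewrite xy. Qed.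

(** With [v1] in the core, the far end is the only possible slot of [v2]. Without a non-link to it,
    [v2] pays just the 6 for [v1], unless the next vertex is in the core too, where [leaf_slack12]
    gives more. *)
Lemma leaf_slack6 a v1 v2 Z : pc [:: a, v1, v2 & Z] -> v1 \in S -> Z != [::] ->
  last a Z \notin nonlinks v2 -> slack v2 6.
Proof.
case: Z => // y t h v1S _ bn; have [yS|yS] := boolP (y \in S).
  by apply: slack_le (leaf_slack12 h v1S yS).
have v2S : v2 \notin S by apply: linked_notin_core v1S; apply: (linked_pc (A := [:: a]) h).
have hf : frame [:: a] v1 v2 y t by [].
apply: (slack_slots e_sym eirr HP Pmin Gmin (n := 0) hf v2S (slots_right_end e_sym eirr HP Pmin hf v1S v2S)).
- move=> u /set1P ->; apply: (frame_nH e_sym eirr HP Pmin hf v1S); first by rewrite !inE eqxx orbT.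
  by rewrite mem_cat; apply/orP; right; rewrite in_cons mem_last orbT.
- rewrite leqn0 cards_eq0; apply/eqP/setP => u; rewrite [RHS]inE; apply/negbTE/negP.
  by case/setIP=> un /set1P E; move: bn; rewrite /= -E un.
- by rewrite v1S (negbTE yS).
Qed.

(* If v2 spends its surplus on b, the next vertex y still has one: it sees no slot
   but b, because the neighbours of a are in the core. *)
Lemma leaf_slack_next a v1 v2 y t : pc [:: a, v1, v2, y & t] -> v1 \in S -> y \notin S ->
  last y t \in nonlinks v2 -> exists c t', t = c :: t' /\ slack y 6.
Proof.
move=> h v1S yS bn; have hf : frame [:: a] v1 v2 y t by [].
have lkvy : lkP v2 y by apply: (linked_pc (A := [:: a; v1]) h).
case: t h hf bn => [|c t] h hf bn; first by move: bn; rewrite in_nonlinks /= lkvy andbF.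
exists c, t; split=> //; have v2S : v2 \notin S by apply: linked_notin_core v1S; apply: (linked_pc (A := [:: a]) h).
have hy : frame [:: a; v1] v2 y c t by [].
set b := last y _ in bn; have bv : e b v2 by move: bn; rewrite in_nonlinks e_sym => /andP[].
have inD u : u \in [:: a, v1, v2, y, c & t] -> ~~ Hv u.
  by move=> uD; apply: (frame_nH e_sym eirr HP Pmin hf v1S) => //; rewrite !inE eqxx orbT.
have nH : ~~ flexible e [:: a, v1, v2, y, c & t].
  by rewrite -(pc_Hv e_sym HP h (mem_head _ _)) inD ?mem_head.
have sy : slots y \subset [set a; b].
  have := @rotated_end_slots _ _ _ e_sym HP Pmin a [:: v1] v2 y (belast c t) b; rewrite -lastI; exact.
have bD : b \in [:: a, v1, v2, y, c & t] by rewrite 3!in_cons /b mem_last !orbT.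
have nHB u : u \in [set a; b] -> ~~ Hv u.
  by case/set2P => ->; apply: inD; rewrite ?mem_head.
have av : lkP a v1 by apply: (linked_pc (A := [::]) h).
have any : a \notin nonlinks y.
  apply: contra yS; rewrite in_nonlinks => /andP[ya _].
  have aT : a \in saturated S.
    by apply: (leaf_saturated (w := v1)) => //; apply: deg_link av; apply: (pc_head e_sym HP h).
  by apply: (core_nbr e_sym aT); rewrite e_sym.
have [cS|cS] := boolP (c \in S).
  have sa := slots_left_end e_sym eirr HP Pmin hy cS yS.
  apply: (slack_slots e_sym eirr HP Pmin Gmin (n := 0) hy yS sa).
  - by move=> u /set1P ->; apply: inD; rewrite mem_head.
  - rewrite leqn0 cards_eq0; apply/eqP/setP => u; rewrite [RHS]inE; apply/negbTE/negP.
    by case/setIP=> un /set1P /= E; move: any; rewrite -E un.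
  - by rewrite (negbTE v2S) cS.
apply: (slack_slots e_sym eirr HP Pmin Gmin (n := 1) hy yS sy nHB); last by rewrite (negbTE v2S) (negbTE cS).
apply: leq_trans (_ : #|[set b]| <= _); last by rewrite cards1.
apply: subset_leq_card; apply/subsetP => u /setIP[un /set2P[]] E; last by rewrite E set11.
by move: any; rewrite -E un.
Qed.

(** Finds the 6 that the end [a] loses to an adjacent core vertex. *)
Lemma leaf_cover a C b : pc (a :: rcons C b) -> 1 < size C -> head a C \in S ->
  exists2 x, x \in C & slack x 6.
Proof.
case: C => [|v1 [|v2 C]] // h _ /= v1S; rewrite !rcons_cons in h.
have [y [t [E bE yC]]] : exists y t, [/\ rcons C b = y :: t, last y t = b & t != [::] -> y \in C].
  case: C {h} => [|z C]; first by exists b, [::].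
  by exists z, (rcons C b); rewrite last_rcons mem_head.
rewrite E in h; have [bn|bn] := boolP (b \in nonlinks v2); last first.
  by exists v2; rewrite ?(leaf_slack6 h v1S) //= ?bE // !inE eqxx orbT.
have [yS|yS] := boolP (y \in S).
  by exists v2; rewrite ?inE ?eqxx ?orbT //; apply: slack_le (leaf_slack12 h v1S yS).
rewrite -bE in bn; have [c [t' [Et sy]]] := leaf_slack_next h v1S yS bn.
by exists y => //; rewrite !inE yC ?Et ?orbT.
Qed.

Lemma inner_slack_or_center A v r : pc (A ++ v :: r) -> A != [::] -> r != [::] ->
  slack v 0 \/ [/\ v \in S, size A = 3, size r = 3 & pay v <= 20 + gain v].
Proof.
case/lastP: A => // l x; case: r => // y r h _ _.
have [vS|vS] := boolP (v \in S); last by left; apply: (inner_slack_notin_core e_sym eirr HP Pmin Gmin reg h vS).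
have [_ []] := inner_slack_core e_sym eirr HP Pmin Gmin reg h vS; first by left.
by case=> l2 r2 hp; right; rewrite size_rcons l2 /= r2.
Qed.

(* The two vertices between an end and the core vertex s at distance three from it
   have enough surplus to cover s, the only vertex that may be short. *)
Lemma center_side a v1 v2 s y t : pc [:: a, v1, v2, s, y & t] -> s \in S ->
  pay v1 + pay v2 + (6 + 6 * (v1 \in S)) <= (12 + gain v1) + (12 + gain v2).
Proof.
move=> h sS; have vs : lkP v2 s by apply: (linked_pc (A := [:: a; v1]) h).
have v2S : v2 \notin S by apply: linked_notin_core sS; rewrite lkP_sym.
have h1 : frame [::] a v1 v2 (s :: y :: t) by [].
have h2 : frame [:: a] v1 v2 s (y :: t) by [].
have s1 : slack v1 0 by case: (@inner_slack_or_center [:: a] v1 [:: v2, s, y & t] h) => // -[].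
have s2 := inner_slack_notin_core e_sym eirr HP Pmin Gmin reg h2 v2S.
have [v1S|v1S] := boolP (v1 \in S).
  have := leaf_slack12 h v1S sS; move: s1; rewrite /slackness.
  move: (pay v1) (pay v2) (gain v1) (gain v2) => c1 c2 c3 c4; arith.
have inD u : u \in [:: a, v1, v2, s, y & t] -> ~~ Hv u.
  by move=> uD; apply: (frame_nH e_sym eirr HP Pmin h2 sS) => //; rewrite !inE eqxx !orbT.
have sl2 : slots v2 \subset [set a] := slots_left_end e_sym eirr HP Pmin h2 sS v2S.
have [an|an] := boolP (a \in nonlinks v2); last first.
  have : slack v2 6.
    apply: (slack_slots e_sym eirr HP Pmin Gmin (n := 0) h2 v2S sl2).
    - by move=> u /set1P ->; apply: inD; rewrite mem_head.
    - rewrite leqn0 cards_eq0; apply/eqP/setP => u; rewrite [RHS]inE; apply/negbTE/negP.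
      by case/setIP=> un /set1P E; move: an; rewrite -E un.
    - by rewrite (negbTE v1S) sS.
  move: s1; rewrite /slackness; move: (pay v1) (pay v2) (gain v1) (gain v2) => c1 c2 c3 c4; arith.
have aS : a \notin S.
  have av1 : lkP a v1 := linked_pc (A := [::]) h.
  by apply/negP => /(core_inner e_sym eirr HP Pmin)[d _]; have := pc_head e_sym HP h; rewrite d.
have hr : pc (rev [:: a, v1, v2, s, y & t]) by rewrite (pc_rev P).
have Er : rev [:: a, v1, v2, s, y & t] = rev [:: s, y & t] ++ [:: v2; v1; a].
  by rewrite -[[:: a, v1, v2, s, y & t]]/([:: a; v1; v2] ++ [:: s, y & t]) rev_cat.
have [b [l' El]] : exists b l', rev [:: s, y & t] = b :: l'.
  by case E: (rev _) (size_rev [:: s, y & t]) => [|b l'] // _; exists b, l'.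
have nH : ~~ flexible e (rev [:: a, v1, v2, s, y & t]).
  by rewrite (flexible_rev e_sym) -(pc_Hv e_sym HP h (mem_head _ _)) inD ?mem_head.
rewrite Er El in hr nH.
have av2 : e a v2 by move: an; rewrite in_nonlinks e_sym => /andP[].
have sl1 : slots v1 \subset [set b; a] := @rotated_end_slots _ _ _ e_sym HP Pmin b l' v2 v1 [::] a hr av2 nH.
have bD : b \in [:: a, v1, v2, s, y & t] by rewrite -mem_rev Er El mem_head.
have : slack v1 6.
  apply: (slack_slots e_sym eirr HP Pmin Gmin (n := 1) h1 v1S sl1).
  - by move=> u /set2P[] ->; apply: inD; rewrite ?mem_head.
  - apply: leq_trans (_ : #|[set b]| <= _); last by rewrite cards1.
    apply: subset_leq_card; apply/subsetP => u /setIP[un /set2P[]] E; first by rewrite E set11.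
    by move: un; rewrite E in_nonlinks lkP_sym (linked_pc (A := [::]) h) andbF.
  - by rewrite (negbTE aS) (negbTE v2S).
move: s2; rewrite /slackness; move: (pay v1) (pay v2) (gain v1) (gain v2) => c1 c2 c3 c4; arith.
Qed.

End Components.

(** * Charge of open paths on at least three vertices *)

Section Heavy.
Variables (T : finType) (e : rel T) (P : seq (seq T)).
Hypotheses (e_sym : symmetric e) (eirr : irreflexive e).
Hypotheses (HP : ppart e P) (Pmin : forall Q, ppart e Q -> size P <= size Q).
Hypothesis Gmin : forall Q, ppart e Q -> size Q = size P -> penalties P <= penalties Q.
Hypothesis reg : forall v, #|nbhd e v| = 6.
Implicit Types (A D C r : seq T) (Q : seq (seq T)) (x a b c s u v w z : T) (B : {set T}).

Local Notation lkP := (linked P).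
Local Notation degP := (pdeg P).
Local Notation cmp := (pcomp P).
Local Notation pc := (oriented P).
Local Notation Ev := (slot_end e P).
Local Notation saturated := (saturated P).
Local Notation S := (core e P).
Local Notation LZ := (LZ e P).
Local Notation L3 := (L3 e P).
Local Notation nonlinks := (nonlinks e P).
Local Notation pay := (pay e P).
Local Notation gain := (gain e P).
Local Notation ret := (refund e P).
Local Notation ext := (bonus e P).
Local Notation rate := (tariff e P).
Local Notation slack := (slackness e P).
Local Notation frame := (frame P).
Local Notation heavy := (heavy_comp e P).

Lemma big_ends a C b (F : T -> nat) :
  \sum_(v <- a :: rcons C b) F v = F a + F b + \sum_(v <- C) F v.
Proof. by rewrite big_cons -cats1 big_cat big_seq1 addnAC addnA. Qed.

Lemma pc_ends_rev a C b : pc (a :: rcons C b) -> pc (b :: rcons (rev C) a).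
Proof. by rewrite -(pc_rev P) rev_cons rev_rcons. Qed.

Lemma end_link a C b : pc (a :: rcons C b) -> C != [::] -> degP a = 1 /\ lkP a (head a C).
Proof.
case: C => // v C h _; have av : lkP a v := linked_pc e_sym HP (A := [::]) h.
by split=> //; apply: deg_link av; apply: (pc_head e_sym HP h).
Qed.

Lemma head_rev_neq0 a b C : C != [::] -> head b (rev C) = last a C.
Proof. by case/lastP: C => // C x _; rewrite rev_rcons last_rcons. Qed.

Lemma heavy_ends a C b : pc (a :: rcons C b) -> ~~ cyc e (a :: rcons C b) -> C != [::] ->
  \sum_(v <- C) pay v + 6 * ((head a C \in S) + (last a C \in S)) <= \sum_(v <- C) (12 + gain v) ->
  heavy (a :: rcons C b).
Proof.
move=> h nc nC; rewrite /heavy_comp !big_ends.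
have hr := pc_ends_rev h; have [da av] := end_link h nC; have [db bv] := end_link hr (revn nC).
have nca : ~~ cyc e (cmp a) by rewrite (pc_cyc e_sym HP h) ?mem_head.
have ncb : ~~ cyc e (cmp b) by rewrite (pc_cyc e_sym HP h) // in_cons mem_rcons mem_head orbT.
rewrite (head_rev_neq0 a) // in bv.
have := end_open_slack e_sym eirr HP Pmin Gmin reg da av nca; have := end_open_slack e_sym eirr HP Pmin Gmin reg db bv ncb.
move: (pay a) (pay b) (gain a) (gain b) (\sum_(v <- C) pay v) (\sum_(v <- C) _) (_ \in _) (_ \in _).
move=> c1 c2 c3 c4 c5 c6 c7 c8; arith.
Qed.

(** Both ends are saturated, so all their neighbours are in the core. The vertices second from each
    end are outside it, hence see no far end and keep 6 each; if they coincide, that vertex lies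
    between two core vertices and keeps 12. *)
Lemma two_leaves a C b : pc (a :: rcons C b) -> 1 < size C -> head a C \in S -> last a C \in S ->
  (forall v, v \in C -> slack v 0) -> \sum_(v <- C) pay v + 12 <= \sum_(v <- C) (12 + gain v).
Proof.
move=> h s2 hS lS ok; have nC : C != [::] by case: (C) s2.
have hr := pc_ends_rev h; have [da av] := end_link h nC; have [db bv] := end_link hr (revn nC).
rewrite (head_rev_neq0 a) // in bv.
have aT := leaf_saturated da av hS; have bT := leaf_saturated db bv lS.
case: C h s2 hS lS ok hr nC bv av => [|v1 [|v2 C]] // h _ /= hS lS ok hr _ bv av.
have l12 : lkP v1 v2 := linked_pc e_sym HP (A := [:: a]) h.
have v2S := linked_notin_core e_sym eirr HP Pmin l12 hS.
have one : forall k x, x \in [:: v1, v2 & C] -> slack x k ->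
    \sum_(v <- [:: v1, v2 & C]) pay v + k <= \sum_(v <- [:: v1, v2 & C]) (12 + gain v).
  move=> k x xC sx; apply: leq_trans (sum_slack (f := fun v => if v == x then k else 0) _).
    by rewrite leq_add2l sum_single.
  by move=> v vC; case: eqP => [->|_]; last exact: ok.
case/lastP: C h lS ok hr bv l12 one => [|C vm] h lS ok hr bv l12 one.
  by rewrite lS in v2S.
rewrite last_rcons in lS bv.
case/lastP: C h lS ok hr bv l12 one => [|C p] h lS ok hr bv l12 one.
  apply: (one 12 v2); first by rewrite !inE eqxx orbT.
  exact: (leaf_slack12 e_sym eirr HP Pmin Gmin reg h).
have s1 : slack v2 6.
  apply: (leaf_slack6 e_sym eirr HP Pmin Gmin reg h) => //; first by case: (C).
  rewrite last_rcons in_nonlinks; apply: contra v2S => /andP[v2b _].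
  by apply: (core_nbr e_sym bT); rewrite e_sym.
have hr' : pc [:: b, vm, p & rcons (rcons (rcons (rev C) v2) v1) a].
  by move: hr; rewrite !rev_cons !rev_rcons.
have lp : lkP vm p := linked_pc e_sym HP (A := [:: b]) hr'.
have pS := linked_notin_core e_sym eirr HP Pmin lp lS.
have s3 : slack p 6.
  apply: (leaf_slack6 e_sym eirr HP Pmin Gmin reg hr') => //; first by case: (rev C).
  rewrite last_rcons in_nonlinks; apply: contra pS => /andP[pa _].
  by apply: (core_nbr e_sym aT); rewrite e_sym.
have n2p : v2 != p.
  have := pc_uniq e_sym HP h; rewrite /= => /and4P[_ _ + _].
  by apply: contraNneq => ->; rewrite !(mem_rcons, inE) eqxx !orbT.
set D := [:: v1, v2 & _] in ok *.
apply: leq_trans (sum_slack (f := fun v => (if v == v2 then 6 else 0) + (if v == p then 6 else 0)) _).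
  rewrite leq_add2l big_split /= -[12]/(6 + 6); apply: leq_add; apply: sum_single.
    by rewrite !inE eqxx orbT.
  by rewrite !(mem_rcons, inE) eqxx !orbT.
move=> v vD; have [->|n1] := eqVneq v v2; first by rewrite (negbTE n2p) addn0.
by have [->|n2] := eqVneq v p; last exact: ok.
Qed.

Lemma heavy_open a C b : pc (a :: rcons C b) -> ~~ cyc e (a :: rcons C b) -> 1 < size C ->
  heavy (a :: rcons C b).
Proof.
move=> h nc s2; have nC : C != [::] by case: (C) s2.
apply: heavy_ends => //; have [/allP ok|] := boolP (all (fun v => slack v 0) C).
  have one : forall k x, x \in C -> slack x k ->
      \sum_(v <- C) pay v + k <= \sum_(v <- C) (12 + gain v).
    move=> k x xC sx; apply: leq_trans (sum_slack (f := fun v => if v == x then k else 0) _).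
      by rewrite leq_add2l sum_single.
    by move=> v vC; case: eqP => [->|_]; last exact: ok.
  have [hS|hS] := boolP (head a C \in S); have [lS|lS] := boolP (last a C \in S).
  - exact: (two_leaves h).
  - have [x xC sx] := leaf_cover e_sym eirr HP Pmin Gmin reg h s2 hS; exact: (one 6 x).
  - have hr := pc_ends_rev h; have [||x xC sx] := leaf_cover e_sym eirr HP Pmin Gmin reg hr.
    + by rewrite size_rev.
    + by rewrite (head_rev_neq0 a).
    + by apply: (one 6 x) => //; rewrite mem_rev in xC.
  - rewrite muln0 addn0; have := @sum_slack _ e P C (fun _ => 0) ok; exact: leq_trans (leq_addr _ _).
(* A vertex without slack is the middle of a path on seven vertices. It lacks at most 8, while each
   side offers 6 beyond what its end pays to the core. *)
case/allPn => v vC nsl; case/splitPr: vC h nc s2 nC => l r h nc s2 nC.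
rewrite rcons_cat rcons_cons in h.
case: (@inner_slack_or_center _ _ _ e_sym eirr HP Pmin Gmin reg (a :: l) v (rcons r b) h) => // [|s0|[vS]].
- by case: (r).
- by rewrite s0 in nsl.
rewrite /= size_rcons; case: l h nc s2 nC => [|v1 [|v2 [|? ?]]] //= h nc s2 nC _.
case: r h nc s2 nC => [|v4 [|v5 [|? ?]]] //= h nc s2 nC _ hp.
rewrite !big_cons !big_nil.
have := center_side e_sym eirr HP Pmin Gmin reg h vS.
have hr : pc [:: b; v5; v4; v; v2; v1; a] by rewrite -(pc_rev P).
have := center_side e_sym eirr HP Pmin Gmin reg hr vS.
move: hp; move: (pay v1) (pay v2) (pay v) (pay v4) (pay v5) (gain v1) (gain v2) (gain v) (gain v4) (gain v5) (v1 \in S) (v5 \in S).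
move=> p1 p2 p3 p4 p5 g1 g2 g3 g4 g5 b1 b5; arith.
Qed.

Lemma heavy_triple a v b : pc [:: a; v; b] -> ~~ cyc e [:: a; v; b] -> heavy [:: a; v; b].
Proof.
move=> h nc; have hf : frame [::] a v b [::] by [].
have [vS|vS] := boolP (v \in S); last first.
  apply: (@heavy_ends a [:: v] b) => //=; rewrite (negbTE vS) !big_seq1 muln0.
  exact: (inner_slack_notin_core e_sym eirr HP Pmin Gmin reg hf vS).
have [da av] := @end_link a [:: v] b h isT; have [db bv] := @end_link b [:: v] a (@pc_ends_rev a [:: v] b h) isT.
rewrite /= in av bv.
have nca : ~~ cyc e (cmp a) by rewrite (pc_cyc e_sym HP h) ?mem_head.
have ncb : ~~ cyc e (cmp b) by rewrite (pc_cyc e_sym HP h) // !inE eqxx !orbT.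
have [hv _] := inner_slack_core e_sym eirr HP Pmin Gmin reg hf vS.
have ea := end_open e_sym eirr HP Pmin Gmin reg da av nca.
have eb := end_open e_sym eirr HP Pmin Gmin reg db bv ncb.
have n4 := frame_nl e_sym HP reg hf; have vd := frame_deg e_sym HP hf.
(* Refunds cancel within the path. What remains is 5 bonuses at each end against the 6 + 6 paid by
   the ends to [v] and the bonuses paid by [v]. *)
have fin k j : \sum_(u in nonlinks v) ext u <= k -> j <= ext a -> j <= ext b -> 12 + k <= 10 * j ->
    heavy [:: a; v; b].
  rewrite /heavy_comp !big_cons !big_nil; move: hv ea eb; rewrite vS.
  move: (\sum_(_ in _) _) (pay a) (pay b) (pay v) (gain a) (gain b) (gain v) (ext a) (ext b) (ret a) (ret b).
  move=> c1 c2 c3 c4 c5 c6 c7 c8 c9 c10 c11; arith.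
have step B z w : degP z = 1 -> lkP z v -> w \in root_closure e P B -> e v w -> z \in root_closure e P B.
  by move=> dz zv wB vw; apply: (root_closure_step dz zv vd wB vw).
have [/existsP[c /andP[cn cZ]]|/existsPn noZ] := boolP [exists c, (c \in nonlinks v) && (c \in LZ)].
  have vc : e v c by move: cn; rewrite in_nonlinks => /andP[].
  apply: (fin 24 6) => //; first by apply: (@sum_bonus _ _ _ v 6 4 n4) => u _; apply: bonus_le6.
    by rewrite /bonus (step _ a c).
  by rewrite /bonus (step _ b c).
(* An outside slot makes both ends roots of [L3], and the balance is tight: 12 + 4 * 2 = 10 * 2. *)
have [/existsP[c /andP[cn cE]]|/existsPn noE] := boolP [exists c, (c \in nonlinks v) && Ev c].
  have [vc nvc] : e v c /\ ~~ lkP v c by apply/andP; rewrite -in_nonlinks.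
  have cD : c \notin [:: a; v; b].
    move: nvc; rewrite (P3_links e_sym HP _ h) !inE !negb_or => /andP[-> ->] /=; rewrite andbT.
    by apply: contraTneq vc => ->; rewrite eirr.
  have B3P z z' : pc [:: z; v; z'] -> c \notin [:: z; v; z'] -> degP z = 1 -> lkP z v -> z \in L3.
    move=> hz cz dz zv; apply: root_closure_base; rewrite inE dz eqxx (pc_size HP hz) ?mem_head //=.
    apply/existsP; exists v; apply/existsP; exists c; rewrite zv vd eqxx cE vc andbT /=.
    by rewrite (pc_mem HP _ hz) ?mem_head.
  have aL : a \in L3 by apply: (B3P a b).
  have bL : b \in L3.
    apply: (B3P b a) => //; first by rewrite -(pc_rev P).
    by rewrite -mem_rev.
  have e2 z : z \in L3 -> 2 <= ext z by rewrite /bonus => ->; case: ifP.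
  apply: (fin 8 2); rewrite ?e2 //; apply: (@sum_bonus _ _ _ v 2 4 n4) => u uv.
  by have := noZ u; rewrite uv /bonus => /= /negbTE ->; case: ifP.
(* With no slot among its non-links, [v] pays each at most 3, that is 12 in all, and the 12 it keeps
   makes up for the payments of the ends. *)
apply: (@heavy_ends a [:: v] b) => //=; rewrite vS !big_seq1.
have r3 u : u \in nonlinks v -> rate u v <= 3.
  move=> uv; have nE : ~~ Ev u by have := noE u; rewrite uv.
  have n0 : ext u = 0.
    rewrite /bonus; case: ifP => [/(LZ_end e_sym HP Pmin)[d n]|_].
      by rewrite (ncyc_slot_end d n) in nE.
    by case: ifP => // /(L3_end e_sym HP Pmin)[d n]; rewrite (ncyc_slot_end d n) in nE.
  rewrite /tariff (negbTE nE) n0 /other_flexible /inner_saturated.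
  have [uT|uT] := boolP (u \in saturated S); last by rewrite /=; case: (_ && _).
  by rewrite (negbTE (saturated_core_nflexible e_sym eirr HP Pmin uT)) /=; case: (_ == _).
have hp : \sum_(u in nonlinks v) rate u v <= 12.
  by rewrite -[12]/(4 * 3) -n4 -sum_nat_const; apply: leq_sum.
have aS : a \notin S by apply: (linked_notin_core e_sym eirr HP Pmin _ vS); rewrite lkP_sym.
have bS : b \notin S by apply: (linked_notin_core e_sym eirr HP Pmin _ vS); rewrite lkP_sym.
have := gain_lb e_sym HP v; rewrite (frame_pay e_sym HP Pmin hf) vd vS (negbTE aS) (negbTE bS).
move: hp; move: (\sum_(u in nonlinks v) _) (#|_| * _) (\sum_(u in links _ _) _) (gain v) => c1 c2 c3 c4; arith.
Qed.

End Heavy.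

(** * Tiny paths, closed paths, and the total charge *)

Section ClosedPaths.
Variables (T : finType) (e : rel T) (P : seq (seq T)).
Hypotheses (e_sym : symmetric e) (eirr : irreflexive e).
Hypotheses (HP : ppart e P) (Pmin : forall Q, ppart e Q -> size P <= size Q).
Hypothesis Gmin : forall Q, ppart e Q -> size Q = size P -> penalties P <= penalties Q.
Hypothesis reg : forall v, #|nbhd e v| = 6.
Implicit Types (A D C : seq T) (Q : seq (seq T)) (x y a b c s u v w z : T) (B : {set T}).

Local Notation lkP := (linked P).
Local Notation degP := (pdeg P).
Local Notation cmp := (pcomp P).
Local Notation pc := (oriented P).
Local Notation Hv := (in_flexible e P).
Local Notation Ev := (slot_end e P).
Local Notation S := (core e P).
Local Notation LZ := (LZ e P).
Local Notation nonlinks := (nonlinks e P).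
Local Notation pay := (pay e P).
Local Notation gain := (gain e P).
Local Notation ext := (bonus e P).
Local Notation rate := (tariff e P).
Local Notation slack := (slackness e P).
Local Notation heavy := (heavy_comp e P).

Lemma end_nS v : degP v <= 1 -> v \notin S.
Proof. by move=> d; apply/negP => /(core_inner e_sym eirr HP Pmin)[d2 _]; rewrite d2 in d. Qed.

(** Tight: 12 + 6 * (6 + 6) = 84, which fixes the bonus of [LZ]. *)
Lemma heavy_single z : pc [:: z] -> heavy [:: z].
Proof.
move=> h; rewrite /heavy_comp !big_seq1.
have l0 : links lkP z = set0.
  by apply/setP => u; rewrite !inE (pc_nb e_sym HP _ h) ?mem_head.
have d0 : degP z = 0 by rewrite /pdeg /deg l0 cards0.
have d1 : degP z <= 1 by rewrite d0.
have zB : z \in single_roots P by rewrite inE (pc_size HP h) ?mem_head.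
have nc : ~~ cyc e (cmp z) by rewrite (pc_cyc e_sym HP h) ?mem_head.
have zZ : z \in LZ by apply: root_closure_base.
have := gain_lb e_sym HP z; have n6 : #|nonlinks z| = 6 by have := card_nonlinks e_sym HP reg z; rewrite d0.
rewrite (pay_split e_sym HP) (tariff_sum_end e_sym eirr HP Pmin Gmin d1 nc) l0 set0I cards0 d0 n6 (ncyc_slot_end d1 nc) /bonus zZ.
move: (_ + \sum_(_ in _) _) (inner_saturated _ _ _) (gain z) => c1 c2 c3; arith.
Qed.

Lemma heavy_pair a b : pc [:: a; b] -> heavy [:: a; b].
Proof.
have half x y : pc [:: x; y] -> pay x + 42 <= 12 + gain x.
  move=> h; have xy : lkP x y := linked_pc e_sym HP (A := [::]) h.
  have dx : degP x = 1 by apply: deg_link xy; apply: (pc_head e_sym HP h).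
  have nc : ~~ cyc e (cmp x) by rewrite (pc_cyc e_sym HP h) ?mem_head.
  have yS : y \notin S by apply: end_nS; apply: (@pc_last _ _ _ e_sym HP [:: x]).
  by have := end_open_slack e_sym eirr HP Pmin Gmin reg dx xy nc; rewrite (negbTE yS) muln0 addn0.
move=> h; have hr : pc [:: b; a] by rewrite -(pc_rev P).
rewrite /heavy_comp !big_cons !big_nil; have := half _ _ h; have := half _ _ hr.
move: (pay a) (pay b) (gain a) (gain b) => c1 c2 c3 c4; arith.
Qed.

Lemma cyc_pay v : cyc e (cmp v) -> pay v = \sum_(u in nonlinks v) rate u v /\ v \notin S.
Proof.
move=> cv; have nS u : cmp u = cmp v -> u \notin S.
  by move=> E; apply/negP => /(core_ncyc e_sym eirr HP Pmin); rewrite E cv.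
split; last exact: nS.
rewrite (pay_split e_sym HP) (refund_cyc e_sym HP Pmin cv) muln0 addn0.
rewrite (_ : _ :&: _ = set0) ?cards0 //; apply/setP => u; rewrite [RHS]inE; apply/negbTE/negP.
case/setIP; rewrite inE lkP_sym => /(lkP_cmp HP)/nS; by move/negP.
Qed.

Lemma cyc_out u v : cyc e (cmp v) -> e v u -> (degP u <= 1) || cyc e (cmp u) -> cmp u = cmp v.
Proof.
move=> cv vu hu; apply/eqP; apply: contraTT vu => n.
by apply: (endlike_nonadj e_sym HP Pmin); rewrite /endlike ?cv ?orbT // eq_sym.
Qed.

Definition outer v D := nbhd e v :\: [set u | u \in D].

(** By [endlike_nonadj] no end or closed path elsewhere is adjacent to [D], so [v] pays nothing, and
    it receives 2 over every edge leaving [D]. *)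
Lemma H_slack D v : pc D -> flexible e D -> v \in D -> slack v (12 + 2 * #|outer v D|).
Proof.
move=> h HD vD; have Hv_v : Hv v by rewrite (pc_Hv e_sym HP h vD).
have cv := cycH Hv_v; have [pE vS] := cyc_pay cv.
have p0 : pay v = 0.
  rewrite pE; apply: big1 => u uv; rewrite (tariff_notin_core e_sym eirr HP Pmin Gmin vS uv).
  have vu : e v u by move: uv; rewrite in_nonlinks => /andP[].
  have -> : Ev u = false.
    apply/negbTE/negP => /andP[du nu]; move: nu.
    by rewrite (Hv_cmp e (cyc_out cv vu _)) ?du // Hv_v.
  have -> // : other_flexible e P u v = false.
  apply/negbTE/negP => /andP[Hu]; by rewrite (cyc_out cv vu) ?eqxx // (cycH Hu) orbT.
rewrite /slackness p0 add0n leq_add2l.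
rewrite (gain_split e_sym HP); apply: leq_trans (leq_addl _ _).
have onl : outer v D \subset nonlinks v.
  apply/subsetP => u; rewrite !inE => /andP[uD ->] /=; apply: contra uD.
  by rewrite (pc_nb e_sym HP _ h vD) => /consec_mem/andP[].
rewrite -(setIidPr onl) -sum_mem; apply: leq_sum => u unl.
rewrite /tariff -addnA; apply: leq_trans (leq_addl _ _); apply: leq_trans (leq_addr _ _).
rewrite leq_mul2l /= /other_flexible Hv_v; case uo: (u \in outer v D) => //=.
move: uo; rewrite !inE => /andP[uD _]; rewrite lt0b; apply: contraNneq uD => E.
by rewrite -(pc_mem HP _ h vD) (mem_cmp_eq HP) E.
Qed.

Lemma card_out D v B : uniq D -> B \subset [set u | u \in D] -> [disjoint nbhd e v & B] ->
  6 + #|B| <= #|outer v D| + size D.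
Proof.
move=> uD sB dB; have cD : #|[set u | u \in D]| = size D by rewrite cardsE; apply/card_uniqP.
have := cardsID [set u | u \in D] (nbhd e v); rewrite reg -/(outer v D) => h.
have : #|nbhd e v :&: [set u | u \in D]| + #|B| <= #|[set u | u \in D]|.
  rewrite -cardsUI; have -> : nbhd e v :&: [set u | u \in D] :&: B = set0.
    apply/eqP; rewrite -subset0 -(setI0 set0); apply/subsetP => u /setIP[/setIP[un _] uB].
    by have := disjointFr dB un; rewrite uB.
  by rewrite cards0 addn0 subset_leq_card // subUset subsetIr.
move: h; rewrite cD; move: #|_| #|_| #|_| (size D) => c1 c2 c3 c4; arith.
Qed.

Lemma sum_const (I : Type) (q : seq I) k : \sum_(v <- q) k = size q * k.
Proof. by rewrite big_const_seq count_predT iter_addn_0 mulnC. Qed.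

(** A vertex among m has at least 7 - m neighbours outside: 7 * 12 and 6 * 14 suffice, but 5 * 16 =
    80. There two non-adjacent vertices have one outside neighbour more each, which gives the
    missing 4; this is where completeness must be excluded. *)
Lemma heavy_H D : pc D -> flexible e D -> heavy D.
Proof.
move=> h HD; have uD := pc_uniq e_sym HP h; case/and3P: (HD) => _ s4 ncl.
have o1 v : v \in D -> 7 <= #|outer v D| + size D.
  move=> vD; have := @card_out D v [set v] uD; rewrite cards1; apply.
    by rewrite sub1set inE.
  by rewrite disjoint_sym disjoints1 inE eirr.
have [x [y [xD yD nxy nexy]]] : exists x y, [/\ x \in D, y \in D, x != y & ~~ e x y].
  have /allPn[x xD /allPn[y yD]] := ncl; rewrite negb_or => /andP[n1 n2]; by exists x, y.
have o2 v w : v \in D -> w \in D -> v != w -> ~~ e v w -> 8 <= #|outer v D| + size D.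
  move=> vD wD n nvw; have := @card_out D v [set v; w] uD; rewrite cards2 n; apply.
    by apply/subsetP => u /set2P[] ->; rewrite inE.
  rewrite disjoint_sym; apply/pred0P => u /=; apply/negbTE/negP => /andP[/set2P[] ->]; rewrite inE ?eirr //.
  by rewrite (negbTE nvw).
have fin f : (forall v, v \in D -> f v <= 2 * #|outer v D|) ->
    84 <= 12 * size D + \sum_(v <- D) f v -> heavy D.
  move=> fo le; rewrite /heavy_comp; apply: leq_trans (sum_slack (f := fun v => 12 + f v) _).
    by rewrite leq_add2l big_split /= sum_const mulnC.
  by move=> v vD; apply: slack_le (H_slack h HD vD); rewrite leq_add2l fo.
have le7 v : v \in D -> 2 * (7 - size D) <= 2 * #|outer v D|.
  by move=> vD; rewrite leq_mul2l /= leq_subLR addnC o1.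
have [s6|s6] := leqP 6 (size D).
  have [s7|s7] := leqP 7 (size D).
    by apply: (fin (fun=> 0)) => //; rewrite sum_const; move: s7; move: (size D) => m; arith.
  have E6 : size D = 6 by apply/eqP; rewrite eqn_leq s6 -ltnS s7.
  by apply: (fin _ le7); rewrite sum_const E6.
have s5 : size D = 5 by apply/eqP; rewrite eqn_leq s4 -ltnS s6.
apply: (fin (fun v => 4 + ((if v == x then 2 else 0) + (if v == y then 2 else 0)))) => [v vD|].
  have := le7 _ vD; rewrite s5.
  have [->|vx] := eqVneq v x.
    by rewrite (negbTE nxy); have := o2 _ _ xD yD nxy nexy; rewrite s5; move: #|_| => c; arith.
  have [->|vy] := eqVneq v y; last by [].
  have nyx : ~~ e y x by rewrite e_sym.
  by have := o2 _ _ yD xD (ltac:(by rewrite eq_sym)) nyx; rewrite s5; move: #|_| => c; arith.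
rewrite !big_split /= sum_const s5.
by have := sum_single 2 xD; have := sum_single 2 yD; move: (\sum_(_ <- _) _) (\sum_(_ <- _) _) => c1 c2; arith.
Qed.

Lemma cyc_pay_ends a C b v : pc (a :: rcons C b) -> cyc e (a :: rcons C b) ->
  ~~ flexible e (a :: rcons C b) -> v \in a :: rcons C b ->
  pay v <= 6 * #|nonlinks v :&: [set a; b]|.
Proof.
set D := a :: _ => h cD nH vD; have cv : cyc e (cmp v) by rewrite (pc_cyc e_sym HP h).
have [-> vS] := cyc_pay cv.
have nHx x : x \in D -> ~~ Hv x by move=> xD; rewrite (pc_Hv e_sym HP h).
have aD : a \in D := mem_head _ _.
have bD : b \in D by rewrite in_cons mem_rcons mem_head orbT.
apply: (tariff_sum_slots e_sym eirr HP Pmin Gmin vS); last by move=> x /set2P[] ->; apply: nHx.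
apply/subsetP => c cs.
have ev : endlike e P v by rewrite /endlike cv orbT.
have cE := slots_end e_sym HP Pmin ev cs; rewrite (pc_mem HP _ h vD) in cE.
have dc : degP c <= 1.
  by move: cs; rewrite inE (negbTE (nHx _ cE)) orbF => /andP[/andP[]].
by case: (pc_ends e_sym HP h cE dc) => ->; rewrite !inE /= ?last_rcons ?eqxx ?orbT.
Qed.

(** Each end has 36, as it may pay 6 to the other one. The vertices linked to the ends do not pay
    the end they are linked to and keep 6 each, or 12 if they coincide. *)
Lemma heavy_cyc a C b : pc (a :: rcons C b) -> cyc e (a :: rcons C b) ->
  ~~ flexible e (a :: rcons C b) -> C != [::] -> heavy (a :: rcons C b).
Proof.
move=> h cD nH nC; have hr := pc_ends_rev h.
have pE v := cyc_pay_ends h cD nH (v := v).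
have ends x y D : pc (x :: rcons D y) -> D != [::] -> [set a; b] = [set x; y] ->
    x \in a :: rcons C b -> pay x + 36 <= 12 + gain x.
  move=> hx nD E xD; have [dx xv] := end_link e_sym HP hx nD.
  have px : pay x <= 6.
    apply: leq_trans (pE _ xD) _; rewrite -[6]/(6 * 1) leq_mul2l /= E -(cards1 y).
    apply: subset_leq_card; apply/subsetP => u /setIP[un /set2P[]] Eu; last by rewrite Eu set11.
    by move: un; rewrite Eu in_nonlinks eirr.
  have Ex : Ev x by rewrite /slot_end dx (pc_Hv e_sym HP h xD).
  have n5 : #|nonlinks x| = 5 by have := card_nonlinks e_sym HP reg x; rewrite dx => -[].
  have := gain_lb e_sym HP x; rewrite n5 Ex; move: px.
  move: (pay x) (gain x) (_ + \sum_(_ in _) _) (inner_saturated _ _ _) (ext x) => c1 c2 c3 c4 c5; arith.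
have ea : pay a + 36 <= 12 + gain a by apply: (ends _ _ _ h) => //; rewrite mem_head.
have eb : pay b + 36 <= 12 + gain b.
  by apply: (ends _ _ _ hr); rewrite ?revn // ?(setUC [set a]) // in_cons mem_rcons mem_head orbT.
have CD v : v \in C -> v \in a :: rcons C b by move=> vC; rewrite in_cons mem_rcons in_cons vC !orbT.
have sl v k : v \in C -> 6 * #|nonlinks v :&: [set a; b]| + k <= 12 -> slack v k.
  move=> vC hk; rewrite /slackness; move: (pE _ (CD _ vC)) hk; move: (pay v) (gain v) #|_| => c1 c2 c3; arith.
suff: \sum_(v <- C) pay v + 12 <= \sum_(v <- C) (12 + gain v).
  rewrite /heavy_comp !big_ends; move: ea eb.
  move: (pay a) (pay b) (gain a) (gain b) (\sum_(v <- C) pay v) (\sum_(v <- C) _) => c1 c2 c3 c4 c5 c6; arith.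
have s0 v : v \in C -> slack v 0.
  move=> vC; apply: sl => //; rewrite addn0 -[12]/(6 * 2) leq_mul2l /=.
  apply: leq_trans (subset_leq_card (subsetIr _ _)) _; by rewrite cards2; case: (_ != _).
have sa v : v \in C -> lkP a v -> slack v 6.
  move=> vC av; apply: sl => //; rewrite -[12]/(6 * 1 + 6) leq_add2r leq_mul2l /= -(cards1 b).
  apply: subset_leq_card; apply/subsetP => u /setIP[un /set2P[]] Eu; last by rewrite Eu set11.
  by move: un; rewrite Eu in_nonlinks lkP_sym av andbF.
have sb v : v \in C -> lkP b v -> slack v 6.
  move=> vC bv; apply: sl => //; rewrite -[12]/(6 * 1 + 6) leq_add2r leq_mul2l /= -(cards1 a).
  apply: subset_leq_card; apply/subsetP => u /setIP[un /set2P[]] Eu; first by rewrite Eu set11.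
  by move: un; rewrite Eu in_nonlinks lkP_sym bv andbF.
have [_ av] := end_link e_sym HP h nC; have [_ bv] := end_link e_sym HP hr (revn nC); rewrite (head_rev_neq0 a) // in bv.
case: C nC h av bv sl s0 sa sb {cD nH hr pE ends CD} => // v1 C _ h /= av.
case/lastP: C h => [|C vm] h bv sl s0 sa sb.
  rewrite !big_seq1; apply: sl; first by rewrite mem_head.
  rewrite (_ : _ :&: _ = set0) ?cards0 //; apply/setP => u; rewrite [RHS]inE; apply/negbTE/negP.
  by case/setIP=> un /set2P[] Eu; move: un; rewrite Eu in_nonlinks lkP_sym ?av ?bv andbF.
rewrite last_rcons in bv.
have m1 : v1 \in v1 :: rcons C vm := mem_head _ _.
have mm : vm \in v1 :: rcons C vm by rewrite in_cons mem_rcons mem_head orbT.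
have n1m : v1 != vm.
  have := pc_uniq e_sym HP h; rewrite /= => /and3P[_ + _].
  by apply: contraNneq => ->; rewrite !(mem_rcons, inE) eqxx !orbT.
apply: leq_trans (sum_slack (f := fun v => (if v == v1 then 6 else 0) + (if v == vm then 6 else 0)) _).
  by rewrite leq_add2l big_split /= -[12]/(6 + 6); apply: leq_add; apply: sum_single.
move=> v vD; have [->|n1] := eqVneq v v1; first by rewrite (negbTE n1m) addn0 sa.
by have [->|n2] := eqVneq v vm; [apply: sb | apply: s0].
Qed.

Lemma heavy_all D : D \in P -> heavy D.
Proof.
move=> DP; have h : pc D by rewrite /oriented DP.
have nD : D != [::] by case/and3P: (ppart_path HP DP).
have [HD|nH] := boolP (flexible e D); first exact: heavy_H.
case: D DP h nD nH => // a D; case/lastP: D => [|C b] DP h _ nH; first exact: heavy_single.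
have [C0|nC] := eqVneq C [::]; first by rewrite C0 in h *; apply: heavy_pair.
have [cD|nc] := boolP (cyc e (a :: rcons C b)); first exact: heavy_cyc.
have [s2|s2] := leqP 2 (size C); first exact: (heavy_open e_sym eirr HP Pmin Gmin reg).
case: C h nc nC s2 {DP nH} => [|v [|]] // h nc _ _; exact: (heavy_triple e_sym eirr HP Pmin Gmin reg).
Qed.

Lemma seven_size : 7 * size P <= #|T|.
Proof.
have pT : perm_eq (flatten P) (index_enum T).
  apply: uniq_perm; first by case/and3P: HP.
    exact: index_enum_uniq.
  by move=> v; rewrite mem_index_enum; have /and3P[_ _ /forallP ->] := HP.
have tot (F : T -> nat) : \sum_(v : T) F v = \sum_(D <- P) \sum_(v <- D) F v.
  by rewrite -(perm_big _ pT) big_flatten.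
have le : \sum_(v : T) pay v + 84 * size P <= \sum_(v : T) (12 + gain v).
  have -> : 84 * size P = \sum_(D <- P) 84 by rewrite sum_const mulnC.
  rewrite !tot -big_split /= big_seq [leqRHS]big_seq.
  by apply: leq_sum => D; apply: heavy_all.
move: le; rewrite big_split /= sum_nat_const (sum_gain P e_sym) addnC leq_add2r.
by move: #|T| (size P) => n k; arith.
Qed.

End ClosedPaths.

(** * Choice of the doubly minimal partition *)

Lemma least (X : nat -> Prop) : (exists n, X n) -> exists n, X n /\ forall m, X m -> n <= m.
Proof.
case=> n; elim: n {-2}n (leqnn n) => [|k IH] n nk Xn.
  by exists n; split=> // m _; move: nk; rewrite leqn0 => /eqP ->.
case: (Classical_Prop.classic (exists2 m, X m & m < n)) => [[m Xm mn]|no].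
  by apply: (IH m) => //; rewrite -ltnS; apply: leq_trans nk.
by exists n; split=> // m Xm; rewrite leqNgt; apply/negP => mn; apply: no; exists m.
Qed.

Theorem theorem1 (T : finType) (e : rel T) :
  simple_graph e -> regular e 6 ->
  exists P : seq (seq T), is_path_partition e P /\ 7 * size P <= #|T|.
Proof.
case=> e_sym eirr reg.
have ex0 : exists k, exists Q, ppart e Q /\ size Q = k.
  exists #|T|, [seq [:: x] | x <- enum T]; rewrite size_map -cardE; split=> //.
  have fl : flatten [seq [:: x] | x <- enum T] = enum T.
    by elim: (enum T) => //= x s ->.
  apply/and3P; split; first by apply/allP => D /mapP[x _ ->].
    by rewrite fl enum_uniq.
  by apply/forallP => v; rewrite fl mem_enum.
have [k [[Q0 [hQ0 sQ0]] kmin]] := least ex0.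
have [g0 [[P [HP [sP gP]]] gmin]] := least (ex_intro (fun penalty => exists Q, ppart e Q /\ size Q = k /\ penalties Q = penalty) _
  (ex_intro _ Q0 (conj hQ0 (conj sQ0 erefl)))).
exists P; split; first exact/ppartP.
apply: (seven_size e_sym eirr HP) => // Q hQ; first by rewrite sP; apply: kmin; exists Q.
by move=> sQ; rewrite gP; apply: gmin; exists Q; rewrite sQ sP.
Qed.
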